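(* Let $D$ be a strongly connected digraph of order $n\geq 4$ satisfying condition $A_0$. Then $D$ contains a Hamiltonian bypass, unless $D$ is isomorphic to the tournament $T(5)$.
   Context: Digraphs are finite, without loops and without multiple arcs (a pair of opposite arcs $xy$, $yx$ is allowed). For a vertex $x$, $d^+(x)$ is the number of out-neighbours, $d^-(x)$ the number of in-neighbours, and $d(x)=d^+(x)+d^-(x)$. Two distinct vertices are adjacent if at least one of the arcs $xy$, $yx$ is present. A digraph $D$ of order $n$ satisfies condition $A_0$ if for every triple of distinct vertices $x,y,z$ such that $x$ and $y$ are non-adjacent: if there is no arc from $x$ to $z$, then $d(x)+d(y)+d^+(x)+d^-(z)\geq 3n-2$; and if there is no arc from $z$ to $x$, then $d(x)+d(y)+d^-(x)+d^+(z)\geq 3n-2$. A Hamiltonian bypass in $D$ is a subdigraph obtained from a Hamiltonian cycle of $D$ (a directed cycle through all vertices) by reversing exactly one arc; equivalently, vertices $x_1,\dots,x_n$ (all vertices of $D$) with arcs $x_ix_{i+1}$ for $i\in[1,n-1]$ and the arc $x_1x_n$ present in $D$. $T(5)$ is the tournament with vertex set $\{x_1,x_2,x_3,x_4,y\}$ and arc set $\{x_1x_2,x_2x_3,x_3x_4,x_4x_1,x_1y,x_3y,yx_2,yx_4,x_1x_3,x_2x_4\}$. *)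

(* Defs.v *)
From mathcomp Require Import all_boot.
Set Implicit Arguments. Unset Strict Implicit. Unset Printing Implicit Defensive.

(* A digraph on a finite vertex type V is given by its arc relation
   [arc : rel V]; [arc x y] means the arc xy is present.  Loops are excluded
   by the hypothesis [irreflexive arc]; multiple arcs cannot occur by
   construction; opposite arcs xy, yx are allowed. *)

Section Digraph.
Variables (V : finType) (arc : rel V).

Definition outdeg (x : V) : nat := #|[set y | arc x y]|.
Definition indeg (x : V) : nat := #|[set y | arc y x]|.
Definition deg (x : V) : nat := outdeg x + indeg x.

Definition adjacent (x y : V) : bool := arc x y || arc y x.

Definition strongly_connected : Prop := forall x y : V, connect arc x y.

Definition condA0 : Prop :=
  forall x y z : V, x != y -> y != z -> x != z -> ~~ adjacent x y ->
    (~~ arc x z -> deg x + deg y + outdeg x + indeg z >= 3 * #|V| - 2) /\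
    (~~ arc z x -> deg x + deg y + indeg x + outdeg z >= 3 * #|V| - 2).

Definition has_ham_bypass : Prop :=
  exists (x1 : V) (s : seq V),
    perm_eq (x1 :: s) (enum V) /\ path arc x1 s /\ arc x1 (last x1 s).

End Digraph.

(* The tournament T(5): vertices x1,x2,x3,x4,y encoded as 0,1,2,3,4 in 'I_5. *)
Definition T5_arcs : seq (nat * nat) :=
  [:: (0,1); (1,2); (2,3); (3,0); (0,4); (2,4); (4,1); (4,3); (0,2); (1,3)].

Definition T5 : rel 'I_5 := fun a b => (nat_of_ord a, nat_of_ord b) \in T5_arcs.

Definition isomorphic (V W : finType) (arcV : rel V) (arcW : rel W) : Prop :=
  exists f : V -> W, bijective f /\ forall x y, arcW (f x) (f y) = arcV x y.

(* Main.v *)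
Require Import Defs.
From mathcomp Require Import all_boot zify.
From Stdlib Require Import Classical.
Set Implicit Arguments. Unset Strict Implicit. Unset Printing Implicit Defensive.

(** Call a pair of non-adjacent vertices bad if its degree sum is at most 2n - 2.  Adding up
    four instances of A_0 shows that bad pairs are pairwise disjoint, and a vertex that
    resists being inserted into Hamiltonian paths has small degree, hence creates bad pairs.

    Suppose that there is no Hamiltonian bypass.  A longest cycle C among those that are not
    Hamiltonian has n - 1 vertices: otherwise a shortest bypass of C through the other vertices
    jumps over vertices that cannot all be inserted into the rest of C, and these form bad pairs.

    Let y be the vertex missed by a cycle of length n - 1.  No Hamiltonian path on the other
    vertices joins two out-neighbours (or two in-neighbours) of y, so these alternate along the
    cycle, with runs of non-neighbours in between.  If y has non-neighbours, all but at most one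
    of them have large degree and can be inserted wherever we want, while the neighbours
    of y have degree at most n; cutting the cycle at a run of non-neighbours and hosting y (and
    the exceptional non-neighbour) elsewhere makes the ends of the run non-adjacent, and
    A_0 fails.  Hence every vertex missed by a cycle of length n - 1 is adjacent to all others.
    If n > 5, chords that skip one vertex are then impossible, all degrees are at
    most n - 2, and A_0 makes the out-degree drop by 4 from a vertex to its predecessor on
    the cycle, which is absurd.  If n = 5, only T(5) remains. *)

(** Almost every degree bound rests on one count: a vertex x that fits between no two consecutive
    vertices of a path from p to q on S has at most |S| - 1 arcs with S, plus one for each of the
    arcs xp and qx that is present. These end terms stay explicit, since several final inequalities
    need them to vanish. Two obstacles shape the case distinctions. A cycle longer than C is
    contradictory only if it misses a vertex, so a detour through all of the remaining vertices is
    useless unless a vertex of C is dropped as well; with just two vertices left this needs its own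
    argument. And one non-neighbour x0 of y may form a bad pair with y, in which case its degree
    does not force it into a path. Such an x0 is kept on the path, or used as the place where the
    cycle is cut, or placed between an in-neighbour and an out-neighbour of y, after showing that it
    is joined to them in the same directions as y. *)

(** * Paths, cycles and insertion *)

(* [#|V|] is elaborated with several convertible, syntactically different, carriers;
   [card_lia] folds all of them to the same atom. *)
Definition order_of (V : finType) : nat := #|V|.

Ltac card_lia :=
  intros;
  repeat match goal with
  | H : ?T |- _ => lazymatch T with
      | is_true (leq _ _) => fail | @eq nat _ _ => fail
      | is_true (leq _ _) -> _ => fail
      | _ => clear H end
  end;
  repeat match goal with
  | H : is_true (leq _ _) |- _ => revert H
  | H : is_true (leq _ _) -> _ |- _ => revert H
  | H : @eq nat _ _ |- _ => revert H
  end;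
  repeat match goal with
  | |- context [@card ?T (@mem ?A ?B (PredOfSimpl.coerce ?D))] =>
      change (@card T (@mem A B (PredOfSimpl.coerce D))) with (order_of T)
  end;
  repeat match goal with
  | |- context [@card ?T ?p] => generalize (@card T p); intro
  end;
  repeat match goal with
  | |- context [@size ?T ?t] =>
      let k := fresh "k" in
      pose k := @size T t;
      repeat match goal with |- context [@size ?T' t] => change (@size T' t) with k end;
      clearbody k
  end;
  lia.

Lemma not_path_split (T : eqType) (e : rel T) p s :
  ~~ path e p s -> exists s1 w s2, s = s1 ++ w :: s2 /\ ~~ e (last p s1) w.
Proof.
elim: s p => [|z s IH] p //=; rewrite negb_and => /orP[npz|/IH[s1 [w [s2 [-> nw]]]]].
  by exists [::], z, s.
by exists (z :: s1), w, s2.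
Qed.

(** Each consecutive pair u, w accounts for at most one of [a u] and [b w]; the terms left over are
    [b] at the first vertex and [a] at the last. *)
Lemma path_pair_count (T : eqType) (a b : pred T) p s :
  path (fun u w => ~~ (a u && b w)) p s ->
  count a (p :: s) + count b (p :: s) <= size s + b p + a (last p s).
Proof.
elim: s p => [|z s IH] p /=; first by lia.
by move=> /andP[npz /IH /=]; case: (a p) npz; case: (b z) => //=; lia.
Qed.

Lemma card_setI_seq (V : finType) (A : {set V}) (l : seq V) :
  uniq l -> #|A :&: [set z in l]| = count (mem A) l.
Proof.
move=> ul; rewrite -size_filter -(card_uniqP (filter_uniq _ ul)).
by apply: eq_card => z; rewrite !inE mem_filter.
Qed.

Lemma card_set_seq (V : finType) (l : seq V) : uniq l -> #|[set z in l]| = size l.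
Proof. by move=> ul; rewrite -(card_uniqP ul); apply: eq_card => z; rewrite inE. Qed.

Lemma disjoint_setD (V : finType) (A B : {set V}) : [disjoint A :\: B & B].
Proof. by rewrite -setI_eq0; apply/eqP/setP => z; rewrite !inE; case: (z \in B); rewrite ?andbF. Qed.

Lemma setD_setU (V : finType) (A B : {set V}) : B \subset A -> A :\: B :|: B = A.
Proof.
move=> BA; apply/setP => z; rewrite !inE.
by case: (boolP (z \in B)) => [/(subsetP BA) ->|]; rewrite ?orbT ?orbF.
Qed.

Lemma set_seq_cat (V : finType) (l1 l2 : seq V) :
  [set z in l1 ++ l2] = [set z in l1] :|: [set z in l2].
Proof. by apply/setP => z; rewrite !inE mem_cat. Qed.

Lemma ex_minimal (P : nat -> Prop) :
  (exists n, P n) -> exists n, P n /\ forall k, P k -> n <= k.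
Proof.
case=> n; elim/ltn_ind: n => n IH Pn.
case: (classic (exists k, k < n /\ P k)) => [[k [kn Pk]]|nk]; first exact: IH kn Pk.
exists n; split=> // k Pk; rewrite leqNgt; apply/negP => kn; apply: nk; by exists k.
Qed.

Section Core.
Variables (V : finType) (arc : rel V).

Definition outs (x : V) := [set z | arc x z].
Definition ins (x : V) := [set z | arc z x].
Definition dd (x : V) (A : {set V}) := #|outs x :&: A| + #|ins x :&: A|.

(** A Hamiltonian path of the subdigraph induced by [S]. Only the ends are recorded, because
    insertion changes the order of the vertices but not the ends. *)
Definition hp (S : {set V}) (p q : V) : Prop :=
  exists s, [/\ path arc p s, last p s = q, uniq (p :: s) & S = [set z in p :: s]].

Definition hcyc (S : {set V}) : Prop := exists p q, hp S p q /\ arc q p.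

Lemma outdegE x : outdeg arc x = #|outs x|. Proof. by []. Qed.
Lemma indegE x : indeg arc x = #|ins x|. Proof. by []. Qed.

Lemma ddE x A : dd x A = #|outs x :&: A| + #|ins x :&: A|. Proof. by []. Qed.

Lemma degE x : deg arc x = dd x setT.
Proof. by rewrite /deg outdegE indegE /dd !setIT. Qed.

Lemma cardI_disj (B A1 A2 : {set V}) : [disjoint A1 & A2] ->
  #|B :&: (A1 :|: A2)| = #|B :&: A1| + #|B :&: A2|.
Proof.
move=> dis; rewrite setIUr cardsU [_ :&: _ :&: _](_ : _ = set0) ?cards0 ?subn0 //.
apply/setP => z; rewrite !inE; apply/negbTE/negP => /andP[/andP[_ z1] /andP[_ z2]].
by move/pred0P: dis => /(_ z) /=; rewrite z1 z2.
Qed.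

Lemma ddU x (A1 A2 : {set V}) : [disjoint A1 & A2] -> dd x (A1 :|: A2) = dd x A1 + dd x A2.
Proof. by move=> dis; rewrite /dd !cardI_disj //; lia. Qed.

Lemma dd_split x (A B : {set V}) : B \subset A -> dd x A = dd x B + dd x (A :\: B).
Proof.
move=> BA; rewrite -ddU; first by rewrite setDE setUIr setUCr setIT (setUidPr BA).
by rewrite -setI_eq0; apply/eqP/setP => z; rewrite !inE; case: (z \in B).
Qed.

Lemma dd_le x A : dd x A <= 2 * #|A|.
Proof.
rewrite /dd mul2n -addnn leq_add //; apply: subset_leq_card; exact: subsetIr.
Qed.

Lemma setI_pred0 (B A : {set V}) : (forall z, z \in A -> z \notin B) -> #|B :&: A| = 0.
Proof.
move=> H; apply/eqP; rewrite cards_eq0; apply/eqP/setP => z; rewrite !inE.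
by case: (boolP (z \in A)) => [/H /negbTE ->|]; rewrite ?andbF.
Qed.

Lemma dd0 x (A : {set V}) : (forall z, z \in A -> ~~ arc x z && ~~ arc z x) -> dd x A = 0.
Proof. by move=> nA; rewrite /dd !setI_pred0 // => z /nA /andP[]; rewrite inE. Qed.

Lemma dd1 x z : dd x [set z] = arc x z + arc z x.
Proof.
have E (B : {set V}) : #|B :&: [set z]| = (z \in B).
  case: (boolP (z \in B)) => zB; first by rewrite (setIidPr _) ?sub1set // cards1.
  rewrite (_ : _ :&: _ = set0) ?cards0 //; apply/setP => w; rewrite !inE.
  by case: eqP => [->|]; rewrite ?andbF // (negbTE zB).
by rewrite /dd !E !inE.
Qed.

Lemma dd_self x (A : {set V}) : irreflexive arc -> x \in A -> dd x A = dd x (A :\ x).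
Proof.
move=> irr xA; rewrite (@dd_split x A [set x]) ?sub1set // dd1 irr //.
Qed.

Lemma joint_le (B1 B2 A : {set V}) :
  (forall z, z \in A -> ~~ ((z \in B1) && (z \in B2))) -> #|B1 :&: A| + #|B2 :&: A| <= #|A|.
Proof.
move=> dis; rewrite -cardsUI [B1 :&: A :&: _](_ : _ = set0) ?cards0 ?addn0.
  by apply: subset_leq_card; apply/subsetP => z; rewrite !inE => /orP[] /andP[].
apply/setP => z; rewrite !inE; apply/negbTE/negP => /andP[/andP[z1 zA] /andP[z2 _]].
by move/negP: (dis z zA); apply; rewrite z1 z2.
Qed.

Lemma joint_dd x r (A : {set V}) :
  (forall z, z \in A -> ~~ (arc x z && arc z r) && ~~ (arc r z && arc z x)) ->
  dd x A + dd r A <= 2 * #|A|.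
Proof.
move=> H.
have h1 : #|outs x :&: A| + #|ins r :&: A| <= #|A|.
  by apply: joint_le => z /H /andP[]; rewrite !inE.
have h2 : #|outs r :&: A| + #|ins x :&: A| <= #|A|.
  by apply: joint_le => z /H /andP[_]; rewrite !inE.
by rewrite /dd; lia.
Qed.

Lemma hp1 p : hp [set p] p p.
Proof. by exists [::]; split=> //; apply/setP => z; rewrite !inE. Qed.

Lemma hp_seq p s : path arc p s -> uniq (p :: s) -> hp [set z in p :: s] p (last p s).
Proof. by move=> *; exists s; split. Qed.

Lemma hp_first S p q : hp S p q -> p \in S.
Proof. by case=> s [_ _ _ ->]; rewrite !inE eqxx. Qed.

Lemma hp_last S p q : hp S p q -> q \in S.
Proof. by case=> s [_ <- _ ->]; rewrite inE mem_last. Qed.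

Lemma hp_cat (S T : {set V}) p q p' q' : hp S p q -> hp T p' q' -> arc q p' -> [disjoint S & T] ->
  hp (S :|: T) p q'.
Proof.
move=> [s [ps ls us ->]] [t [pt lt ut ->]] qp dis; exists (s ++ p' :: t); split.
- by rewrite cat_path ps /= ls qp.
- by rewrite last_cat.
- rewrite -cat_cons cat_uniq us ut andbT; apply/negP => /hasP[z zt zs].
  by move/pred0P: dis => /(_ z) /=; rewrite !in_set zs zt.
- by rewrite -cat_cons set_seq_cat.
Qed.

Lemma hp_consl (S : {set V}) v p q : hp S p q -> arc v p -> v \notin S -> hp (v |: S) v q.
Proof. by move=> h vp vS; apply: hp_cat (hp1 v) h vp _; rewrite disjoints1. Qed.

Lemma hp_consr (S : {set V}) v p q : hp S p q -> arc q v -> v \notin S -> hp (v |: S) p v.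
Proof.
move=> h vp vS; rewrite setUC; apply: hp_cat h (hp1 v) vp _.
by rewrite disjoint_sym disjoints1.
Qed.

Lemma hp_insert (S : {set V}) p q x : hp S p q -> x \notin S ->
  hp (x |: S) p q \/ dd x S < #|S| + arc x p + arc q x.
Proof.
move=> [s [ps ls us ->]] xS.
case: (boolP (path (fun u w => ~~ (arc u x && arc x w)) p s)) => [np|].
  right; rewrite /dd !card_setI_seq // card_set_seq //=.
  have := path_pair_count np; rewrite ls /=.
  have E : count (mem (outs x)) =1 count (arc x) by move=> l; apply: eq_count => z; rewrite /= inE.
  have F : count (mem (ins x)) =1 count (arc^~ x) by move=> l; apply: eq_count => z; rewrite /= inE.
  by rewrite E F !inE /=; lia.
move=> /not_path_split [s1 [w [s2 [Es]]]]; rewrite negbK => /andP[ux xw]; left.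
exists (s1 ++ x :: w :: s2); split.
- by move: ps; rewrite Es !cat_path /= => /and3P[-> _ ->]; rewrite ux xw.
- by rewrite -ls Es !last_cat.
- rewrite (perm_uniq (s2 := x :: p :: s)).
    by rewrite cons_uniq us andbT; move: xS; rewrite inE.
  by rewrite Es -!cat_cons perm_catC /= perm_cons -!cat_cons perm_catC.
- apply/setP => z; rewrite Es !(inE, mem_cat).
  by case: (z == x); case: (z == p); case: (z \in s1); case: (z == w).
Qed.

(** Greedy insertion: vertices of [G] go in as long as one fits, and [U] is what remains. The bound
    refers to the final, enlarged path. *)
Lemma hp_multi_insert (S : {set V}) p q (G : {set V}) : hp S p q -> [disjoint S & G] ->
  exists U : {set V}, [/\ U \subset G, hp (S :|: (G :\: U)) p q &
    forall x, x \in U ->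
      dd x (S :|: (G :\: U)) < #|S :|: (G :\: U)| + arc x p + arc q x].
Proof.
have [k] := ubnP #|G|; elim: k => // k IH in S G *.
rewrite ltnS => Gk hS dis.
case: (classic (exists2 x, x \in G & hp (x |: S) p q)) => [[x xG hx]|no]; last first.
  exists G; split=> //; rewrite setDv setU0 // => x xG.
  case: (@hp_insert S p q x hS) => //.
    apply/negP => xS; by move/pred0P: dis => /(_ x) /=; rewrite xS xG.
  by move=> hx; case: no; exists x.
have := IH (x |: S) (G :\ x) _ hx.
case.
- by rewrite (cardsD1 x) xG in Gk.
- rewrite -setI_eq0; apply/eqP/setP => z; rewrite !inE.
  case: (eqVneq z x) => //= _; apply/negbTE/negP => /andP[zS zG].
  by move/pred0P: dis => /(_ z) /=; rewrite zS zG.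
move=> U [UG hU bU]; have xU : x \notin U by apply/negP => /(subsetP UG); rewrite !inE eqxx.
have E : (x |: S) :|: (G :\ x :\: U) = S :|: (G :\: U).
  apply/setP => z; rewrite !inE; case: (eqVneq z x) => [->|] //=.
  by rewrite xU xG orbT.
exists U; rewrite -E; split=> //; apply: subset_trans UG (subsetDl _ _).
Qed.

(* The vertices that resist a maximal insertion: each of them has few arcs to the host
   path, and at most two arcs to each of the other resisting vertices. *)
Lemma hp_absorb (S : {set V}) p q (G : {set V}) : irreflexive arc -> hp S p q -> [disjoint S & G] ->
  exists U : {set V}, [/\ U \subset G, hp (S :|: (G :\: U)) p q &
    forall x, x \in U ->
      dd x (S :|: G) + 3 <= #|S :|: G| + #|U| + arc x p + arc q x].
Proof.
move=> irr hS dis; have [U [UG hU bU]] := hp_multi_insert hS dis.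
exists U; split=> // x xU; have := bU x xU.
have E : S :|: G = (S :|: (G :\: U)) :|: U.
  by apply/setP => z; rewrite !inE; case: (boolP (z \in U)) => [/(subsetP UG) ->|]; rewrite ?orbT ?orbF.
have dU : [disjoint S :|: (G :\: U) & U].
  rewrite -setI_eq0; apply/eqP/setP => z; rewrite !inE.
  case: (boolP (z \in U)); rewrite ?andbF // => /(subsetP UG) zG; rewrite orbF andbT.
  by apply/negbTE/negP => zS; move/pred0P: dis => /(_ z) /=; rewrite zS zG.
have cE : #|S :|: G| = #|S :|: (G :\: U)| + #|U|.
  by rewrite E cardsU (_ : _ :&: _ = set0) ?cards0 ?subn0 //; apply/eqP; rewrite setI_eq0.
have -> : dd x (S :|: G) = dd x (S :|: (G :\: U)) + dd x U by rewrite E ddU.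
rewrite cE; have := dd_le x (U :\ x); rewrite -(@dd_self x U) //; have := cardsD1 x U; rewrite xU.
by lia.
Qed.

Lemma no_bypass_hp p q : ~ has_ham_bypass arc -> hp setT p q -> ~~ arc p q.
Proof.
move=> nb [s [ps ls us E]]; apply/negP => pq; apply: nb; exists p, s; split; last first.
  by split=> //; rewrite ls.
apply: uniq_perm => //; first exact: enum_uniq.
by move=> z; rewrite mem_enum /=; have := in_setT z; rewrite E inE.
Qed.

End Core.

(** * Condition A_0 and bad pairs *)

Section Degrees.
Variables (V : finType) (arc : rel V).
Hypothesis A0 : condA0 arc.
Local Notation n := #|V|.
Local Notation outs := (outs arc).
Local Notation ins := (ins arc).
Local Notation deg := (deg arc).

Lemma A0_out x y z : x != y -> y != z -> x != z -> ~~ adjacent arc x y -> ~~ arc x z ->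
  3 * n <= deg x + deg y + #|outs x| + #|ins z| + 2.
Proof.
move=> xy yz xz nxy xz'; have [/(_ xz') + _] := A0 xy yz xz nxy.
by rewrite outdegE indegE; lia.
Qed.

Lemma A0_in x y z : x != y -> y != z -> x != z -> ~~ adjacent arc x y -> ~~ arc z x ->
  3 * n <= deg x + deg y + #|ins x| + #|outs z| + 2.
Proof.
move=> xy yz xz nxy xz'; have [_ /(_ xz')] := A0 xy yz xz nxy.
by rewrite outdegE indegE; lia.
Qed.

Lemma adjacentC x y : adjacent arc x y = adjacent arc y x.
Proof. by rewrite /adjacent orbC. Qed.

Lemma degD x : deg x = #|outs x| + #|ins x|.
Proof. by []. Qed.

Definition bad x y := [&& x != y, ~~ adjacent arc x y & deg x + deg y + 2 <= 2 * n].

Lemma badC x y : bad x y = bad y x.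
Proof. by rewrite /bad eq_sym adjacentC [deg x + _]addnC. Qed.

(** The pair x, y is tested with third vertex z and the pair x, z with third vertex y, in both
    directions. The sum is 12n <= 3(d(x) + d(y)) + 3(d(x) + d(z)) + 8, while badness bounds the
    right side by 12n - 4. *)
Lemma bad_uniq x y z : bad x y -> bad x z -> y = z.
Proof.
move=> /and3P[xy nxy dxy] /and3P[xz nxz dxz]; apply/eqP/negPn/negP => yz.
have /andP[a1 a2] : ~~ arc x z && ~~ arc z x by rewrite -negb_or.
have /andP[b1 b2] : ~~ arc x y && ~~ arc y x by rewrite -negb_or.
have zy : z != y by rewrite eq_sym.
have := A0_out xy yz xz nxy a1; have := A0_in xy yz xz nxy a2.
have := A0_out xz zy xy nxz b1; have := A0_in xz zy xy nxz b2.
by move: dxy dxz; rewrite !degD; lia.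
Qed.

Lemma deg_split x (A : {set V}) : deg x = dd arc x A + dd arc x (~: A).
Proof. by rewrite degE (dd_split arc x (subsetT A)) setTD. Qed.

Lemma outs_split x (A : {set V}) : #|outs x| = #|outs x :&: A| + #|outs x :&: ~: A|.
Proof. by rewrite -setDE cardsID. Qed.

Lemma ins_split x (A : {set V}) : #|ins x| = #|ins x :&: A| + #|ins x :&: ~: A|.
Proof. by rewrite -setDE cardsID. Qed.

Lemma card_splitC (A : {set V}) : #|A| + #|~: A| = n.
Proof. exact: cardsC. Qed.

End Degrees.

Section Reverse.
Variables (V : finType) (arc : rel V).

Lemma hp_revP (e : rel V) S p q : hp e S p q -> hp (fun x y => e y x) S q p.
Proof.
case=> s [ps ls us ->]; exists (rev (belast p s)).
have E : q :: rev (belast p s) = rev (p :: s) by rewrite [p :: s]lastI ls rev_rcons.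
split.
- by rewrite -ls rev_path.
- case: s ps ls us E => [|z s] /= _ ls _ _; first by rewrite -ls.
  by rewrite rev_cons last_rcons.
- by rewrite E rev_uniq.
- by rewrite E; apply/setP => z; rewrite !inE mem_rev inE.
Qed.

End Reverse.

(** * Counting along a cycle; reachability inside a set *)

Section Cycles.
Variables (V : finType) (arc : rel V).
Local Notation hp := (hp arc).
Local Notation hcyc := (hcyc arc).

Lemma hcycP S : hcyc S -> exists c, [/\ c != [::], uniq c, cycle arc c & S = [set z in c]].
Proof.
by move=> [p [q [[s [ps ls us ->]] qp]]]; exists (p :: s); split=> //=; rewrite rcons_path ps ls.
Qed.

Lemma cycle_hcyc p s : uniq (p :: s) -> cycle arc (p :: s) -> hcyc [set z in p :: s].
Proof.
by rewrite /= rcons_path => us /andP[ps lp]; exists p, (last p s); split=> //; exists s.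
Qed.

Lemma cycle_shift_count (C A B : {set V}) (f : V -> V) :
  injective f -> (forall v, v \in C -> f v \in C) ->
  (forall v, v \in C -> ~~ ((v \in A) && (f v \in B))) ->
  #|A :&: C| + #|B :&: C| <= #|C|.
Proof.
move=> fI fC H; have cf : #|f @: (A :&: C)| = #|A :&: C| by exact: card_imset.
have sub : (f @: (A :&: C)) \subset C :\: B.
  apply/subsetP => w /imsetP[v]; rewrite !inE => /andP[vA vC] ->.
  by have := H v vC; rewrite vA /= => ->; exact: fC.
by have := subset_leq_card sub; have := cardsID B C; rewrite cf [C :&: B]setIC; lia.
Qed.

(** Deleting the arc from [v] to [next c v] leaves a Hamiltonian path of [C] from [next c v] to [v],
    so the shift by one sends [A] into the complement of [B]. *)
Lemma cycle_count1 (C A B : {set V}) : hcyc C ->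
  (forall u w, hp C u w -> ~~ ((w \in A) && (u \in B))) -> #|A :&: C| + #|B :&: C| <= #|C|.
Proof.
move=> /hcycP[c [_ uc cc ->]] H; apply: (@cycle_shift_count _ _ _ (next c)).
- exact: can_inj (prev_next uc).
- by move=> v; rewrite !inE mem_next.
move=> v; rewrite inE => vc; have [i t Et] := rot_to vc.
have ut : uniq (v :: t) by rewrite -Et rot_uniq.
have ct : cycle arc (v :: t) by rewrite -Et rot_cycle.
rewrite -(next_rot i uc) Et; apply: H.
have -> : [set z in c] = [set z in rcons t v].
  by apply/setP => z; rewrite !inE mem_rcons -Et mem_rot.
case: t ut ct {Et} => [|w t] ut ct.
  by rewrite /= eqxx [X in hp X](_ : _ = [set v]); [exact: hp1 | apply/setP => z; rewrite !inE].
rewrite /= eqxx -[X in hp _ _ X](last_rcons w t v); apply: hp_seq.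
  by move: ct; rewrite /= => /andP[].
by rewrite -rcons_cons rcons_uniq.
Qed.

(** The same count with the shift by two: deleting the vertex after [v] leaves a path on the other
    vertices of [C] that ends in [v]. *)
Lemma cycle_count2 (C A B : {set V}) : irreflexive arc -> hcyc C ->
  (forall u v w, v \in C -> hp (C :\ v) u w -> ~~ ((w \in A) && (u \in B))) ->
  #|A :&: C| + #|B :&: C| <= #|C|.
Proof.
move=> irr /hcycP[c [_ uc cc ->]] H.
apply: (@cycle_shift_count _ _ _ (fun v => next c (next c v))).
- by move=> u v /(can_inj (prev_next uc)) /(can_inj (prev_next uc)).
- by move=> v; rewrite !inE !mem_next.
move=> v; rewrite inE => vc; have [i t Et] := rot_to vc.
have ut : uniq (v :: t) by rewrite -Et rot_uniq.
have ct : cycle arc (v :: t) by rewrite -Et rot_cycle.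
rewrite -!(next_rot i uc) Et.
case: t ut ct Et => [|w t] ut ct Et; first by rewrite /= irr in ct.
have wv : w == v = false by move: ut; rewrite /= inE negb_or eq_sym => /and3P[/andP[/negbTE]].
have [wt vt] : w \notin t /\ v \notin t.
  by move: ut; rewrite /= inE negb_or => /and3P[/andP[_ ->] ->].
have ut' : uniq t by move: ut => /= /and3P[].
apply: (H _ w).
  by rewrite inE -[w \in c](mem_rot i) Et !inE eqxx orbT.
have -> : [set z in c] :\ w = [set z in rcons t v].
  apply/setP => z; rewrite !inE mem_rcons inE -[z \in c](mem_rot i) Et !inE.
  by case: (eqVneq z w) => [->|] //=; rewrite wv (negbTE wt).
(* On a cycle of two vertices the shift by two is the identity and the path is the single vertex
   [v]. *)
case: t ut ct Et wt vt ut' => [|x t] ut ct Et wt vt ut'; rewrite /= eqxx wv ?eqxx.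
  by rewrite [X in hp X](_ : _ = [set v]); [exact: hp1 | apply/setP => z; rewrite !inE].
rewrite -[X in hp _ _ X](last_rcons x t v); apply: hp_seq.
  by move: ct; rewrite /= => /and3P[].
by rewrite -rcons_cons rcons_uniq vt.
Qed.

Definition inside (R : {set V}) : rel V := fun u w => [&& arc u w, u \in R & w \in R].

Lemma inside_conn (R : {set V}) u w : u \in R -> connect (inside R) u w -> w \in R.
Proof.
move=> uR /connectP[s ps ->]; elim: s u uR ps => [|z s IH] u uR //= /andP[/and3P[_ _ zR]].
exact: IH.
Qed.

Lemma inside_hp (R : {set V}) u w : u \in R -> connect (inside R) u w ->
  exists2 P : {set V}, P \subset R & hp P u w.
Proof.
move=> uR /connectP[s ps ->]; case: (shortenP ps) => t pt ut _ {s ps}.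
have aR : {subset u :: t <= R}.
  elim: t u uR pt {ut} => [|v t IH] u uR /=.
    by move=> _ z; rewrite inE => /eqP ->.
  case/andP=> /and3P[_ _ vR] pt z; rewrite inE => /predU1P[-> //|]; exact: IH.
exists [set z in u :: t]; first by apply/subsetP => z; rewrite inE => /aR.
exists t; split=> //; elim: t u uR pt {ut aR} => [|v t IH] u uR //= /andP[/and3P[-> _ vR]].
exact: IH.
Qed.

Lemma hp_inside (R P : {set V}) u w : P \subset R -> hp P u w -> connect (inside R) u w.
Proof.
move=> PR [s [ps ls us E]]; apply/connectP; exists s => //.
have : forall z, z \in u :: s -> z \in R.
  by move=> z zs; apply: (subsetP PR); rewrite E inE.
elim: s u ps {us E ls} => [|z s IH] u //= /andP[uz ps] H.
rewrite /inside uz !H ?inE ?eqxx ?orbT //=; apply: IH => // x xs; apply: H.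
by rewrite inE xs orbT.
Qed.

Lemma inside_trans (R : {set V}) u v w : connect (inside R) u v -> connect (inside R) v w ->
  connect (inside R) u w.
Proof. exact: connect_trans. Qed.

Lemma inside1 (R : {set V}) u w : arc u w -> u \in R -> w \in R -> connect (inside R) u w.
Proof. by move=> *; apply: connect1; apply/and3P. Qed.

End Cycles.

(** * A longest non-Hamiltonian cycle *)

Section Chop.
Variables (V : finType) (arc : rel V).
Local Notation hp := (hp arc).
Local Notation hcyc := (hcyc arc).

(* G is the set of vertices strictly between p and q on a cycle with vertex set C. *)
Definition chop (C G : {set V}) (p q : V) : Prop := exists g t,
  [/\ uniq (p :: g ++ q :: t), cycle arc (p :: g ++ q :: t),
      C = [set z in p :: g ++ q :: t] & G = [set z in g]].

Lemma chop_ex C p q : hcyc C -> p \in C -> q \in C -> p != q -> exists G, chop C G p q.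
Proof.
move=> /hcycP[c [_ uc cc ->]]; rewrite !inE => pc qc pq; have [i t Et] := rot_to pc.
have : q \in p :: t by rewrite -Et mem_rot.
rewrite inE eq_sym (negbTE pq) /= => qt.
case/splitPr: qt Et => g t' Et; exists [set z in g], g, t'.
rewrite -Et rot_uniq rot_cycle; split=> //; apply/setP => z; by rewrite !inE mem_rot.
Qed.

Section Facts.
Variables (C G : {set V}) (p q : V).
Hypothesis ch : chop C G p q.

Lemma chop_sub : G \subset C.
Proof.
case: ch => g [t [_ _ -> ->]]; apply/subsetP => z; rewrite !inE mem_cat => ->.
by rewrite orbT.
Qed.

Lemma chop_hp : hp (C :\: G) q p.
Proof.
case: ch => g [t [u c -> ->]].
have E : [set z in p :: g ++ q :: t] :\: [set z in g] = [set z in q :: rcons t p].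
  move: u; rewrite /= mem_cat cat_uniq => /and3P[pg ug /andP[/hasPn gq uq]].
  apply/setP => z; rewrite !inE mem_cat mem_rcons !inE.
  case: (boolP (z \in g)) => /= [zg|_]; last by rewrite orbCA.
  case: (eqVneq z p) => [zp|_]; first by rewrite -zp zg in pg.
  case: (eqVneq z q) => [zq|_]; first by have := gq q; rewrite inE eqxx -zq zg => /(_ isT).
  by apply/esym/negP => /= zt; have := gq z; rewrite inE zt orbT zg => /(_ isT).
have c' : cycle arc ((q :: t) ++ p :: g).
  by move: c; rewrite -cat_cons -rot_size_cat rot_cycle.
rewrite E -[X in hp _ _ X](last_rcons q t p); apply: hp_seq.
  move: c'; rewrite /= rcons_path cat_path /= rcons_path => /andP[/and3P[-> -> _] _] //.
move: u; rewrite -cat_cons cat_uniq => /and3P[u1 /hasPn h u2].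
rewrite -rcons_cons rcons_uniq u2 andbT; apply/negP => pq; have := h p pq.
by rewrite inE eqxx.
Qed.

Lemma chop_neq : p != q.
Proof.
case: ch => g [t [u _ _ _]]; move: u; rewrite /= mem_cat inE !negb_or.
by case/andP => /andP[_ /andP[]].
Qed.

Lemma chop_in : p \in C /\ q \in C.
Proof. by case: ch => g [t [_ _ -> _]]; split; [rewrite !inE eqxx | rewrite !inE mem_cat inE eqxx !orbT]. Qed.

Lemma chop_fill S : hp S q p -> [disjoint S & G] -> hcyc (S :|: G).
Proof.
case: ch => g [t [u c _ ->]] hS dis.
case: g u c dis => [|z g] /= u c dis.
  case/andP: c => pq _; exists q, p; split=> //.
  by rewrite (_ : [set z in [::]] = set0) ?setU0 //; apply/setP => z; rewrite !inE.
move: c; rewrite rcons_cat cat_path => /and3P[pz zg /= /andP[lq _]].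
exists q, (last z g); split=> //; apply: hp_cat hS _ pz dis.
apply: hp_seq => //; case/andP: u => _.
by rewrite -[_ && _]/(uniq ((z :: g) ++ q :: t)) cat_uniq => /andP[].
Qed.

Lemma chop_left x : x \in G -> exists G', [/\ chop C G' p x, #|G'| < #|G| & G' \subset G].
Proof.
case: ch => g [t [u c EC ->]]; rewrite inE => xg; case/splitPr: xg u c EC => g1 g2 u c EC.
exists [set z in g1]; split.
- exists g1, (g2 ++ q :: t); rewrite -catA in EC u c *.
  by split.
- have ug : uniq (g1 ++ x :: g2).
    by move: u; rewrite /= cat_uniq => /and3P[_ ->].
  rewrite !card_set_seq ?size_cat /=; first by lia.
    by move: ug.
  by move: ug; rewrite cat_uniq => /and3P[].
- by apply/subsetP => z; rewrite !inE mem_cat => ->.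
Qed.

Lemma chop_right x : x \in G -> exists G', [/\ chop C G' x q, #|G'| < #|G| & G' \subset G].
Proof.
case: ch => g [t [u c EC ->]]; rewrite inE => xg; case/splitPr: xg u c EC => g1 g2 u c EC.
have Er : p :: (g1 ++ x :: g2) ++ q :: t = (p :: g1) ++ (x :: g2 ++ q :: t).
  by rewrite -catA.
have Er' : x :: g2 ++ q :: (t ++ p :: g1) = (x :: g2 ++ q :: t) ++ (p :: g1).
  by rewrite /= -catA.
exists [set z in g2]; split.
- exists g2, (t ++ p :: g1); rewrite Er'; split=> //.
  + by move: u; rewrite Er uniq_catC.
  + by move: c; rewrite Er -rot_size_cat rot_cycle.
  + by rewrite EC Er !set_seq_cat setUC.
- have ug : uniq (g1 ++ x :: g2).
    by move: u; rewrite /= cat_uniq => /and3P[_ ->].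
  rewrite !card_set_seq ?size_cat /=; first by lia.
    by move: ug.
  by move: ug; rewrite cat_uniq => /and3P[_ _ /andP[]].
- by apply/subsetP => z; rewrite !inE mem_cat inE => ->; rewrite !orbT.
Qed.

End Facts.

(** The pair with the fewest vertices in between is taken: a link between an end and an inner vertex
    would have a smaller gap. *)
Lemma chop_min (L : V -> V -> Prop) C p q : hcyc C -> p \in C -> q \in C -> p != q -> L p q ->
  exists p' q' G, [/\ chop C G p' q', L p' q' &
    forall x, x \in G -> ~ L p' x /\ ~ L x q'].
Proof.
move=> hC pC qC pq Lpq.
pose P k := exists p' q' G, [/\ chop C G p' q', L p' q' & #|G| = k].
have [k [[p' [q' [G [ch L' Gk]]]] kmin]] : exists k, P k /\ forall j, P j -> k <= j.
  apply: ex_minimal; have [G ch] := chop_ex hC pC qC pq.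
  by exists #|G|, p, q, G.
exists p', q', G; split=> // x xG; split=> Lx.
  have [G' [ch' lt _]] := chop_left ch xG.
  by have := kmin #|G'|; rewrite leqNgt -Gk lt; move=> H; apply: (notF); apply: H; exists p', x, G'.
have [G' [ch' lt _]] := chop_right ch xG.
by have := kmin #|G'|; rewrite leqNgt -Gk lt; move=> H; apply: (notF); apply: H; exists x, q', G'.
Qed.

End Chop.

Section ListHam.
Variables (V : finType) (arc : rel V).
Local Notation hp := (hp arc).

Lemma card_ex (A : {set V}) : 0 < #|A| -> exists x, x \in A.
Proof. by move=> /card_gt0P. Qed.

Lemma card_ex2 (A : {set V}) z : 1 < #|A| -> exists2 x, x \in A & x != z.
Proof.
move=> A2; have : 0 < #|A :\ z| by have := cardsD1 z A; case: (z \in A) => /=; card_lia.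
by case/card_gt0P => x; rewrite !inE => /andP[]; exists x.
Qed.

Lemma card_ex3 (A : {set V}) z w : 2 < #|A| -> exists x, [/\ x \in A, x != z & x != w].
Proof.
move=> A3; have : 1 < #|A :\ z| by have := cardsD1 z A; case: (z \in A) => /=; card_lia.
by case/(card_ex2 w) => x; rewrite !inE => /andP[]; exists x.
Qed.

Lemma card_gt1_ex (A : {set V}) : 1 < #|A| -> exists u w, [/\ u \in A, w \in A & u != w].
Proof.
move=> A2; have [u uA] : exists u, u \in A by apply: card_ex; card_lia.
by have [w wA wu] := card_ex2 u A2; exists u, w; rewrite eq_sym.
Qed.

Lemma cardID1 (B A : {set V}) z : z \notin B -> #|B :&: A| = #|B :&: (A :\ z)|.
Proof.
move=> zB; apply: eq_card => w; rewrite !inE; case: eqVneq => [->|] //=.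
by rewrite (negbTE zB) andbF.
Qed.

Lemma hp_suffix S w b u : hp S w b -> u \in S -> u != w ->
  exists S' : {set V}, [/\ S' \subset S, w \notin S' & hp S' u b].
Proof.
move=> [s [ps ls us ->]]; rewrite inE => /predU1P[->|us']; first by rewrite eqxx.
move=> uw; case/splitPr: us' ps ls us => s1 s2; rewrite cat_path last_cat /= => /and3P[_ _ p2] ls us.
exists [set z in u :: s2]; split.
- by apply/subsetP => z; rewrite !inE !mem_cat inE => ->; rewrite !orbT.
- case/andP: us; rewrite mem_cat in_cons !negb_or => /and3P[_ wu ws] _.
  by rewrite !inE negb_or wu.
- exists s2; split=> //; move: us => /andP[_]; by rewrite cat_uniq => /and3P[].
Qed.

(** Following the cycle from [z] round to [x] gives a Hamiltonian path, which an arc from [z] to [x]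
    would turn into a bypass. *)
Lemma reverse_consecutive l1 x z l2 : ~ has_ham_bypass arc ->
  uniq (l1 ++ x :: z :: l2) -> [set v in l1 ++ x :: z :: l2] = setT ->
  cycle arc (l1 ++ x :: z :: l2) -> ~~ arc z x.
Proof.
move=> nb ul El cl; apply: no_bypass_hp nb _.
have E2 : rcons l1 x ++ z :: l2 = l1 ++ x :: z :: l2 by rewrite cat_rcons.
have cl2 : cycle arc (z :: l2 ++ rcons l1 x).
  by rewrite -cat_cons -(rot_size_cat (rcons l1 x)) rot_cycle E2.
have ul2 : uniq (z :: l2 ++ rcons l1 x) by rewrite -cat_cons uniq_catC E2.
exists (l2 ++ rcons l1 x); split=> //.
- by move: cl2; rewrite /= rcons_path => /andP[].
- by rewrite last_cat last_rcons.
- by rewrite -cat_cons set_seq_cat setUC -set_seq_cat E2 El.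
Qed.

Lemma not_both_before (l : seq V) x z : x \in l -> z \in l -> x != z ->
  (exists l1 l2 l3, l = l1 ++ x :: l2 ++ z :: l3) \/
  (exists l1 l2 l3, l = l1 ++ z :: l2 ++ x :: l3).
Proof.
move=> xl; case/splitPr: xl => l1 l2; rewrite mem_cat inE => zl xz.
have {zl}/orP[zl|zl] : (z \in l1) || (z \in l2).
  by move: zl; rewrite eq_sym (negbTE xz).
- by right; case/splitPr: zl => a b; exists a, b, l2; rewrite -catA.
- by left; case/splitPr: zl => a b; exists l1, a, b.
Qed.

(** Of two opposite arcs one runs forward along [l], hence is an arc of the Hamiltonian cycle, and
    then the other one is excluded. *)
Lemma chordless_oriented (l0 l l4 : seq V) : ~ has_ham_bypass arc ->
  uniq (l0 ++ l ++ l4) -> [set v in l0 ++ l ++ l4] = setT -> cycle arc (l0 ++ l ++ l4) ->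
  (forall l1 u l2 w l3, l = l1 ++ u :: l2 ++ w :: l3 -> arc u w -> l2 = [::]) ->
  forall u w, u \in l -> w \in l -> u != w -> arc u w -> ~~ arc w u.
Proof.
move=> nb ul El cl chl.
have main l1 u l2 w l3 : l = l1 ++ u :: l2 ++ w :: l3 -> arc u w -> ~~ arc w u.
  move=> E uw; have E2 := chl _ _ _ _ _ E uw; rewrite {}E2 /= in E.
  have E3 : l0 ++ l ++ l4 = (l0 ++ l1) ++ u :: w :: (l3 ++ l4) by rewrite E -!catA.
  by apply: (@reverse_consecutive (l0 ++ l1) u w (l3 ++ l4)); rewrite -?E3.
move=> u w ul' wl' uw auw; case: (not_both_before ul' wl' uw) => [[l1 [l2 [l3 E]]]|[l1 [l2 [l3 E]]]].
  exact: main E auw.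
by apply/negP => awu; have := main _ _ _ _ _ E awu; rewrite auw.
Qed.

Lemma oriented_dd (R : {set V}) r : irreflexive arc ->
  (forall u w, u \in R -> w \in R -> arc u w -> ~~ arc w u) -> r \in R ->
  dd arc r R < #|R|.
Proof.
move=> irr ori rR; rewrite dd_self //; have := cardsD1 r R; rewrite rR.
have : #|outs arc r :&: (R :\ r)| + #|ins arc r :&: (R :\ r)| <= #|R :\ r|.
  apply: joint_le => z; rewrite !inE => /andP[_ zR].
  by apply/negP => /andP[/(ori _ _ rR zR)/negP].
by rewrite /dd; card_lia.
Qed.

End ListHam.

(** * A maximal cycle that leaves at least two vertices *)

Section LongCycle.
Variables (V : finType) (arc : rel V).
Hypothesis irr : irreflexive arc.
Hypothesis A0 : condA0 arc.
Local Notation n := #|V|.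
Local Notation outs := (outs arc).
Local Notation ins := (ins arc).
Local Notation hp := (hp arc).
Local Notation hcyc := (hcyc arc).
Local Notation dd := (dd arc).

Variable C : {set V}.
Hypothesis hC : hcyc C.
Hypothesis Cn : #|C| + 2 <= n.
Hypothesis Cmax : forall S, hcyc S -> #|S| < n -> #|S| <= #|C|.
Local Notation R := (~: C).
Local Notation conn := (connect (inside arc R)).

Lemma card_CR : #|C| + #|R| = n. Proof. exact: card_splitC. Qed.

Lemma hcyc_between S : hcyc S -> #|C| < #|S| -> #|S| = n.
Proof.
move=> hS lt; have le : #|S| <= n by rewrite -cardsT subset_leq_card ?subsetT.
case: (ltngtP #|S| n) => //; last by card_lia.
by move=> /(Cmax hS); card_lia.
Qed.

Lemma inR_disj (P : {set V}) : P \subset R -> [disjoint C & P].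
Proof. by rewrite disjoint_sym disjoints_subset. Qed.

Lemma cardU_R (S P : {set V}) : S \subset C -> P \subset R -> #|S :|: P| = #|S| + #|P|.
Proof.
move=> SC PR; rewrite cardsU (_ : S :&: P = set0) ?cards0 ?subn0 //.
apply/eqP; rewrite setI_eq0; apply: disjointWl SC _; exact: inR_disj.
Qed.

Lemma card_C_gt1 : 1 < #|C|.
Proof.
case: hC => p [q [h qp]]; have pC := hp_first h; have qC := hp_last h.
by apply/card_gt1P; exists p, q; split=> //; apply: contraTneq qp => ->; rewrite irr.
Qed.

(** If w sends an arc to [y] and [r] sends one to u, then a path from u to w closes up with [P].
    When [P] misses a vertex of R, the path is [C] cut at an arc; when [P] is all of R, one vertex
    of [C] is dropped, and the resulting n - 1 vertices still exceed |C|. *)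
Lemma link_count y r (P : {set V}) : P \subset R -> hp P y r ->
  #|ins y :&: C| + #|outs r :&: C| <= #|C|.
Proof.
move=> PR hP; have nCR := card_CR; have yP := hp_first hP.
have P0 : 0 < #|P| by apply/card_gt0P; exists y.
have lePR := subset_leq_card PR.
case: (ltngtP #|P| #|R|) => PsR; last first.
- apply: (cycle_count2 irr hC) => // u v w vC h; apply/negP; rewrite !inE => /andP[wy ru].
  have dis : [disjoint C :\ v & P] by apply: disjointWl (subsetDl _ _) (inR_disj PR).
  have cy : hcyc ((C :\ v) :|: P) by exists u, r; split=> //; apply: hp_cat h hP wy dis.
  have := cardU_R (subsetDl C [set v]) PR.
  have := cardsD1 v C; rewrite vC => e1 e2; have := hcyc_between cy; card_lia.
- by card_lia.
- apply: (cycle_count1 hC) => // u w h; apply/negP; rewrite !inE => /andP[wy ru].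
  have cy : hcyc (C :|: P) by exists u, r; split=> //; apply: hp_cat h hP wy (inR_disj PR).
  have := cardU_R (subxx C) PR; have := hcyc_between cy; card_lia.
Qed.

Lemma conn_count y r : y \in R -> conn y r -> #|ins y :&: C| + #|outs r :&: C| <= #|C|.
Proof. by move=> yR /(inside_hp yR)[P PR hP]; apply: link_count PR hP. Qed.

Lemma dd_C r : r \in R -> dd r C <= #|C|.
Proof. by move=> rR; rewrite ddE addnC; apply: conn_count. Qed.

Lemma nadj x y : ~~ adjacent arc x y -> (arc x y = false) * (arc y x = false).
Proof. by rewrite /adjacent negb_or => /andP[/negbTE -> /negbTE ->]. Qed.

(** A_0 is applied to [y], [x] with another vertex r of R as third vertex. Since [y] and r do not
    reach each other both ways, an arc between them is missing; the relevant neighbourhoods are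
    disjoint on R and avoid [y] and r, which saves 2. *)
Lemma isolated_bad x y : x \in C -> y \in R -> bad arc x y ->
  (forall r, r \in R -> conn y r -> conn r y -> r = y) -> False.
Proof.
move=> xC yR bxy iso; have nCR := card_CR.
have [r rR ry] : exists2 r, r \in R & r != y by apply: card_ex2; card_lia.
have xR : x \notin R by rewrite inE xC.
have [yx xr] : y != x /\ x != r by split; [apply: contraNneq xR => <- | apply: contraNneq xR => ->].
have yr : y != r by rewrite eq_sym.
case/and3P: bxy => _; rewrite adjacentC => nyx dxy.
have cR2 : #|R :\ y :\ r| + 2 = #|R|.
  by have := cardsD1 y R; have := cardsD1 r (R :\ y); rewrite yR in_setD1 ry rR /=; card_lia.
have sub (B1 B2 : {set V}) : y \notin B1 -> r \notin B1 -> y \notin B2 -> r \notin B2 ->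
    (forall z, z \in R -> ~~ ((z \in B1) && (z \in B2))) ->
    #|B1 :&: R| + #|B2 :&: R| + 2 <= #|R|.
  move=> y1 r1 y2 r2 H; rewrite (cardID1 _ y1) (cardID1 _ r1) (cardID1 _ y2) (cardID1 _ r2).
  by rewrite -cR2 leq_add2r; apply: joint_le => z; rewrite in_setD1 => /andP[_]; rewrite in_setD1 => /andP[_ /H].
case: (boolP (conn y r)) => [cyr|nyr].
  have nry : ~~ conn r y by apply: contraNN ry => cry; rewrite (iso r).
  have ary : ~~ arc r y by apply: contraNN nry => ?; apply: inside1.
  have := A0_in A0 yx xr yr nyx ary; have := conn_count yR cyr.
  rewrite (ins_split arc y C) (outs_split arc r C).
  have := sub (ins y) (outs r); rewrite !inE !irr ary => /(_ isT isT isT isT) H.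
  suff : forall z, z \in R -> ~~ ((z \in ins y) && (z \in outs r)) by move=> /H; card_lia.
  move=> z zR; rewrite !inE; apply/negP => /andP[zy rz]; case/negP: nry.
  by apply: inside_trans (inside1 rz rR zR) (inside1 zy zR yR).
have ayr : ~~ arc y r by apply: contraNN nyr => ?; apply: inside1.
case: (boolP (conn r y)) => [cry|nry].
  have := A0_out A0 yx xr yr nyx ayr; have := conn_count rR cry.
  rewrite (outs_split arc y C) (ins_split arc r C).
  have := sub (outs y) (ins r); rewrite !inE !irr ayr => /(_ isT isT isT isT) H.
  suff : forall z, z \in R -> ~~ ((z \in outs y) && (z \in ins r)) by move=> /H; card_lia.
  move=> z zR; rewrite !inE; apply/negP => /andP[yz zr]; case/negP: nyr.
  by apply: inside_trans (inside1 yz yR zR) (inside1 zr zR rR).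
(* Neither vertex reaches the other: the two directions of A_0 are added. *)
have ary : ~~ arc r y by apply: contraNN nry => ?; apply: inside1.
have := A0_out A0 yx xr yr nyx ayr; have := A0_in A0 yx xr yr nyx ary.
have := dd_C yR; have := dd_C rR; have := degD arc y; have := degD arc r.
have := deg_split arc y C; have := deg_split arc r C.
have : dd y R + dd r R + 4 <= 2 * #|R|.
  have := sub (outs y) (ins r); rewrite !inE !irr ayr => /(_ isT isT isT isT) H1.
  have := sub (outs r) (ins y); rewrite !inE !irr ary => /(_ isT isT isT isT) H2.
  rewrite !ddE.
  have : forall z, z \in R -> ~~ ((z \in outs y) && (z \in ins r)).
    move=> z zR; rewrite !inE; apply/negP => /andP[yz zr]; case/negP: nyr.
    by apply: inside_trans (inside1 yz yR zR) (inside1 zr zR rR).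
  have : forall z, z \in R -> ~~ ((z \in outs r) && (z \in ins y)).
    move=> z zR; rewrite !inE; apply/negP => /andP[rz zy]; case/negP: nry.
    by apply: inside_trans (inside1 rz rR zR) (inside1 zy zR yR).
  by move=> /H2 h2 /H1 h1; card_lia.
card_lia.
Qed.

(** On R no vertex is the middle of a path of length two between [x] and [r], so it carries at most
    two of the four possible arcs; [r] itself carries none, which saves the 2 in the definition of
    [bad]. *)
Lemma bad_of_counts x r : x \in C -> r \in R -> ~~ adjacent arc x r ->
  dd x C + dd r C <= 2 * #|C| ->
  (forall z, z \in R -> ~~ (arc x z && arc z r) && ~~ (arc r z && arc z x)) -> bad arc x r.
Proof.
move=> xC rR nxr cC jR; have nCR := card_CR.
have xr : x != r by apply: contraTneq rR => <-; rewrite inE xC.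
rewrite /bad xr nxr /= (deg_split arc x C) (deg_split arc r C).
have e1 : dd x R = dd x (R :\ r).
  by rewrite (dd_split arc x (_ : [set r] \subset R)) ?sub1set // dd1 !(nadj nxr).
have := dd_self irr rR; have := cardsD1 r R; rewrite rR => e2 e3.
have : dd x (R :\ r) + dd r (R :\ r) <= 2 * #|R :\ r|.
  by apply: joint_dd => z; rewrite inE => /andP[_ /jR].
card_lia.
Qed.

(** If [r] fitted into the path on [C :\: G], a cycle on |C| + 1 < n vertices would arise. So [r]
    has at most |C| - |G| + 1 arcs with [C], while [x], stuck in a set of at most |G| vertices, has
    at most |C| + |G| - 1. *)
Lemma gap_count p q (G U : {set V}) x r : chop arc C G p q -> U \subset G ->
  (forall z, z \in U ->
      dd z ((C :\: G) :|: G) + 3 <= #|(C :\: G) :|: G| + #|U| + arc z q + arc p z) ->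
  x \in U -> r \in R -> (forall z, z \in G -> ~~ arc r z && ~~ arc z r) ->
  dd x C + dd r C <= 2 * #|C|.
Proof.
move=> ch UG bU xU rR rG; have := bU x xU.
have GC := chop_sub ch.
have E : (C :\: G) :|: G = C.
  by apply/setP => z; rewrite !inE; case: (boolP (z \in G)) => [/(subsetP GC) ->|]; rewrite ?orbT ?orbF.
rewrite E (dd_split arc r GC) (dd0 rG) add0n.
have rCG : r \notin C :\: G by move: rR; rewrite !inE => /negbTE ->; rewrite andbF.
case: (hp_insert (chop_hp ch) rCG) => [hr|].
  have dis : [disjoint r |: (C :\: G) & G].
    rewrite -setI_eq0; apply/eqP/setP => z; rewrite !inE.
    case: (boolP (z \in G)) => zG; rewrite ?andbF //= andbT orbF.
    by apply/eqP => zr; move: rR; rewrite -zr inE (subsetP GC _ zG).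
  have cy := chop_fill ch hr dis; have := hcyc_between cy.
  have -> : r |: (C :\: G) :|: G = C :|: [set r] by rewrite -setUA E setUC.
  rewrite cardU_R ?subxx ?sub1set // cards1; card_lia.
have := cardsID G C; rewrite (setIidPr GC); have := subset_leq_card UG.
by case: (arc x q); case: (arc p x); case: (arc r q); case: (arc p r) => /=; card_lia.
Qed.

Definition linked p q := exists y y',
  [/\ y \in R, arc p y, connect (inside arc R) y y' & arc y' q].

Lemma enter r : strongly_connected arc -> r \in R ->
  exists p y, [/\ p \in C, y \in R, arc p y & conn y r].
Proof.
move=> str rR; have [c cC] : exists c, c \in C by apply: card_ex; have := card_C_gt1; card_lia.
have /connectP[s ps Er] := str c r.
suff : (c \in R /\ conn c r) \/ exists p y, [/\ p \in C, y \in R, arc p y & conn y r].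
  by case=> [[]|//]; rewrite inE cC.
elim: s c ps Er {cC} => [|z s IH] c /= ; first by move=> _ <-; left.
case/andP=> cz ps Er; case: (IH z ps Er) => [[zR czr]|]; last by right.
case: (boolP (c \in C)) => [cC|cC]; first by right; exists c, z.
have cR : c \in R by rewrite inE.
by left; split=> //; apply: inside_trans (inside1 cz cR zR) czr.
Qed.

Lemma exit r : strongly_connected arc -> r \in R ->
  exists q y, [/\ q \in C, y \in R, arc y q & conn r y].
Proof.
move=> str rR; have [c cC] : exists c, c \in C by apply: card_ex; have := card_C_gt1; card_lia.
have /connectP[s ps Er] := str r c.
elim: s r rR ps Er => [|z s IH] r rR /=; first by move=> _ E; rewrite -E inE cC in rR.
case/andP=> rz ps Er; case: (boolP (z \in C)) => [zC|zC]; first by exists z, r.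
have zR : z \in R by rewrite inE.
have [q [y [qC yR yq czy]]] := IH z zR ps Er.
by exists q, y; split=> //; apply: inside_trans (inside1 rz rR zR) czy.
Qed.

(** Without such a pair every vertex of R enters and leaves [C] at one vertex v only, and is bad
    with every other vertex of [C]. Two vertices of R with the same v share a partner; two with
    different v are bad with each other as well. Both cases contradict [bad_uniq]. *)
Lemma linked_exists : strongly_connected arc ->
  exists p q, [/\ p \in C, q \in C, p != q & linked p q].
Proof.
move=> str; apply: NNPP => no; have nCR := card_CR; have C2 := card_C_gt1.
have same p q : p \in C -> q \in C -> linked p q -> p = q.
  by move=> pC qC l; apply/eqP/negPn/negP => pq; apply: no; exists p, q.
have att r : r \in R -> exists v, [/\ v \in C,
    (forall u w, u \in C -> w \in R -> arc u w -> conn w r -> u = v) &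
    (forall u w, u \in C -> w \in R -> arc w u -> conn r w -> u = v)].
  move=> rR; have [p [y [pC yR py cyr]]] := enter str rR.
  have [q [y' [qC yR' yq cry]]] := exit str rR.
  have pq : p = q by apply: same => //; exists y, y'; split=> //; apply: inside_trans cyr cry.
  exists p; split=> // u w uC wR.
    by move=> uw cwr; rewrite pq; apply: same => //; exists w, y'; split=> //; apply: inside_trans cwr cry.
  by move=> wu crw; apply/esym/same => //; exists y, w; split=> //; apply: inside_trans cyr crw.
have att_nadj r v x : r \in R -> (forall u w, u \in C -> w \in R -> arc u w -> conn w r -> u = v) ->
    (forall u w, u \in C -> w \in R -> arc w u -> conn r w -> u = v) -> x \in C -> x != v ->
    ~~ adjacent arc x r.
  move=> rR h1 h2 xC xv; rewrite /adjacent negb_or.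
  by apply/andP; split; apply/negP => a; move/eqP: xv; apply; [apply: (h1 x r)|apply: (h2 x r)].
have ddv r v : r \in R -> v \in C -> (forall u w, u \in C -> w \in R -> arc u w -> conn w r -> u = v) ->
    (forall u w, u \in C -> w \in R -> arc w u -> conn r w -> u = v) -> dd r C <= 2.
  move=> rR vC h1 h2; rewrite (dd_split arc r (_ : [set v] \subset C)) ?sub1set // dd1.
  rewrite [X in _ + X]dd0; first by case: arc; case: arc.
  by move=> z; rewrite !inE -negb_or => /andP[zv zC]; rewrite -/(adjacent arc r z) adjacentC (att_nadj r v).
have badv r v x : r \in R -> v \in C -> (forall u w, u \in C -> w \in R -> arc u w -> conn w r -> u = v) ->
    (forall u w, u \in C -> w \in R -> arc w u -> conn r w -> u = v) -> x \in C -> x != v -> bad arc x r.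
  move=> rR vC h1 h2 xC xv; apply: bad_of_counts => //; first exact: att_nadj h1 h2 xC xv.
    have := ddv r v rR vC h1 h2; have := dd_le arc x (C :\ x); rewrite -dd_self //.
    by have := cardsD1 x C; rewrite xC; card_lia.
  move=> z zR; apply/andP; split; apply/negP => /andP[a b]; move/eqP: xv; apply.
    by apply: (h1 x z) => //; apply: inside1.
  by apply: (h2 x z) => //; apply: inside1.
have [r rR] : exists r, r \in R by apply: card_ex; card_lia.
have [r' rR' rr'] : exists2 r', r' \in R & r' != r by apply: card_ex2; card_lia.
have [v [vC h1 h2]] := att r rR; have [v' [vC' h1' h2']] := att r' rR'.
case: (eqVneq v v') => [vv|vv'].
  have [x xC xv] : exists2 x, x \in C & x != v by apply: card_ex2.
  have b1 := badv r v x rR vC h1 h2 xC xv.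
  rewrite vv in xv; have b2 := badv r' v' x rR' vC' h1' h2' xC xv.
  by have := bad_uniq A0 b1 b2 => E; rewrite E eqxx in rr'.
have b1 : bad arc v' r by apply: (badv r v) => //; rewrite eq_sym.
have [y' [yR' ry' vy]] : exists y, [/\ y \in R, conn r y & arc y v].
  by have [q [y [qC yR yq cry]]] := exit str rR; exists y; rewrite -(h2 q y).
have [y2 [yR2 ry2 vy2]] : exists y, [/\ y \in R, conn r' y & arc y v'].
  by have [q [y [qC yR yq cry]]] := exit str rR'; exists y; rewrite -(h2' q y).
have nrr' : ~~ conn r r'.
  apply/negP => c; move/eqP: vv'; apply; apply/esym/(h2 v' y2) => //; exact: inside_trans c ry2.
have nr'r : ~~ conn r' r.
  apply/negP => c; move/eqP: vv'; apply; apply/(h2' v y') => //; exact: inside_trans c ry'.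
have b2 : bad arc r r'.
  rewrite /bad eq_sym rr' /adjacent.
  have -> : arc r r' = false by apply: contraNF nrr' => ?; apply: inside1.
  have -> : arc r' r = false by apply: contraNF nr'r => ?; apply: inside1.
  rewrite (deg_split arc r C) (deg_split arc r' C) /=.
  have := ddv r v rR vC h1 h2; have := ddv r' v' rR' vC' h1' h2'.
  have e1 : dd r' R = dd r' (R :\ r).
    rewrite (dd_split arc r' (_ : [set r] \subset R)) ?sub1set // dd1.
    have -> : arc r r' = false by apply: contraNF nrr' => ?; apply: inside1.
    by have -> : arc r' r = false by apply: contraNF nr'r => ?; apply: inside1.
  have e2 := dd_self irr rR; have := cardsD1 r R; rewrite rR.
  have : dd r (R :\ r) + dd r' (R :\ r) <= 2 * #|R :\ r|.
    apply: joint_dd => z; rewrite in_setD1 => /andP[_ zR]; apply/andP; split; apply/negP => /andP[a b].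
      by case/negP: nrr'; apply: inside_trans (inside1 a rR zR) (inside1 b zR rR').
    by case/negP: nr'r; apply: inside_trans (inside1 a rR' zR) (inside1 b zR rR).
  card_lia.
have := bad_uniq A0 (y := v') (z := r') (x := r); rewrite badC b1 b2 => /(_ isT isT) E.
by rewrite -E inE vC' in rR'.
Qed.

End LongCycle.

(** * The remaining vertices form one path *)

Section Cover.
Variables (V : finType) (arc : rel V).
Hypothesis irr : irreflexive arc.
Hypothesis A0 : condA0 arc.
Hypothesis nb : ~ has_ham_bypass arc.
Local Notation n := #|V|.
Local Notation outs := (outs arc).
Local Notation ins := (ins arc).
Local Notation hp := (hp arc).
Local Notation hcyc := (hcyc arc).
Local Notation dd := (dd arc).

Variable C : {set V}.
Hypothesis hC : hcyc C.
Hypothesis Cn : #|C| + 2 <= n.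
Hypothesis Cmax : forall S, hcyc S -> #|S| < n -> #|S| <= #|C|.
Local Notation R := (~: C).
Local Notation conn := (connect (inside arc R)).

(* If a shortest bypass of C through R cannot be closed up, the vertex left out is bad
   with every vertex of the bypass, which therefore is a single isolated vertex of R. *)
Lemma covering_link : strongly_connected arc ->
  exists p q y y', [/\ p != q, hp C q p, arc p y, arc y' q &
    hp R y y' /\ forall P : {set V}, P \subset R -> hp P y y' -> P = R].
Proof.
move=> str; have nCR := card_CR C.
have [p0 [q0 [pC0 qC0 pq0 l0]]] := linked_exists irr A0 hC Cn str.
have [p [q [G [ch [y [y' [yR py cyy yq]]] Gmin]]]] := chop_min hC pC0 qC0 pq0 l0.
have GC := chop_sub ch; have [pC qC] := chop_in ch.
have disG : [disjoint C :\: G & G] by exact: disjoint_setD.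
have [U [UG hU bU]] := hp_absorb irr (chop_hp ch) disG.
have yR' : y' \in R := inside_conn yR cyy.
have nG r z : r \in R -> conn y r -> conn r y' -> z \in G -> ~~ arc r z && ~~ arc z r.
  move=> rR cyr cry zG; have [n1 n2] := Gmin z zG; apply/andP; split; apply/negP => a.
    by apply: n1; exists y, r.
  by apply: n2; exists r, y'.
have badU x r : x \in U -> r \in R -> conn y r -> conn r y' -> bad arc x r.
  move=> xU rR cyr cry; have xG := subsetP UG x xU; have xC := subsetP GC x xG.
  have [n1 n2] := Gmin x xG.
  apply: (bad_of_counts irr Cn xC rR).
  - by have := nG r x rR cyr cry xG; rewrite /adjacent negb_or andbC.
  - by apply: (gap_count Cn Cmax ch UG bU xU rR) => z; apply: nG.
  move=> z zR; apply/andP; split; apply/negP => /andP[a b].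
    by apply: n2; exists z, y'; split=> //; apply: inside_trans (inside1 b zR rR) cry.
  by apply: n1; exists y, z; split=> //; apply: inside_trans cyr (inside1 a rR zR).
(* A stuck [x] is bad with both ends of the link, so these coincide; likewise no other vertex of R
   is strongly connected to [y] inside R. *)
case: (set_0Vmem U) => [U0|[x xU]]; last first.
  have xC := subsetP GC x (subsetP UG x xU).
  have b1 := badU x y xU yR (connect0 _ _) cyy.
  have b2 := badU x y' xU yR' cyy (connect0 _ _).
  have Ey := bad_uniq A0 b1 b2; case: (isolated_bad irr A0 hC Cn Cmax xC yR b1) => r rR c1 c2.
  by rewrite -Ey in badU; apply: (bad_uniq A0 (badU x r xU rR c1 c2) b1).
have hCqp : hp C q p.
  by move: hU; rewrite U0 setD0 setD_setU.
(* Any path inside R from [y] to [y'] closes a cycle longer than [C], which must then be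
   Hamiltonian. *)
have full (P : {set V}) : P \subset R -> hp P y y' -> P = R.
  move=> PR hP; have cy : hcyc (C :|: P).
    by exists q, y'; split=> //; apply: hp_cat hCqp hP py (inR_disj PR).
  have := hcyc_between Cn Cmax cy; rewrite (cardU_R (subxx C) PR).
  have P0 : 0 < #|P| by apply/card_gt0P; exists y; apply: hp_first hP.
  move=> h; apply/eqP; rewrite eqEcard PR /=; move: h P0; card_lia.
exists p, q, y, y'; split=> //; first exact: chop_neq ch.
by have [P PR hP] := inside_hp yR cyy; rewrite -{1}(full P PR hP).
Qed.

Section CoveringPath.
Variables p q y y' : V.
Hypothesis pq : p != q.
Hypothesis hCqp : hp C q p.
Hypothesis py : arc p y.
Hypothesis yq : arc y' q.
Hypothesis hR : hp R y y'.
Hypothesis full : forall P : {set V}, P \subset R -> hp P y y' -> P = R.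

(** A forward chord would shorten the path to one on a proper subset of R, which [full] excludes. *)
Lemma R_list : exists t, [/\ path arc y t, last y t = y', uniq (y :: t),
  R = [set z in y :: t] & forall l1 u l2 w l3, y :: t = l1 ++ u :: l2 ++ w :: l3 ->
    arc u w -> l2 = [::]].
Proof.
have [t [pt lt ut Et]] := hR; exists t; split=> // l1 u l2 w l3 E uw.
case: l2 E => // z l2 E; exfalso.
have sub : subseq (l1 ++ u :: w :: l3) (y :: t).
  rewrite E; apply: cat_subseq => //.
  by apply: (@cat_subseq _ [:: u] (w :: l3) [:: u]); rewrite ?subseq_refl ?suffix_subseq.
have uS : uniq (l1 ++ u :: w :: l3) := subseq_uniq sub ut.
have hS : hp [set v in l1 ++ u :: w :: l3] y y'.
  case: l1 E uS {sub} => [|v l1] /= [Ey E]; rewrite -?Ey => uS.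
    exists (w :: l3); split=> //; last by rewrite -lt E /= !last_cat.
    by move: pt; rewrite E /= cat_path /= Ey uw => /and4P[_ _ _ ->].
  exists (l1 ++ u :: w :: l3); split=> //; last by rewrite -lt E !last_cat /= !last_cat.
  by move: pt; rewrite E !cat_path /= cat_path /= uw => /and5P[-> -> _ _ /andP[_ ->]].
have PR : [set v in l1 ++ u :: w :: l3] \subset R.
  by rewrite Et; apply/subsetP => v; rewrite !in_set; apply: mem_subseq.
have := full PR hS; rewrite Et => /setP/(_ z); rewrite !in_set E.
move: ut; rewrite E => ut.
have -> : z \in l1 ++ u :: (z :: l2) ++ w :: l3 by rewrite mem_cat !inE eqxx !orbT.
suff -> : z \in l1 ++ u :: w :: l3 = false by [].
apply/negbTE/count_memPn; have := count_uniq_mem z ut.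
have -> : z \in l1 ++ u :: (z :: l2) ++ w :: l3 by rewrite mem_cat !inE eqxx !orbT.
by rewrite !count_cat /= !count_cat /= eqxx; card_lia.
Qed.

Lemma C_list : exists s, [/\ path arc q s, last q s = p, uniq (q :: s) & C = [set z in q :: s]].
Proof. by have [s [? ? ? ?]] := hCqp; exists s. Qed.

Lemma whole_cycle s t : path arc q s -> last q s = p -> path arc y t -> last y t = y' ->
  cycle arc ((q :: s) ++ (y :: t)).
Proof.
by move=> ps ls pt lt; rewrite /= rcons_path cat_path /= last_cat /= ps ls py pt lt yq.
Qed.

Lemma whole_uniq s t : uniq (q :: s) -> C = [set z in q :: s] -> uniq (y :: t) ->
  R = [set z in y :: t] -> uniq ((q :: s) ++ (y :: t)).
Proof.
move=> us EC ut ER; rewrite cat_uniq us ut andbT; apply/hasPn => z zt.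
have : z \in R by rewrite ER in_set.
by rewrite inE EC in_set.
Qed.

Lemma whole_set s t : C = [set z in q :: s] -> R = [set z in y :: t] ->
  [set z in (q :: s) ++ (y :: t)] = setT.
Proof. by move=> EC ER; rewrite set_seq_cat -EC -ER setUCr. Qed.

Lemma R_oriented u w : u \in R -> w \in R -> arc u w -> ~~ arc w u.
Proof.
have [t [pt lt ut ER ch]] := R_list; have [s [ps ls us EC]] := C_list.
move=> uR wR uw; have uw' : u != w by apply: contraTneq uw => ->; rewrite irr.
apply: (@chordless_oriented V arc (q :: s) (y :: t) [::]) => //; rewrite ?cats0.
- exact: whole_uniq.
- exact: whole_set.
- exact: whole_cycle.
- by move: uR; rewrite ER in_set.
- by move: wR; rewrite ER in_set.
Qed.

Lemma yR : y \in R. Proof. exact: hp_first hR. Qed.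
Lemma yR' : y' \in R. Proof. exact: hp_last hR. Qed.

Lemma conn_from_y u : u \in R -> conn y u.
Proof.
move=> uR; case: (eqVneq u y) => [->|uy]; first exact: connect0.
have := hp_revP hR => hR'.
have uy' : u == y' \/ u != y' by case: eqP; [left|right].
case: uy' => [/eqP ->|uy']; first exact: hp_inside (subxx R) hR.
have [S [SR _ hS]] := hp_suffix hR' uR uy'.
exact: hp_inside SR (hp_revP hS).
Qed.

Lemma conn_to_y' u : u \in R -> conn u y'.
Proof.
move=> uR; case: (eqVneq u y) => [->|uy]; first exact: hp_inside (subxx R) hR.
have [S [SR _ hS]] := hp_suffix hR uR uy; exact: hp_inside SR hS.
Qed.

Lemma card_R_sub2 (B : {set V}) u w : u \in R -> w \in R -> u != w -> u \notin B -> w \notin B ->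
  #|B :&: R| + 2 <= #|R|.
Proof.
move=> uR wR uw uB wB; rewrite (cardID1 _ uB) (cardID1 _ wB).
have e1 := cardsD1 u R; have e2 := cardsD1 w (R :\ u).
rewrite uR in e1; rewrite in_setD1 eq_sym uw wR in e2.
have := subset_leq_card (subsetIr B (R :\ u :\ w)); card_lia.
Qed.

Lemma oriented_nonadj r v : r \in R -> v \in R -> r != v -> ~~ adjacent arc r v ->
  dd r R + 2 <= #|R|.
Proof.
move=> rR vR rv; rewrite /adjacent negb_or => /andP[/negbTE a1 /negbTE a2].
rewrite (dd_split arc r (_ : [set v] \subset R)) ?sub1set // dd1 a1 a2 add0n.
have rRv : r \in R :\ v by rewrite in_setD1 rv.
have ori u w : u \in R :\ v -> w \in R :\ v -> arc u w -> ~~ arc w u.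
  by rewrite !in_setD1 => /andP[_ uR] /andP[_ wR]; apply: R_oriented.
have := oriented_dd irr ori rRv; have := cardsD1 v R; rewrite vR; card_lia.
Qed.

Section Long.
Hypothesis R3 : 2 < #|R|.

Lemma long_list : exists z w t, [/\ path arc y [:: z, w & t], last y [:: z, w & t] = y',
   uniq [:: y, z, w & t], R = [set v in [:: y, z, w & t]] &
   forall l1 u l2 x l3, [:: y, z, w & t] = l1 ++ u :: l2 ++ x :: l3 -> arc u x -> l2 = [::]].
Proof.
have [t [pt lt ut ER ch]] := R_list.
have := R3; rewrite ER card_set_seq //; case: t pt lt ut ER ch => [|z [|w t]] //= *.
by exists z, w, t.
Qed.

(** Otherwise [y] and [y'] are non-adjacent, with degree at most n - 2 because R is oriented. A_0 is
    tested on them with the second vertex z of the path: z has one out-neighbour in R since the path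
    is chordless, and [y] has no in-neighbour among [y], z, [y']. *)
Lemma return_arc : arc y' y.
Proof.
apply/negPn/negP => ny; have nCR := card_CR C.
have [z [w [t [pt lt ut ER ch]]]] := long_list.
have [yz yy'] : y != z /\ y != y'.
  move: ut; rewrite -lt /= inE negb_or => /and4P[/andP[yz ywt] _ _ _]; split=> //.
  by apply: contraNneq ywt => ->; apply: mem_last.
have zy' : z != y'.
  move: ut; rewrite -lt /= => /and3P[_ zwt _].
  by apply: contraNneq zwt => {1}->; apply: mem_last.
have zR : z \in R by rewrite ER !inE eqxx orbT.
have ayz : arc y z by case/andP: pt.
have nyy : ~~ arc y y'.
  apply/negP => a; case/lastP: t pt lt ut ER ch => [|t v] pt lt ut ER ch.
    by have := ch [::] y [:: z] w [::] erefl; rewrite /= in lt; rewrite lt => /(_ a).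
  rewrite /= last_rcons in lt; subst v.
  by have := ch [::] y [:: z, w & t] y' [::]; rewrite /= cats1 => /(_ erefl a).
have nadj : ~~ adjacent arc y y' by rewrite /adjacent negb_or nyy.
have nzy := R_oriented yR zR ayz.
have y'z : y' != z by rewrite eq_sym.
have := A0_in A0 yy' y'z yz nadj nzy.
have := conn_count irr hC Cn Cmax yR (conn_from_y zR).
have := dd_C irr hC Cn Cmax yR; have := dd_C irr hC Cn Cmax yR'.
have := ins_split arc y C; have := outs_split arc z C.
have := deg_split arc y C; have := deg_split arc y' C.
have := card_R_sub2 (B := ins y) zR yR' zy'; rewrite !inE nzy ny => /(_ isT isT).
have c1 : #|ins y :&: R| + 3 <= #|R|.
  have yB : y \notin ins y by rewrite inE irr.
  have zB : z \notin ins y by rewrite inE.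
  have y'B : y' \notin ins y by rewrite inE.
  rewrite (cardID1 _ yB) (cardID1 _ zB) (cardID1 _ y'B).
  have e1 := cardsD1 y R; have e2 := cardsD1 z (R :\ y); have e3 := cardsD1 y' (R :\ y :\ z).
  rewrite yR in e1; rewrite in_setD1 eq_sym yz zR in e2.
  rewrite 2!in_setD1 y'z [y' == y]eq_sym yy' yR' in e3.
  have := subset_leq_card (subsetIr (ins y) (R :\ y :\ z :\ y')); card_lia.
have c2 : #|outs z :&: R| <= 1.
  rewrite -(cards1 w); apply: subset_leq_card; apply/subsetP => v; rewrite ER !inE => /andP[zv].
  case/or4P => [/eqP vy|/eqP vz|//|vt]; first by rewrite -vy zv in nzy.
    by rewrite vz irr in zv.
  by case/splitPr: vt ch => t1 t2 /(_ [:: y] z (w :: t1) v t2 erefl zv).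
have d1 : dd y R + 2 <= #|R| by apply: (oriented_nonadj (v := y')); rewrite ?yR ?yR'.
have d2 : dd y' R + 2 <= #|R|.
  by apply: (oriented_nonadj (v := y)); rewrite ?yR ?yR' // 1?eq_sym // adjacentC.
by move: c1 c2 d1 d2 nCR; card_lia.
Qed.

Lemma conn_all u w : u \in R -> w \in R -> conn u w.
Proof.
move=> uR wR; apply: inside_trans (conn_to_y' uR) _.
by apply: inside_trans (inside1 return_arc yR' yR) (conn_from_y wR).
Qed.

(** A_0 for [r], [x] with an out-neighbour z of [r] in R. In-arcs of [r] and out-arcs of z share |C|
    on [C] and number at most |R| - 2 each on R; with at most |R| - 1 arcs of [r] inside R the total
    is at most 3n - 1, where 3n is required. *)
Lemma sparse_vertex x r : x \in C -> r \in R -> ~~ adjacent arc x r ->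
  dd x C + dd r C <= 2 * #|C| -> dd x R <= 2 -> False.
Proof.
move=> xC rR nxr cC xR2; have nCR := card_CR C.
have [r' rR' rr'] : exists2 r', r' \in R & r' != r by apply: card_ex2; move: R3; card_lia.
have [z zR rz] : exists2 z, z \in R & arc r z.
  case/connectP: (conn_all rR rR') => -[|z s] /=; first by move=> _ E; rewrite E eqxx in rr'.
  by case/andP=> /and3P[rz _ zR] _ _; exists z.
have nzr := R_oriented rR zR rz.
have [rx rz'] : r != x /\ r != z.
  split; last by apply: contraTneq rz => ->; rewrite irr.
  by apply: contraTneq rR => ->; rewrite inE xC.
have xz : x != z by apply: contraTneq zR => <-; rewrite inE xC.
rewrite adjacentC in nxr.
have := A0_in A0 rx xz rz' nxr nzr.
have := conn_count irr hC Cn Cmax rR (conn_all rR zR).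
have := ins_split arc r C; have := outs_split arc z C.
have := deg_split arc r C; have := deg_split arc x C.
have := oriented_dd irr R_oriented rR.
have := card_R_sub2 (B := ins r) rR zR rz'; rewrite !inE nzr irr => /(_ isT isT).
have := card_R_sub2 (B := outs z) rR zR rz'; rewrite !inE nzr irr => /(_ isT isT).
by move: R3 nCR cC xR2; card_lia.
Qed.

(** Links through a proper part of R: when they are added to [C], the cycle is longer but not
    Hamiltonian, so unlike general links they contradict maximality. *)
Definition plinked a' b' := exists (P : {set V}) a b,
  [/\ P \subset R, #|P| < #|R|, hp P a b, arc a' a & arc b b'].

(** Given out-neighbours u and w of [x] in R, take a path in R from w to [b]. Either it misses a
    vertex of R, or it contains u and its final segment from u avoids w. *)
Lemma outs_R_le1 x b b' : b \in R -> arc b b' -> ~ plinked x b' -> #|outs x :&: R| <= 1.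
Proof.
move=> bR bb' npl; rewrite leqNgt; apply/negP => /card_gt1_ex[u [w]].
rewrite !in_setI => -[/andP[xu uR] /andP[xw wR] uw]; rewrite !inE in xu xw.
have [P PR hP] := inside_hp wR (conn_all wR bR).
have le := subset_leq_card PR.
case: (ltnP #|P| #|R|) => [lt|ge]; first by apply: npl; exists P, w, b.
have uP : u \in P by have /eqP -> : P == R by rewrite eqEcard PR.
have [S [SP wS hS]] := hp_suffix hP uP uw.
apply: npl; exists S, u, b; split=> //; first exact: subset_trans SP PR.
have : S \proper P by apply/properP; split=> //; exists w => //; apply: hp_first hP.
by move/proper_card => lt; apply: leq_trans lt le.
Qed.

Lemma ins_R_le1 x a a' : a \in R -> arc a' a -> ~ plinked a' x -> #|ins x :&: R| <= 1.
Proof.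
move=> aR aa' npl; rewrite leqNgt; apply/negP => /card_gt1_ex[u [w]].
rewrite !in_setI => -[/andP[xu uR] /andP[xw wR] uw]; rewrite !inE in xu xw.
have [P PR hP] := inside_hp aR (conn_all aR wR).
have le := subset_leq_card PR.
case: (ltnP #|P| #|R|) => [lt|ge]; first by apply: npl; exists P, a, w.
have uP : u \in P by have /eqP -> : P == R by rewrite eqEcard PR.
have [S [SP wS hS]] := hp_suffix (hp_revP hP) uP uw.
apply: npl; exists S, a, u; split=> //; [exact: subset_trans SP PR| |exact: hp_revP hS].
have : S \proper P by apply/properP; split=> //; exists w => //; apply: hp_last hP.
by move/proper_card => lt; apply: leq_trans lt le.
Qed.

(** Take a link with the smallest gap. If the gap is absorbed, [C] and the path form a longer cycle
    that is not Hamiltonian; a vertex that stays out has at most one in- and one out-neighbour in R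
    by minimality, so [sparse_vertex] applies. *)
Lemma no_plink a' b' : a' \in C -> b' \in C -> plinked a' b' -> a' = b'.
Proof.
move=> aC bC pl; apply/eqP/negPn/negP => nab; have nCR := card_CR C.
have [p' [q' [G [ch [P [a [b [PR Pl hP pa bq]]]] Gmin]]]] := chop_min hC aC bC nab pl.
have GC := chop_sub ch; have [pC qC] := chop_in ch.
have aP := hp_first hP; have bP := hp_last hP.
have [aR bR] : a \in R /\ b \in R by rewrite !(subsetP PR).
have disG : [disjoint C :\: G & G] by exact: disjoint_setD.
have [U [UG hU bU]] := hp_absorb irr (chop_hp ch) disG.
have aG z : z \in G -> ~~ arc a z && ~~ arc z a.
  move=> zG; have [n1 n2] := Gmin z zG; apply/andP; split; apply/negP => h.
    apply: n1; exists [set a], a, a; rewrite sub1set cards1; split=> //; last exact: hp1.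
    by move: R3; card_lia.
  by apply: n2; exists P, a, b.
case: (set_0Vmem U) => [U0|[x xU]].
  have hCqp' : hp C q' p'.
    by move: hU; rewrite U0 setD0 setD_setU.
  have cy : hcyc (C :|: P).
    by exists q', b; split=> //; apply: hp_cat hCqp' hP pa (inR_disj PR).
  have := hcyc_between Cn Cmax cy; rewrite (cardU_R (subxx C) PR).
  have P0 : 0 < #|P| by apply/card_gt0P; exists a.
  by move: Pl nCR P0; card_lia.
have xG := subsetP UG x xU; have xC := subsetP GC x xG; have [n1 n2] := Gmin x xG.
apply: (@sparse_vertex x a) => //.
- by have := aG x xG; rewrite /adjacent negb_or andbC.
- exact: (gap_count Cn Cmax ch UG bU xU aR aG).
- by have := outs_R_le1 bR bq n2; have := ins_R_le1 aR pa n1; rewrite ddE; card_lia.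
Qed.

(** Let z be the second vertex of the path. Leaving out [y], or all vertices after z, gives proper
    links, so in [C] only [q] can send an arc to z and only [p] can receive one. A third vertex of
    [C] is then sparse. *)
Lemma no_long_cover : False.
Proof.
have nCR := card_CR C; have [z [w [t [pt lt ut ER _]]]] := long_list.
have pC := hp_last hCqp; have qC := hp_first hCqp.
have [zR wR] : z \in R /\ w \in R by rewrite ER !inE !eqxx !orbT.
have ayz : arc y z by case/andP: pt.
have hyz : hp [set y; z] y z.
  exists [:: z]; split=> //=; rewrite ?ayz //.
    by move: ut => /= /andP[]; rewrite !inE !negb_or => /andP[-> _].
  by apply/setP => v; rewrite !inE.
have hzy : hp (R :\ y) z y'.
  exists (w :: t); split=> //; [by case/andP: pt|by case/andP: ut|].
  rewrite ER; apply/setP => v; rewrite in_setD1 !in_set [v \in y :: _]in_cons.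
  case: (eqVneq v y) => [->|] //=; symmetry; apply/negbTE; by case/andP: ut.
have zq v : v \in C -> arc v z -> v = q.
  move=> vC vz; apply: no_plink => //; exists (R :\ y), z, y'; split=> //.
    exact: subsetDl.
  by have := cardsD1 y R; rewrite yR; card_lia.
have zp v : v \in C -> arc z v -> v = p.
  move=> vC zv; apply/esym/no_plink => //; exists [set y; z], y, z; split=> //.
    by apply/subsetP => u; rewrite !inE -!in_setC => /orP[] /eqP ->; rewrite ?yR.
  by have := cards2 y z; case: (y != z) => /=; move: R3; card_lia.
(* R itself carries a cycle by [return_arc], so maximality gives |C| >= |R|. *)
have Cge : 2 < #|C|.
  apply: leq_trans R3 _; apply: Cmax; last by have := card_C_gt1 irr hC; move: nCR; card_lia.
  by exists y, y'; split=> //; apply: return_arc.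
have [x [xC xp xq]] := card_ex3 p q Cge.
apply: (@sparse_vertex x z) => //.
- by rewrite /adjacent negb_or; apply/andP; split; apply/negP => a;
    [move/eqP: xq; apply; apply: zq | move/eqP: xp; apply; apply: zp].
- have : dd x C <= 2 * #|C :\ x| by rewrite dd_self // dd_le.
  have := cardsD1 x C; rewrite xC.
  have : dd z C <= 2.
    have h1 : #|outs z :&: C| <= 1.
      rewrite -(cards1 p); apply: subset_leq_card; apply/subsetP => v; rewrite !inE => /andP[a vC].
      by rewrite (zp v).
    have h2 : #|ins z :&: C| <= 1.
      rewrite -(cards1 q); apply: subset_leq_card; apply/subsetP => v; rewrite !inE => /andP[a vC].
      by rewrite (zq v).
    by rewrite ddE; move: h1 h2; card_lia.
  card_lia.
- have n2 : ~ plinked x q by move=> pl; case/eqP: xq; apply: no_plink.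
  have n1 : ~ plinked p x by move=> pl; case/eqP: xp; apply/esym/no_plink.
  by have := outs_R_le1 yR' yq n2; have := ins_R_le1 yR py n1; rewrite ddE; card_lia.
Qed.

End Long.
End CoveringPath.
End Cover.

(** * Exactly two vertices left *)

Section TwoLeft.
Variables (V : finType) (arc : rel V).
Hypothesis irr : irreflexive arc.
Hypothesis A0 : condA0 arc.
Hypothesis nb : ~ has_ham_bypass arc.
Local Notation n := #|V|.
Local Notation outs := (outs arc).
Local Notation ins := (ins arc).
Local Notation deg := (deg arc).
Local Notation hp := (hp arc).
Local Notation hcyc := (hcyc arc).
Local Notation dd := (dd arc).

Variable C : {set V}.
Hypothesis hC : hcyc C.
Hypothesis Cn : #|C| + 2 <= n.
Hypothesis Cmax : forall S, hcyc S -> #|S| < n -> #|S| <= #|C|.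
Local Notation R := (~: C).
Variables p q y y' : V.
Hypothesis pq : p != q.
Hypothesis hCqp : hp C q p.
Hypothesis py : arc p y.
Hypothesis yq : arc y' q.
Hypothesis RE : R = [set y; y'].
Hypothesis yy' : y != y'.
Hypothesis ayy : arc y y'.
Hypothesis nyy : ~~ arc y' y.

Lemma two_card : #|C| + 2 = n.
Proof. by have := card_CR C; rewrite RE cards2 yy'; card_lia. Qed.

Lemma two_yR : y \in R. Proof. by rewrite RE !inE eqxx. Qed.
Lemma two_yR' : y' \in R. Proof. by rewrite RE !inE eqxx orbT. Qed.
Let pC : p \in C := hp_last hCqp.
Let qC : q \in C := hp_first hCqp.

Lemma neqCR u r : u \in C -> r \in R -> u != r.
Proof. by move=> uC; apply: contraTneq => <-; rewrite inE uC. Qed.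

Lemma dd_two r : dd r R = arc r y + arc y r + (arc r y' + arc y' r).
Proof. by rewrite RE ddU ?dd1 // disjoints1 inE. Qed.

Lemma ins_two r : #|ins r :&: R| = arc y r + arc y' r.
Proof.
rewrite RE cardI_disj ?disjoints1 ?inE //.
have E (B : {set V}) z : #|B :&: [set z]| = (z \in B).
  case: (boolP (z \in B)) => zB; first by rewrite (setIidPr _) ?sub1set // cards1.
  by rewrite setI_pred0 // => w; rewrite inE => /eqP ->.
by rewrite !E !inE.
Qed.

Lemma outs_two r : #|outs r :&: R| = arc r y + arc r y'.
Proof. by have := dd_two r; rewrite ddE ins_two; card_lia. Qed.

Lemma two_hp : hp R y y'.
Proof.
exists [:: y']; split=> //=; rewrite ?ayy ?inE ?yy' //.
by rewrite RE; apply/setP => v; rewrite !inE.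
Qed.

Lemma two_count : #|ins y :&: C| + #|outs y' :&: C| <= #|C|.
Proof. exact: (link_count irr hC Cn Cmax (subxx R) two_hp). Qed.

(** A_0 with third vertex [y']: the in-arcs of [y] and the out-arcs of [y'] are together at most |C|
    = n - 2. *)
Lemma two_good_y x : x \in C -> ~~ adjacent arc y x -> 2 * n <= deg y + deg x.
Proof.
move=> xC nyx; have xy' := neqCR xC two_yR'; have yx : y != x by rewrite eq_sym neqCR ?two_yR.
have := A0_in A0 yx xy' yy' nyx nyy; have := two_count; have := two_card.
rewrite (ins_split arc y C) (outs_split arc y' C) ins_two outs_two !irr (negbTE nyy).
by card_lia.
Qed.

Lemma two_good_y' x : x \in C -> ~~ adjacent arc y' x -> 2 * n <= deg y' + deg x.
Proof.
move=> xC nyx; have xy := neqCR xC two_yR; have yx : y' != x by rewrite eq_sym neqCR ?two_yR'.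
have y'y : y' != y by rewrite eq_sym.
have := A0_out A0 yx xy y'y nyx nyy; have := two_count; have := two_card.
rewrite (ins_split arc y C) (outs_split arc y' C) ins_two outs_two !irr (negbTE nyy).
by card_lia.
Qed.

(** A detour through one vertex w of R leaves the other one out, so one with the smallest gap has a
    stuck vertex x. By [gap_count], and with at most 3 further arcs on R, the degree sum of w and x
    is below the 2n required of non-adjacent pairs. *)
Lemma two_no_single a b r : r \in R -> a \in C -> b \in C -> arc a r -> arc r b -> a = b.
Proof.
move=> rR0 aC bC ar rb; apply/eqP/negPn/negP => ab; have nC := two_card.
pose L u v := exists r, [/\ r \in R, arc u r & arc r v].
have l0 : L a b by exists r.
have [p' [q' [G [ch [w [wR pw wq]] Gmin]]]] := chop_min hC aC bC ab l0.
have GC := chop_sub ch.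
have [U [UG hU bU]] := hp_absorb irr (chop_hp ch) (disjoint_setD C G).
have wG z : z \in G -> ~~ arc w z && ~~ arc z w.
  move=> zG; have [n1 n2] := Gmin z zG.
  by apply/andP; split; apply/negP => h; [apply: n1|apply: n2]; exists w.
case: (set_0Vmem U) => [U0|[x xU]].
  have hCqp' : hp C q' p' by move: hU; rewrite U0 setD0 setD_setU.
  have wR1 : [set w] \subset R by rewrite sub1set.
  have cy : hcyc (C :|: [set w]).
    by exists q', w; split=> //; apply: hp_cat hCqp' (hp1 arc w) pw (inR_disj wR1).
  have := hcyc_between Cn Cmax cy; rewrite (cardU_R (subxx C) wR1) cards1.
  by move: nC; card_lia.
have xG := subsetP UG x xU; have xC := subsetP GC x xG.
have nwx : ~~ adjacent arc w x by have := wG x xG; rewrite /adjacent negb_or.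
have big : 2 * n <= deg w + deg x.
  move: wR nwx; rewrite RE !inE => /orP[] /eqP -> nwx; [exact: two_good_y|exact: two_good_y'].
have := gap_count Cn Cmax ch UG bU xU wR wG.
move: big; rewrite (deg_split arc w C) (deg_split arc x C) !dd_two.
case/andP: (wG x xG) => h1 h2.
have : w = y \/ w = y' by move: wR; rewrite RE !inE => /orP[] /eqP ->; [left|right].
case=> E; move: h1 h2; rewrite E !irr ayy (negbTE nyy) => /negbTE -> /negbTE ->;
  case: (arc x y); case: (arc y x); case: (arc x y'); case: (arc y' x);
  by move: nC; rewrite /=; card_lia.
Qed.

(** An out-neighbour in [C] would have to be [p], and then [p] would be the only vertex of [C]
    adjacent to [y]; the degree sum of [y] and [q] becomes too small. *)
Lemma two_outs_y v : v \in C -> ~~ arc y v.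
Proof.
move=> vC; apply/negP => yv; have nC := two_card.
have vp : p = v by apply: (two_no_single two_yR).
have onlyp u : u \in C -> adjacent arc y u -> u = p.
  move=> uC /orP[yu|uy]; first by apply/esym/(two_no_single two_yR pC uC py).
  by rewrite vp; apply: (two_no_single two_yR uC vC uy).
have nyq : ~~ adjacent arc y q by apply/negP => /(onlyp q qC) E; move: pq; rewrite E eqxx.
have := two_good_y qC nyq; rewrite (deg_split arc y C) (deg_split arc q C) !dd_two.
have := dd_le arc q (C :\ q); rewrite -(dd_self irr qC); have := cardsD1 q C; rewrite qC.
rewrite (dd_split arc y (_ : [set p] \subset C)) ?sub1set // dd1 [dd y (C :\: _)]dd0; last first.
  move=> z; rewrite !inE -negb_or => /andP[zp zC]; apply: contraNN zp => a; apply/eqP; exact: onlyp.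
move: nyq; rewrite /adjacent negb_or irr ayy (negbTE nyy) => /andP[/negbTE -> /negbTE ->].
by move: nC; case: (arc y p); case: (arc p y); case: (arc q y'); case: (arc y' q) => /=; card_lia.
Qed.

Lemma two_ins_y' v : v \in C -> ~~ arc v y'.
Proof.
move=> vC; apply/negP => yv; have nC := two_card.
have vq : v = q by apply: (two_no_single two_yR').
have onlyq u : u \in C -> adjacent arc y' u -> u = q.
  move=> uC /orP[yu|uy]; last by apply: (two_no_single two_yR' uC qC uy).
  by rewrite -vq; apply/esym/(two_no_single two_yR' vC uC yv).
have nyp : ~~ adjacent arc y' p by apply/negP => /(onlyq p pC) E; move: pq; rewrite E eqxx.
have := two_good_y' pC nyp; rewrite (deg_split arc y' C) (deg_split arc p C) !dd_two.
have := dd_le arc p (C :\ p); rewrite -(dd_self irr pC); have := cardsD1 p C; rewrite pC.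
rewrite (dd_split arc y' (_ : [set q] \subset C)) ?sub1set // dd1 [dd y' (C :\: _)]dd0; last first.
  move=> z; rewrite !inE -negb_or => /andP[zp zC]; apply: contraNN zp => a; apply/eqP; exact: onlyq.
move: nyp; rewrite /adjacent negb_or irr ayy (negbTE nyy) => /andP[/negbTE -> /negbTE ->].
by move: nC; case: (arc y' q); case: (arc q y'); case: (arc p y); case: (arc y p) => /=; card_lia.
Qed.

Lemma two_deg_y : deg y = #|ins y :&: C| + 1.
Proof.
rewrite (deg_split arc y C) dd_two ddE setI_pred0; last by move=> z /two_outs_y; rewrite inE.
by rewrite !irr ayy (negbTE nyy); lia.
Qed.

Lemma two_deg_y' : deg y' = #|outs y' :&: C| + 1.
Proof.
rewrite (deg_split arc y' C) dd_two ddE [X in _ + X + _]setI_pred0; last by move=> z /two_ins_y'; rewrite inE.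
by rewrite !irr ayy (negbTE nyy); lia.
Qed.

Lemma two_outs1 : #|outs y| = 1.
Proof.
rewrite (outs_split arc y C) outs_two irr ayy setI_pred0 //.
by move=> z /two_outs_y; rewrite inE.
Qed.

Lemma two_ins1 : #|ins y'| = 1.
Proof.
rewrite (ins_split arc y' C) ins_two irr ayy setI_pred0 //.
by move=> z /two_ins_y'; rewrite inE.
Qed.

(** The vertex has at most 2(n - 3) arcs inside [C], none with [y] and at most one with [y']. *)
Lemma two_x_y x : x \in C -> x \notin ins y -> ~~ adjacent arc y x /\ deg x + 5 <= 2 * n.
Proof.
move=> xC; rewrite inE => xy; have nC := two_card.
have nyx : ~~ adjacent arc y x by rewrite /adjacent negb_or two_outs_y.
split=> //; rewrite (deg_split arc x C) dd_two (negbTE xy) (negbTE (two_outs_y xC)) (negbTE (two_ins_y' xC)).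
have := dd_le arc x (C :\ x); rewrite -(dd_self irr xC); have := cardsD1 x C; rewrite xC.
by move: nC; case: (arc y' x) => /=; card_lia.
Qed.

Lemma two_x_y' x : x \in C -> x \notin outs y' -> ~~ adjacent arc y' x /\ deg x + 5 <= 2 * n.
Proof.
move=> xC; rewrite inE => xy; have nC := two_card.
have nyx : ~~ adjacent arc y' x by rewrite /adjacent negb_or xy two_ins_y'.
split=> //; rewrite (deg_split arc x C) dd_two (negbTE xy) (negbTE (two_outs_y xC)) (negbTE (two_ins_y' xC)).
have := dd_le arc x (C :\ x); rewrite -(dd_self irr xC); have := cardsD1 x C; rewrite xC.
by move: nC; case: (arc x y) => /=; card_lia.
Qed.

(** As [p] sends an arc to [y], some vertex of [C] is not an out-neighbour of [y']. Its degree is at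
    most 2n - 5, so [y'] has degree at least 5, one of it from [y]. *)
Lemma two_b : 4 <= #|outs y' :&: C|.
Proof.
have nC := two_card; have cnt := two_count.
have a1 : 0 < #|ins y :&: C| by apply/card_gt0P; exists p; rewrite !inE py.
have [x] : exists x, x \in C :\: outs y'.
  by apply: card_ex; have := cardsID (outs y') C; rewrite setIC; move: cnt a1; card_lia.
rewrite inE => /andP[xo xC]; have [nyx dx] := two_x_y' xC xo.
by have := two_good_y' xC nyx; rewrite two_deg_y'; move: dx; card_lia.
Qed.

Lemma two_a : 4 <= #|ins y :&: C|.
Proof.
have nC := two_card; have cnt := two_count; have b4 := two_b.
have [x] : exists x, x \in C :\: ins y.
  by apply: card_ex; have := cardsID (ins y) C; rewrite setIC; move: cnt b4; card_lia.
rewrite inE => /andP[xo xC]; have [nyx dx] := two_x_y xC xo.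
by have := two_good_y xC nyx; rewrite two_deg_y; move: dx; card_lia.
Qed.

Lemma two_ins_big z : z \in C -> n + 1 <= #|ins z| + #|ins y :&: C|.
Proof.
move=> zC; have cnt := two_count; have b4 := two_b.
have [x] : exists2 x, x \in C :\: ins y & x != z.
  by apply: card_ex2; have := cardsID (ins y) C; rewrite setIC; move: cnt b4; card_lia.
rewrite inE => /andP[xo xC] xz; have [nyx dx] := two_x_y xC xo.
have yx : y != x by rewrite eq_sym neqCR ?two_yR.
have yz : y != z by rewrite eq_sym neqCR ?two_yR.
have := A0_out A0 yx xz yz nyx (two_outs_y zC); rewrite two_deg_y two_outs1; move: dx.
by card_lia.
Qed.

Lemma two_outs_big z : z \in C -> n + 1 <= #|outs z| + #|outs y' :&: C|.
Proof.
move=> zC; have cnt := two_count; have b4 := two_a.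
have [x] : exists2 x, x \in C :\: outs y' & x != z.
  by apply: card_ex2; have := cardsID (outs y') C; rewrite setIC; move: cnt b4; card_lia.
rewrite inE => /andP[xo xC] xz; have [nyx dx] := two_x_y' xC xo.
have yx : y' != x by rewrite eq_sym neqCR ?two_yR'.
have yz : y' != z by rewrite eq_sym neqCR ?two_yR'.
have := A0_in A0 yx xz yz nyx (two_ins_y' zC); rewrite two_deg_y' two_ins1; move: dx.
by card_lia.
Qed.

(** The correction terms of the two preceding bounds add up to at most n - 2, so d(z) >= n + 4; at
    most two arcs of [z] leave [C]. *)
Lemma two_dense z : z \in C -> n + 2 <= dd z C.
Proof.
move=> zC; have := two_ins_big zC; have := two_outs_big zC; have := two_count; have := two_card.
have := degD arc z; rewrite (deg_split arc z C) dd_two (negbTE (two_outs_y zC)) (negbTE (two_ins_y' zC)).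
by case: (arc z y); case: (arc y' z) => /=; card_lia.
Qed.

Lemma two_no_skip x : x \in C -> ~ hp (C :\ x) q p.
Proof.
move=> xC h; have nC := two_card.
have dis : [disjoint C :\ x & R] by apply: disjointWl (subsetDl _ _) (inR_disj (subxx R)).
have cy : hcyc ((C :\ x) :|: R) by exists q, y'; split=> //; apply: hp_cat h two_hp py dis.
have := hcyc_between Cn Cmax cy; rewrite (cardU_R (subsetDl _ _) (subxx R)) RE cards2 yy'.
by have := cardsD1 x C; rewrite xC; move: nC; card_lia.
Qed.

(* All but one of the vertices jumped over by a shortest chord can be inserted elsewhere,
   which yields a cycle missing exactly one vertex. *)
Lemma two_left_false : False.
Proof.
have nC := two_card; have [s [ps ls us EC]] := hCqp.
pose chord k := exists l1 u g w l2, [/\ q :: s = l1 ++ u :: g ++ w :: l2, arc u w, size g = k & 0 < k].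
have [k [[l1 [u [g [w [l2 [E uw sg k0]]]]]] kmin]] : exists k, chord k /\ forall j, chord j -> k <= j.
  apply: ex_minimal.
  (* A chord from [q] exists: two out-neighbours of [q] in [C] remain even without its successor on
     the path. *)
  have : 1 < #|(outs q :&: C) :\ head q s|.
    have := two_outs_big qC; have := two_count; have := two_a.
    rewrite (outs_split arc q C) outs_two (negbTE (two_ins_y' qC)).
    have := cardsD1 (head q s) (outs q :&: C).
    by case: (_ \in _); case: (arc q y) => /=; move: nC; card_lia.
  case/(card_ex2 q) => w; rewrite EC !inE => /and3P[wh qw ws] wq.
  rewrite (negbTE wq) /= in ws.
  have [g [l2 Es]] : exists g l2, s = g ++ w :: l2 by case/splitPr: ws => g l2; exists g, l2.
  case: g Es => [|v g] Es; first by rewrite Es /= eqxx in wh.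
  by exists (size g).+1, [::], q, (v :: g), w, l2; rewrite Es.
(* The skipped segment has no forward chords, as these would skip fewer vertices. *)
have chl m1 a m2 b m3 : g = m1 ++ a :: m2 ++ b :: m3 -> arc a b -> m2 = [::].
  move=> Eg ab; apply/eqP; rewrite -size_eq0 eqn0Ngt; apply/negP => m20.
  have : chord (size m2).
    exists (l1 ++ u :: m1), a, m2, b, (m3 ++ w :: l2); split=> //.
    by rewrite E Eg; do ?rewrite -!catA /=.
  by move/kmin; rewrite -sg Eg !size_cat /= size_cat /=; card_lia.
have us' := us; rewrite E in us'.
have gC : [set z in g] \subset C.
  by apply/subsetP => z; rewrite EC E !inE => zg; rewrite !(mem_cat, inE) zg !orbT.
have ug : uniq g by move: us'; rewrite cat_uniq /= cat_uniq => /and4P[_ _ _ /and3P[]].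
have ori a b : a \in g -> b \in g -> a != b -> arc a b -> ~~ arc b a.
  apply: (@chordless_oriented V arc (l1 ++ [:: u]) g (w :: l2 ++ [:: y; y'])) => //.
  - have -> : (l1 ++ [:: u]) ++ g ++ w :: l2 ++ [:: y; y'] = (q :: s) ++ [:: y; y'].
      by rewrite E; do ?rewrite -!catA /=.
    apply: (@whole_uniq _ C q y) => //; first by rewrite /= inE yy'.
    by rewrite RE; apply/setP => v; rewrite !inE.
  - have -> : (l1 ++ [:: u]) ++ g ++ w :: l2 ++ [:: y; y'] = (q :: s) ++ [:: y; y'].
      by rewrite E; do ?rewrite -!catA /=.
    apply: (@whole_set _ C q y) => //.
    by rewrite RE; apply/setP => v; rewrite !inE.
  - have -> : (l1 ++ [:: u]) ++ g ++ w :: l2 ++ [:: y; y'] = (q :: s) ++ [:: y; y'].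
      by rewrite E; do ?rewrite -!catA /=.
    by apply: (@whole_cycle _ _ p q y y') => //=; rewrite ayy.
have hS : hp (C :\: [set z in g]) q p.
  have -> : C :\: [set z in g] = [set z in l1 ++ u :: w :: l2].
    apply/setP => z; rewrite in_setD EC E !in_set !mem_cat !in_cons mem_cat in_cons.
    case: (boolP (z \in g)) => [zg|_ //] /=.
    have := count_uniq_mem z us'; rewrite mem_cat !inE mem_cat zg !orbT.
    rewrite !count_cat /= count_cat /= => cz.
    have cg : 0 < count_mem z g by rewrite -has_count has_pred1.
    apply/esym/negbTE; rewrite !negb_or -!has_pred1 !has_count.
    rewrite [z == u]eq_sym [z == w]eq_sym.
    by move: cz cg; case: (u == z); case: (w == z); rewrite /=; card_lia.
  have ul : uniq (l1 ++ u :: w :: l2).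
    apply: subseq_uniq us'; apply: cat_subseq => //.
    by apply: (@cat_subseq _ [:: u] (w :: l2) [:: u]); rewrite ?subseq_refl ?suffix_subseq.
  case: l1 E ul {us' ori kmin} => [|v l1] /= [Eq E]; rewrite -?Eq => ul.
    exists (w :: l2); split=> //; last by rewrite -ls E /= !last_cat.
    by move: ps; rewrite E /= cat_path /= Eq uw => /and3P[_ _ ->].
  exists (l1 ++ u :: w :: l2); split=> //; last by rewrite -ls E !last_cat /= !last_cat.
  by move: ps; rewrite E !cat_path /= cat_path /= uw => /and4P[-> -> _ /andP[_ ->]].
(* One skipped vertex [x0] is set aside, so that a complete insertion yields a cycle on n - 1
   vertices and not a Hamiltonian one. *)
case: g sg gC ug chl ori hS E us' => [|x0 g] sg gC ug chl ori hS E us'; first by rewrite -sg in k0.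
have x0C : x0 \in C by apply: (subsetP gC); rewrite !inE eqxx.
have x0g : x0 \notin g by case/andP: ug.
have gE : [set z in x0 :: g] = x0 |: [set z in g] by apply/setP => z; rewrite !inE.
set G := [set z in g]; set G0 := [set z in x0 :: g] in gC hS gE *.
have disG : [disjoint C :\: G0 & G].
  by apply: disjointWr (disjoint_setD C G0); rewrite gE subsetUr.
have [U [UG hU bU]] := hp_multi_insert hS disG.
have SG : C :\: G0 :|: G = C :\ x0.
  apply/setP => z; rewrite gE /G !inE; case: (eqVneq z x0) => [->|zx] /=; first by rewrite (negbTE x0g).
  have := subsetP gC z; rewrite gE /G !inE (negbTE zx) /=.
  by case: (z \in g) => [/(_ isT) ->|]; rewrite /= ?orbF.
case: (set_0Vmem U) => [U0|[x xU]].
  by move: hU; rewrite U0 setD0 SG; apply: two_no_skip.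
have xG := subsetP UG x xU; have xg : x \in g by rewrite inE in xG.
have xC : x \in C by apply: (subsetP gC); rewrite gE inE xG orbT.
pose T := x0 |: U.
have TC : T \subset C.
  rewrite subUset sub1set x0C /=; apply: subset_trans UG _; apply: subset_trans gC.
  by rewrite gE subsetUr.
have CT : C :\: G0 :|: (G :\: U) = C :\: T.
  have -> : C :\: G0 :|: (G :\: U) = (C :\: G0 :|: G) :\: U.
    rewrite setDUl; congr (_ :|: _); apply/setP => z; rewrite [RHS]inE.
    case: (boolP (z \in U)) => // zU; rewrite /= gE !inE.
    by have := subsetP UG z zU; rewrite inE => ->; rewrite orbT.
  by rewrite SG setDDl.
have x0U : x0 \notin U by apply/negP => /(subsetP UG); rewrite inE (negbTE x0g).
have cT : #|T| = #|U| + 1 by rewrite cardsU1 x0U addnC.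
(* The skipped segment is oriented, so [x] has fewer than |T| arcs with the vertices left out; with
   at most |C| - |T| + 1 arcs to the path this is below [two_dense]. *)
have oT : dd x T < #|T|.
  apply: (oriented_dd irr); last by rewrite !inE xU orbT.
  have Tg z : z \in T -> z \in x0 :: g.
    by rewrite !inE => /orP[->//|/(subsetP UG)]; rewrite inE => ->; rewrite orbT.
  move=> a b /Tg ag /Tg bg ab; apply: ori => //.
  by apply: contraTneq ab => ->; rewrite irr.
have := bU x xU; rewrite CT; have := two_dense xC; rewrite (dd_split arc x TC).
have := cardsID T C; rewrite (setIidPr TC).
by move: oT cT nC; case: (arc x q); case: (arc p x) => /=; card_lia.
Qed.

End TwoLeft.

(** * Existence of a cycle on n - 1 vertices *)

Section PreHamiltonian.
Variables (V : finType) (arc : rel V).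
Hypothesis irr : irreflexive arc.
Hypothesis A0 : condA0 arc.
Hypothesis n4 : 4 <= #|V|.
Hypothesis str : strongly_connected arc.

Lemma hcyc_through (u : V) : exists S, hcyc arc S.
Proof.
have /(card_ex2 u)[w _ wu] : 1 < #|[set: V]| by rewrite cardsT; apply: leq_trans n4.
have uw : u != w by rewrite eq_sym.
case/connectP: (str u w) => -[|z s] /=; first by move=> _ E; rewrite E eqxx in uw.
case/andP=> uz _ _; case/connectP: (str z u) => t pt lt; case: (shortenP pt) lt => t' pt' ut' _ lt'.
by exists [set v in z :: t'], z, u; split=> //; exists t'.
Qed.

(** If all cycles were Hamiltonian, any chord of one would close a shorter cycle, so D would be a
    directed cycle. All half-degrees are then at most 1, against A_0. *)
Lemma hcyc_short : exists2 S, hcyc arc S & #|S| < #|V|.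
Proof.
have [u0 _] : exists u : V, u \in setT by apply: card_ex; rewrite cardsT; apply: leq_trans n4.
have [S hS] := hcyc_through u0.
apply: NNPP => no.
have full T : hcyc arc T -> #|T| = #|V|.
  move=> hT; have le : #|T| <= #|V| by rewrite -cardsT subset_leq_card ?subsetT.
  by apply/eqP; rewrite eqn_leq le leqNgt; apply/negP => lt; apply: no; exists T.
have [c [_ uc cc ES]] := hcycP hS.
have cT : forall v, v \in c.
  move=> v; have /eqP : S == setT by rewrite eqEcard subsetT cardsT (full _ hS) leqnn.
  by move/setP/(_ v); rewrite ES !inE.
have nx u z : arc u z -> z = next c u.
  move=> uz; apply/eqP/negPn/negP => zn; have [i t Et] := rot_to (cT u).
  have ut : uniq (u :: t) by rewrite -Et rot_uniq.
  have ct : cycle arc (u :: t) by rewrite -Et rot_cycle.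
  move: zn; rewrite -(next_rot i uc) Et => zn.
  have : z \in u :: t by rewrite -Et mem_rot.
  rewrite inE => /predU1P[zu|zt]; first by rewrite zu irr in uz.
  case: t ut ct Et zt zn => [|w t] ut ct Et zt zn //.
  rewrite /= eqxx in zn; move: zt; rewrite inE (negbTE zn) /= => zt.
  case/splitPr: zt ut ct Et => t1 t2 ut ct Et.
  have uz2 : uniq (z :: rcons t2 u).
    rewrite -rcons_cons rcons_uniq -[_ && _]/(uniq (u :: z :: t2)); apply: subseq_uniq ut.
    apply: (@cat_subseq _ [:: u] (z :: t2) [:: u] (w :: t1 ++ z :: t2)); first exact: subseq_refl.
    exact: (suffix_subseq (w :: t1)).
  have hz : hcyc arc [set v in z :: rcons t2 u].
    apply: cycle_hcyc => //.
    move: ct; rewrite /= rcons_cat /= cat_path /= !rcons_path last_rcons uz andbT.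
    by case/and4P=> _ _ _ /andP[-> ->].
  have := full _ hz; rewrite card_set_seq //.
  have := full _ hS; rewrite ES card_set_seq //.
  have -> : size c = size (u :: w :: t1 ++ z :: t2) by rewrite -Et size_rot.
  by rewrite /= size_cat size_rcons /= => <-; card_lia.
have sc : size c = #|V| by have := full _ hS; rewrite ES card_set_seq.
have o1 u : #|outs arc u| <= 1.
  rewrite -(cards1 (next c u)); apply: subset_leq_card; apply/subsetP => z.
  by rewrite !inE => /nx ->.
have i1 u : #|ins arc u| <= 1.
  rewrite -(cards1 (prev c u)); apply: subset_leq_card; apply/subsetP => z.
  by rewrite !inE => /nx ->; rewrite prev_next.
move: n4; rewrite -sc; case: c uc nx {cc ES cT sc o1 i1} (o1) (i1) => [|x0 [|x1 [|x2 [|x3 t]]]] //= uc nx o1 i1 _.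
move: uc; rewrite !inE !negb_or => /and5P[/and4P[x01 x02 x03 _] /and3P[x12 x13 _] /andP[x23 _] _ _].
have n02 : ~~ arc x0 x2.
  by apply/negP => /nx; rewrite eqxx => E; rewrite E eqxx in x12.
have n03 : ~~ arc x0 x3.
  by apply/negP => /nx; rewrite eqxx => E; rewrite E eqxx in x13.
have n20 : ~~ arc x2 x0.
  move: x02 x12; rewrite eq_sym [x1 == _]eq_sym => /negbTE x20 /negbTE x21.
  by apply/negP => /nx; rewrite x20 x21 eqxx => E; rewrite E eqxx in x03.
have nadj : ~~ adjacent arc x0 x2 by rewrite /adjacent negb_or n02.
have := A0_out A0 x02 x23 x03 nadj n03; rewrite !degD.
move: (o1 x0) (o1 x2) (i1 x0) (i1 x2) (i1 x3) n4; card_lia.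
Qed.

Lemma pre_hamiltonian : ~ has_ham_bypass arc -> exists y, hcyc arc [set~ y].
Proof.
move=> nb; have [S0 hS0 S0n] := hcyc_short.
have [k [[C [hC Cn Ck]] kmin]] : exists k, (exists C, [/\ hcyc arc C, #|C| < #|V| & k = #|V| - #|C|]) /\
    forall j, (exists C, [/\ hcyc arc C, #|C| < #|V| & j = #|V| - #|C|]) -> k <= j.
  by apply: ex_minimal; exists (#|V| - #|S0|), S0.
have Cmax S : hcyc arc S -> #|S| < #|V| -> #|S| <= #|C|.
  move=> hS Sn; have := kmin (#|V| - #|S|); rewrite Ck => H.
  have : #|V| - #|C| <= #|V| - #|S| by apply: H; exists S.
  by move: Cn Sn; card_lia.
have nCR := card_CR C.
case: (ltnP (#|C| + 1) #|V|) => [C2|C1]; last first.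
  have /eqP/cards1P[y Ey] : #|~: C| = 1 by move: nCR C1 Cn; card_lia.
  by exists y; rewrite -Ey setCK.
have {}C2 : #|C| + 2 <= #|V| by move: C2; card_lia.
have [p [q [y [y' [pq hqp py yq [hR full]]]]]] := covering_link irr A0 hC C2 Cmax str.
exfalso.
case: (ltnP 2 #|~: C|) => R3.
  exact: (no_long_cover irr A0 nb hC C2 Cmax hqp py yq hR full R3).
have R2 : #|~: C| = 2 by move: R3 nCR C2; card_lia.
have [t [pt lt ut ER ch]] := R_list C2 hR full.
move: R2; rewrite ER card_set_seq //; case: t pt lt ut ER {ch} => [|z [|w t]] //= pt lt ut ER _.
rewrite andbT in pt; subst z.
have yy' : y != y' by move: ut; rewrite inE andbT.
have RE : ~: C = [set y; y'] by rewrite ER; apply/setP => v; rewrite !inE.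
have [yR yR'] : y \in ~: C /\ y' \in ~: C by rewrite RE !inE !eqxx orbT.
have nyy := R_oriented irr nb C2 hqp py yq hR full yR yR' pt.
exact: (two_left_false irr A0 nb hC C2 Cmax pq hqp py yq RE yy' pt nyy).
Qed.

End PreHamiltonian.

(** * The vertex missed by a cycle of length n - 1 *)

Lemma filter_split (T : eqType) (P : pred T) l s1 u s2 :
  filter P l = s1 ++ u :: s2 ->
  exists l1 l2, [/\ l = l1 ++ u :: l2, filter P l1 = s1, filter P l2 = s2 & P u].
Proof.
elim: l s1 => [|z l IH] s1 /=; first by case: s1.
case: (boolP (P z)) => Pz.
  case: s1 => [|v s1] /= [<- E]; first by exists [::], l.
  by have [l1 [l2 [-> <- <- Pu]]] := IH _ E; exists (z :: l1), l2; rewrite /= Pz.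
by move=> /IH[l1 [l2 [-> <- <- Pu]]]; exists (z :: l1), l2; rewrite /= (negbTE Pz).
Qed.

Section Outside.
Variables (V : finType) (arc : rel V).
Hypothesis irr : irreflexive arc.
Hypothesis nb : ~ has_ham_bypass arc.
Local Notation n := #|V|.
Local Notation outs := (outs arc).
Local Notation ins := (ins arc).
Local Notation deg := (deg arc).
Local Notation hp := (hp arc).
Local Notation hcyc := (hcyc arc).
Local Notation dd := (dd arc).

Variable y : V.
Local Notation C := [set~ y].

Lemma card_C : #|C| + 1 = n.
Proof. by have := card_splitC [set y]; rewrite cards1; card_lia. Qed.

Lemma CUy : y |: C = setT.
Proof. by rewrite setUC setUC setUCr. Qed.

Lemma yNC : y \notin C.
Proof. by rewrite !inE eqxx. Qed.

Lemma no_hp_outs u w : hp C u w -> arc y u -> arc y w -> False.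
Proof.
move=> h yu yw; have := hp_consl h yu yNC; rewrite CUy => /(no_bypass_hp nb).
by rewrite yw.
Qed.

Lemma no_hp_ins u w : hp C u w -> arc u y -> arc w y -> False.
Proof.
move=> h uy wy; have := hp_consr h wy yNC; rewrite CUy => /(no_bypass_hp nb).
by rewrite uy.
Qed.

Lemma outs_C : outs y :&: C = outs y.
Proof.
by apply/setIidPl/subsetP => z; rewrite !inE; apply: contraTneq => ->; rewrite irr.
Qed.

Lemma ins_C : ins y :&: C = ins y.
Proof.
by apply/setIidPl/subsetP => z; rewrite !inE; apply: contraTneq => ->; rewrite irr.
Qed.

(** Consecutive vertices of the cycle are the ends of a Hamiltonian path of C, so they are neither
    both out- nor both in-neighbours of [y]. *)
Lemma half_degrees : hcyc C -> 2 * #|outs y| + 1 <= n /\ 2 * #|ins y| + 1 <= n.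
Proof.
move=> hC; have cC := card_C; split.
  have : #|outs y :&: C| + #|outs y :&: C| <= #|C|.
    apply: (cycle_count1 hC) => u w h; apply/negP; rewrite !inE => /andP[yw yu].
    exact: no_hp_outs h yu yw.
  by rewrite outs_C; move: cC; card_lia.
have : #|ins y :&: C| + #|ins y :&: C| <= #|C|.
  apply: (cycle_count1 hC) => u w h; apply/negP; rewrite !inE => /andP[yw yu].
  exact: no_hp_ins h yu yw.
by rewrite ins_C; move: cC; card_lia.
Qed.

Lemma missed_deg : hcyc C -> deg y + 1 <= n.
Proof. by move=> /half_degrees[]; have := degD arc y; card_lia. Qed.

Lemma dd_C_nonnbr x : ~~ arc x y -> ~~ arc y x -> deg x = dd x C.
Proof.
move=> n1 n2; rewrite (deg_split arc x [set y]) dd1.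
by rewrite (negbTE n1) (negbTE n2).
Qed.

(** For vertices joined to [y] in one direction this is equality of type; two-way neighbours, for
    which both alternatives may hold, are excluded only later, by [one_way]. *)
Definition same u w := (arc y u && arc y w) || (arc u y && arc w y).

Lemma sameC u w : same u w = same w u.
Proof. by rewrite /same andbC [arc w y && _]andbC. Qed.

Lemma no_hp_same u w : hp C u w -> ~~ same u w.
Proof.
move=> h; apply/negP => /orP[] /andP[]; [exact: no_hp_outs|exact: no_hp_ins].
Qed.

(** A cycle on all vertices but [y], opened at a chosen place: the list keeps the order that [hcyc]
    forgets. *)
Definition cyc l := [/\ uniq l, cycle arc l & [set z in l] = C].

Lemma cyc_rot l1 l2 : cyc (l1 ++ l2) -> cyc (l2 ++ l1).
Proof.
case=> u c E; split.
- by rewrite uniq_catC.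
- by rewrite -rot_size_cat rot_cycle.
- by rewrite set_seq_cat setUC -set_seq_cat.
Qed.

Lemma cyc_mem l z : cyc l -> (z \in l) = (z != y).
Proof. by case=> _ _ /setP/(_ z); rewrite !inE. Qed.

Lemma cyc_size l : cyc l -> size l + 1 = n.
Proof. by case=> u _ E; rewrite -card_set_seq // E card_C. Qed.

Lemma hcyc_cyc v : hcyc C -> v != y -> exists l, cyc (v :: l).
Proof.
move=> /hcycP[c [_ uc cc Ec]] vy; have : v \in c.
  by move/setP/(_ v): (Ec); rewrite !inE vy => <-.
move=> /rot_to[i t Et]; exists t; rewrite -Et; split.
- by rewrite rot_uniq.
- by rewrite rot_cycle.
- by apply/setP => z; rewrite Ec !inE mem_rot.
Qed.

Lemma cyc_hcyc l : cyc l -> l != [::] -> hcyc C.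
Proof. by case: l => // p s [u c <-] _; apply: cycle_hcyc. Qed.

Lemma cyc_segment l1 p s l2 : cyc (l1 ++ (p :: s) ++ l2) ->
  hp [set z in p :: s] p (last p s).
Proof.
move=> /cyc_rot; rewrite -catA => -[u c _]; apply: hp_seq.
  by move: c; rewrite /= rcons_cat cat_path => /andP[].
by move: u; rewrite cat_uniq => /and3P[].
Qed.

Lemma cyc_consecutive l1 u w l2 : cyc (l1 ++ u :: w :: l2) -> arc u w /\ hp C w u.
Proof.
move=> cl; have [ul cc E] := cl.
have cl' : cyc ((w :: l2) ++ rcons l1 u).
  by apply: cyc_rot; rewrite cat_rcons.
have h : hp [set z in w :: l2 ++ rcons l1 u] w (last w (l2 ++ rcons l1 u)).
  by apply: (@cyc_segment [::] w (l2 ++ rcons l1 u) [::]); rewrite cats0.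
move: h; rewrite last_cat last_rcons.
have -> : [set z in w :: l2 ++ rcons l1 u] = C by case: cl'.
move=> h; split=> //.
by have [_ + _] := cyc_rot cl; rewrite /= => /andP[].
Qed.

Lemma cyc_no_same l1 u w l2 : cyc (l1 ++ u :: w :: l2) -> ~~ same u w.
Proof. by move=> /cyc_consecutive[_ /no_hp_same]; rewrite sameC. Qed.

Definition X : {set V} := [set v | [&& v != y, ~~ arc y v & ~~ arc v y]].
Lemma X_def v : (v \in X) = [&& v != y, ~~ arc y v & ~~ arc v y]. Proof. by rewrite inE. Qed.

Definition nX v := arc y v || arc v y.

Lemma nXE v : nX v = arc y v || arc v y. Proof. by []. Qed.

Lemma sameE u w : same u w = (arc y u && arc y w) || (arc u y && arc w y). Proof. by []. Qed.

Lemma X_C v : v \in X -> v \in C.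
Proof. by rewrite !inE => /and3P[]. Qed.

Lemma nX_C v : nX v -> v != y.
Proof. by apply: contraTneq => ->; rewrite /nX irr. Qed.

Lemma X_nX v : v != y -> (v \in X) = ~~ nX v.
Proof. by move=> vy; rewrite inE vy negb_or. Qed.

Lemma X_deg x : x \in X -> deg x = dd x C.
Proof. by rewrite inE => /and3P[_ n1 n2]; apply: dd_C_nonnbr. Qed.

Lemma X_nadj x : x \in X -> ~~ adjacent arc x y.
Proof. by rewrite inE /adjacent negb_or => /and3P[_ -> ->]. Qed.

Lemma X_deg_le x : x \in X -> deg x + 4 <= 2 * n.
Proof.
move=> xX; rewrite (X_deg xX) (dd_self irr (X_C xX)).
have := dd_le arc x (C :\ x); have := cardsD1 x C; rewrite (X_C xX).
by have := card_C; card_lia.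
Qed.

(* If the whole run g could be inserted elsewhere, a Hamiltonian path on C would join p and q. *)
Lemma run_bad p g q t : condA0 arc -> cyc (p :: g ++ q :: t) -> (forall z, z \in g -> z \in X) ->
  same p q -> exists x, [/\ x \in g, deg x + 1 <= n & bad arc x y].
Proof.
move=> A0 cl gX pq; have [ul cc E] := cl; have cC := card_C.
have cl' : cyc ((q :: rcons t p) ++ g).
  by rewrite /= cat_rcons; apply: (@cyc_rot (p :: g) (q :: t)).
set S := [set z in q :: rcons t p]; set G := [set z in g].
have hS : hp S q p.
  have := cyc_segment (l1 := [::]) (p := q) (s := rcons t p) (l2 := g) cl'.
  by rewrite last_rcons.
have [ul' cc' E'] := cl'.
have SG : S :|: G = C by rewrite -E' set_seq_cat.
have dis : [disjoint S & G].
  rewrite -setI_eq0; apply/eqP/setP => z; rewrite in_setI !in_set; apply/negbTE/negP => /andP[z1 z2].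
  by move: ul'; rewrite cat_uniq => /and3P[_ /hasPn/(_ z z2)]; rewrite z1.
have [U [UG hU bU]] := hp_absorb irr hS dis.
(* All neighbours of [y] lie on the path, where consecutive vertices are never of the same type; so
   each type occurs at most (|S| + 1) / 2 times. *)
have dy : deg y <= #|S| + 1.
  have e1 (e : pred V) : (forall l1 u w l2, cyc (l1 ++ u :: w :: l2) -> ~~ (e u && e w)) ->
      2 * count e (q :: rcons t p) <= #|S| + 1.
    move=> H; have : path (fun u w => ~~ (e u && e w)) q (rcons t p).
      apply/negPn/negP => /not_path_split[s1 [w [s2 [Es]]]]; rewrite negbK => /andP[eu ew].
      have : cyc (belast q s1 ++ last q s1 :: w :: s2 ++ g).
        suff -> : belast q s1 ++ last q s1 :: w :: s2 ++ g = (q :: rcons t p) ++ g by [].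
        by rewrite -cat_rcons -lastI Es /= -catA.
      by move/H; rewrite eu ew.
    move/path_pair_count; rewrite /S card_set_seq ?(subseq_uniq _ ul') ?prefix_subseq //=.
    by case: (e q); case: (e (last _ _)) => /=; card_lia.
  have inC (A : {set V}) (e : pred V) : (forall z, (z \in A) = e z) -> ~~ e y ->
      (forall z, z \in g -> ~~ e z) -> #|A| = count e (q :: rcons t p).
    move=> Ae ey eg; rewrite -size_filter -(card_uniqP (filter_uniq _ _)).
      apply: eq_card => z; rewrite Ae mem_filter; case: (boolP (e z)) => //= ez.
      have zy : z != y by apply: contraNneq ey => <-.
      have := cyc_mem z cl'; rewrite mem_cat zy; case: (boolP (z \in g)) => [/eg|_]; first by rewrite ez.
      by rewrite orbF => ->.
    by apply: subseq_uniq ul'; apply: prefix_subseq.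
  have g1 z : z \in g -> ~~ arc y z by move=> /gX; rewrite inE => /and3P[].
  have g2 z : z \in g -> ~~ arc z y by move=> /gX; rewrite inE => /and3P[].
  have o1 : #|outs y| = count (arc y) (q :: rcons t p).
    by apply: inC => //; [move=> z; rewrite inE | rewrite irr].
  have o2 : #|ins y| = count (arc^~ y) (q :: rcons t p).
    by apply: inC => //; [move=> z; rewrite inE | rewrite /= irr].
  rewrite degD o1 o2.
  have : 2 * count (arc y) (q :: rcons t p) <= #|S| + 1.
    by apply: e1 => l1 u w l2 /cyc_no_same; rewrite /same negb_or => /andP[].
  have : 2 * count (arc^~ y) (q :: rcons t p) <= #|S| + 1.
    by apply: e1 => l1 u w l2 /cyc_no_same; rewrite /same negb_or => /andP[].
  by card_lia.
have UX x : x \in U -> x \in X by move=> /(subsetP UG); rewrite inE => /gX.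
have cSG : #|S| + #|G| = #|C|.
  rewrite -SG cardsU (_ : S :&: G = set0) ?cards0 ?subn0 //; by apply/eqP; rewrite setI_eq0.
have leU := subset_leq_card UG.
have dU x : x \in U -> deg x + 1 <= n + #|U| - 1.
  move=> xU; have := bU x xU; rewrite SG (X_deg (UX x xU)); move: cC.
  have : 0 < #|U| by apply/card_gt0P; exists x.
  by case: (arc x q); case: (arc p x) => /=; card_lia.
have badU x : x \in U -> bad arc x y.
  move=> xU; have xX := UX x xU; rewrite /bad X_nadj //=.
  have -> : x != y by have := X_C xX; rewrite !inE.
  have := dU x xU; have : 0 < #|U| by apply/card_gt0P; exists x.
  by move: dy cSG leU cC; card_lia.
case: (set_0Vmem U) => [U0|[x xU]].
  by move: hU; rewrite U0 setD0 SG => /no_hp_same; rewrite sameC pq.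
(* Every stuck vertex is bad with [y], and bad pairs are disjoint. *)
have U1 : U = [set x].
  apply/setP => z; rewrite inE; apply/idP/eqP => [zU|->//].
  by apply: (bad_uniq A0 (x := y)); rewrite badC badU.
exists x; split; last exact: badU.
  by have := subsetP UG x xU; rewrite inE.
by have := dU x xU; rewrite U1 cards1; card_lia.
Qed.

End Outside.

Ltac perm_count := apply/permP => ?;
  do 6 (rewrite -?cats1 /= ?count_cat /=); clear; lia.

Lemma filter_nil (T : eqType) (P : pred T) (l : seq T) : filter P l = [::] -> forall z, z \in l -> ~~ P z.
Proof.
move=> E z zl; apply/negP => Pz; have : z \in filter P l by rewrite mem_filter Pz.
by rewrite E.
Qed.

Lemma filter_split2 (T : eqType) (P : pred T) l s1 u w s2 :
  filter P l = s1 ++ u :: w :: s2 ->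
  exists l1 g l2, [/\ l = l1 ++ u :: g ++ w :: l2, filter P l1 = s1, filter P l2 = s2 &
    forall z, z \in g -> ~~ P z].
Proof.
move=> /filter_split[l1 [l' [-> E1 E2 _]]].
have [g [l2 [-> Eg El2 _]]] := filter_split (s1 := [::]) E2.
by exists l1, g, l2; split=> //; apply: filter_nil.
Qed.

Lemma filter_trim (T : eqType) (P : pred T) l v f : filter P l = v :: f ->
  exists g0 M g1, [/\ l = g0 ++ (v :: M) ++ g1, filter P (v :: M) = v :: f, last v M = last v f,
    forall z, z \in g0 -> ~~ P z & forall z, z \in g1 -> ~~ P z].
Proof.
move=> /(filter_split (s1 := [::]))[g0 [l2 [-> E0 E2 Pv]]].
have n0 := filter_nil E0.
case/lastP: f E2 => [|f w] E2.
  by exists g0, [::], l2; split=> //=; [rewrite Pv | apply: filter_nil].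
rewrite -cats1 in E2; have [M [g1 [-> EM E1 Pw]]] := filter_split E2.
exists g0, (rcons M w), g1; split=> //.
- by rewrite /= cat_rcons.
- by rewrite /= Pv filter_rcons Pw EM.
- by rewrite !last_rcons.
- exact: filter_nil.
Qed.

(** * Paths with visible vertex lists *)

Section Walk.
Variables (V : finType) (arc : rel V).

Definition walk (L : seq V) (p q : V) := exists s, [/\ L = p :: s, path arc p s & last p s = q].

Lemma walk1 p : walk [:: p] p p.
Proof. by exists [::]. Qed.

Lemma walk_cat L L' p q p' q' : walk L p q -> walk L' p' q' -> arc q p' -> walk (L ++ L') p q'.
Proof.
move=> [s [-> ps ls]] [t [-> pt lt]] a; exists (s ++ p' :: t); split=> //.
  by rewrite cat_path ps /= ls a.
by rewrite last_cat.
Qed.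

Lemma walk_split L1 u L2 p q : walk (L1 ++ u :: L2) p q ->
  walk (rcons L1 u) p u /\ walk (u :: L2) u q.
Proof.
case=> s [E ps ls]; case: L1 E => [|v L1] /= [Ev E].
  by subst; split; [exists [::] | exists s].
subst v; subst s; move: ps ls; rewrite cat_path last_cat /= => /and3P[p1 a p2] ls.
split; last by exists L2.
by exists (rcons L1 u); rewrite rcons_path p1 last_rcons.
Qed.

(** The run [g] is replaced by [z]; its vertices have to be absorbed elsewhere afterwards. *)
Lemma walk_host L p q l1 j g o l2 z : walk L p q ->
  L = l1 ++ j :: g ++ o :: l2 -> arc j z -> arc z o -> walk (rcons l1 j ++ [:: z] ++ o :: l2) p q.
Proof.
move=> w E jz zo; have w1 : walk (rcons l1 j) p j by move: w; rewrite E => /walk_split[].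
have w2 : walk (o :: l2) o q.
  have : walk ((l1 ++ j :: g) ++ o :: l2) p q by rewrite -catA /= -E.
  by case/walk_split.
exact: walk_cat w1 (walk_cat (walk1 z) w2 zo) jz.
Qed.

Lemma walk_hp L p q : walk L p q -> uniq L -> hp arc [set z in L] p q.
Proof. by case=> s [-> ps ls] u; exists s. Qed.

Lemma cyc_walk y l1 p s l2 : cyc arc y (l1 ++ (p :: s) ++ l2) -> walk (p :: s) p (last p s).
Proof.
move=> /cyc_rot; rewrite -catA => -[_ c _]; exists s; split=> //.
by move: c; rewrite /= rcons_cat cat_path => /andP[].
Qed.

Lemma cyc_perm_set y l l' : cyc arc y l -> perm_eq l' l -> uniq l' /\ [set z in l'] = [set~ y].
Proof.
case=> u _ E p; split; first by rewrite (perm_uniq p).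
by rewrite -E; apply/setP => z; rewrite !inE (perm_mem p).
Qed.

Lemma cyc_perm_setT y l l' : cyc arc y l -> perm_eq l' (y :: l) ->
  uniq l' /\ [set z in l'] = setT.
Proof.
move=> c p; have [u _ E] := c; have yl : y \notin l by rewrite (cyc_mem y c) eqxx.
split; first by rewrite (perm_uniq p) /= yl.
apply/setP => z; rewrite !inE (perm_mem p) inE (cyc_mem z c).
by case: (z == y).
Qed.

End Walk.

(** * Absorbing non-neighbours *)

Section Nonneighbours.
Variables (V : finType) (arc : rel V).
Hypothesis irr : irreflexive arc.
Hypothesis A0 : condA0 arc.
Hypothesis nb : ~ has_ham_bypass arc.
Hypothesis n4 : 4 <= #|V|.
Hypothesis str : strongly_connected arc.
Local Notation n := #|V|.
Local Notation outs := (outs arc).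
Local Notation ins := (ins arc).
Local Notation deg := (deg arc).
Local Notation hp := (hp arc).
Local Notation hcyc := (hcyc arc).
Local Notation dd := (dd arc).
Variable y : V.
Local Notation C := [set~ y].
Local Notation X := (X arc y).
Local Notation nX := (nX arc y).
Local Notation same := (same arc y).
Local Notation cyc := (cyc arc y).
Hypothesis hC : hcyc C.

Lemma nonnbr_split : exists x0, forall x, x \in X -> x != x0 -> 2 * n <= deg x + deg y + 1.
Proof.
case: (classic (exists x, bad arc y x)) => [[x0 b0]|nob].
  exists x0 => x xX xx0; rewrite leqNgt; apply/negP => lt; case/eqP: xx0.
  apply: (bad_uniq A0 (x := y)) b0; rewrite badC /bad X_nadj //=.
  have := X_C xX; rewrite !inE => -> /=; move: lt; card_lia.
(* There is no exception: [y] serves as a dummy, being no element of [X]. *)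
exists y => x xX _; rewrite leqNgt; apply/negP => lt; apply: nob; exists x.
rewrite badC /bad X_nadj //=.
have := X_C xX; rewrite !inE => -> /=; move: lt; card_lia.
Qed.

Lemma nX_notX (l : seq V) : (forall z, z \in l -> z != y) -> (forall z, z \in l -> ~~ nX z) ->
  forall z, z \in l -> z \in X.
Proof. by move=> H1 H2 z zl; rewrite X_nX ?H1 ?H2. Qed.

(** A vertex [v] joined to [y] both ways has the same type as every neighbour. By [run_bad] the runs
    just after and just before [v] would then both contain a vertex bad with [y]. *)
Lemma one_way v : arc y v -> arc v y = false.
Proof.
move=> yv; apply/negbTE/negP => vy.
have vy' : v != y by apply: contraTneq yv => ->; rewrite irr.
have [t cl] := hcyc_cyc hC vy'; have [ul cc Ec] := cl.
have ty z : z \in t -> z != y by move=> zt; rewrite -(cyc_mem z cl) inE zt orbT.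
have sv q : nX q -> same v q by rewrite sameE nXE yv vy /= => ->.
(* If [v] is the only neighbour, d(y) = 2 is too small for an ordinary non-neighbour. *)
case Ef : (filter nX t) => [|q f].
  have aX := nX_notX ty (filter_nil Ef).
  have [x0 good] := nonnbr_split.
  have tE : [set z in t] \subset X by apply/subsetP => z; rewrite inE => /aX.
  have st := cyc_size cl; rewrite /= in st.
  have ct : #|[set z in t]| = size t by rewrite card_set_seq //; move: ul => /andP[].
  have [x xt xx0] : exists2 x, x \in [set z in t] & x != x0.
    by apply: card_ex2; rewrite ct; move: st n4; card_lia.
  have xX := subsetP tE x xt; have := good x xX xx0; have := X_deg_le irr xX.
  rewrite [deg y](deg_split arc y [set v]) dd1 yv vy.
  rewrite [dd y _]dd0; first by rewrite /=; card_lia.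
  move=> z; rewrite !inE => zv; case: (eqVneq z y) => [->|zy]; first by rewrite irr.
  have : z \in v :: t by rewrite (cyc_mem z cl).
  by rewrite inE (negbTE zv) /= => /aX; rewrite inE => /and3P[_ -> ->].
have [g0 [M [g1 [Et EM lM n0 n1]]]] := filter_trim Ef.
have Pq : nX q.
  have : q \in filter nX t by rewrite Ef inE eqxx.
  by rewrite mem_filter => /andP[].
have Pl : nX (last q M).
  have : last q f \in filter nX t by rewrite Ef mem_last.
  by rewrite mem_filter lM => /andP[].
have c0 : cyc (v :: g0 ++ q :: M ++ g1) by rewrite Et in cl.
have X0 : forall z, z \in g0 -> z \in X.
  by apply: nX_notX n0 => z zg; apply: ty; rewrite Et mem_cat zg.
have X1 : forall z, z \in g1 -> z \in X.
  by apply: nX_notX n1 => z zg; apply: ty; rewrite Et !mem_cat zg !orbT.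
have [x [xg0 _ b0]] := run_bad irr nb A0 c0 X0 (sv q Pq).
have c1 : cyc (last q M :: g1 ++ v :: g0 ++ belast q M).
  have := @cyc_rot _ arc y (v :: g0 ++ belast q M) (last q M :: g1); apply.
  by rewrite /= -catA -cat_rcons -lastI.
have s1 : same (last q M) v by rewrite sameC sv.
have [x' [xg1 _ b1]] := run_bad irr nb A0 c1 X1 s1.
have Ex : x = x' by apply: (bad_uniq A0 (x := y)); rewrite badC.
move: ul; rewrite Et /= cat_uniq -Ex in xg1 * => /and3P[_ _ /andP[/hasPn H _]].
by have := H x; rewrite in_cons mem_cat xg1 !orbT xg0 => /(_ isT).
Qed.

Lemma nX_type v : nX v -> arc v y = ~~ arc y v.
Proof.
rewrite nXE; case: (boolP (arc y v)) => [/one_way -> //|_ /= ->//].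
Qed.

Lemma same_type u w : nX u -> nX w -> same u w = (arc y u == arc y w).
Proof.
move=> hu hw; rewrite sameE (nX_type hu) (nX_type hw).
by case: (arc y u); case: (arc y w).
Qed.

Lemma X_count : #|X| + #|outs y| + #|ins y| + 1 = n.
Proof.
have cC := card_C y.
have d1 : [disjoint outs y & ins y].
  rewrite -setI_eq0; apply/eqP/setP => z; rewrite !inE.
  by apply/negbTE/negP => /andP[/one_way ->].
have d2 : [disjoint X & outs y :|: ins y].
  rewrite -setI_eq0; apply/eqP/setP => z; rewrite !inE.
  by case: (arc y z); case: (arc z y); rewrite ?andbF.
have E : X :|: (outs y :|: ins y) = C.
  apply/setP => z; rewrite !inE; case: (eqVneq z y) => [->|_]; first by rewrite irr.
  by case: (arc y z); case: (arc z y).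
have := cardsU X (outs y :|: ins y); have := cardsU (outs y) (ins y).
rewrite (disjoint_setI0 d1) (disjoint_setI0 d2) cards0 E.
by move: cC; card_lia.
Qed.

Lemma outs_ex : exists o, arc y o.
Proof.
have [v _ vy] : exists2 v, v \in [set: V] & v != y by apply: card_ex2; rewrite cardsT; apply: leq_trans n4.
by case/connectP: (str y v) => -[|o s] /=; [move=> _ E; rewrite E eqxx in vy | case/andP; exists o].
Qed.

Lemma ins_ex : exists j, arc j y.
Proof.
have [v _ vy] : exists2 v, v \in [set: V] & v != y by apply: card_ex2; rewrite cardsT; apply: leq_trans n4.
case/connectP: (str v y) => s; case/lastP: s => [|s z].
  by move=> _ /= E; rewrite E eqxx in vy.
by rewrite rcons_path last_rcons => /andP[_ a] E; rewrite -E in a; exists (last v s).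
Qed.

(** A_0 for [y] and a non-neighbour, with an in-neighbour j of [y] as third vertex: if [y] had only
    two neighbours, the sum would be at most 3n - 1 instead of 3n. *)
Lemma type_count : 0 < #|X| -> 3 <= #|outs y| + #|ins y|.
Proof.
case/card_gt0P => x xX; rewrite leqNgt; apply/negP => lt.
have [j jy] := ins_ex.
have yj : ~~ arc y j by apply/negP => /one_way; rewrite jy.
have xy : x != y by have := X_C xX; rewrite !inE.
have yx : y != x by rewrite eq_sym.
have xj : x != j by apply: contraTneq xX => ->; rewrite !inE jy !andbF.
have yj' : y != j by apply: contraTneq jy => <-; rewrite irr.
have nadj : ~~ adjacent arc y x by rewrite adjacentC X_nadj.
have := A0_out A0 yx xj yj' nadj yj; have := X_deg_le irr xX.
have [o yo] := outs_ex.
have : 0 < #|outs y| by apply/card_gt0P; exists o; rewrite inE.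
have : 0 < #|ins y| by apply/card_gt0P; exists j; rewrite inE.
have : #|ins j| + 2 <= n.
  have : ins j \subset ~: [set y; j].
    by apply/subsetP => z; rewrite !inE negb_or => zj; apply/andP; split;
      apply: contraTneq zj => ->; rewrite ?irr.
  by move/subset_leq_card; have := cardsC [set y; j]; rewrite cards2 yj'; card_lia.
by move: lt; rewrite [deg y]degD; card_lia.
Qed.

Section Good.
Variable x0 : V.
Hypothesis good : forall x, x \in X -> x != x0 -> 2 * n <= deg x + deg y + 1.

Lemma good_deg x : x \in X -> x != x0 -> n + #|X| <= deg x.
Proof. by move=> xX xx; have := good xX xx; have := X_count; rewrite [deg y]degD; card_lia. Qed.

(** Here [c] bounds the arcs of a vertex of [G] that leave [S :|: G]. A stuck vertex has degree
    below |S| + |G| + |U| + c, too little for an ordinary non-neighbour; so [x0] could only be stuck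
    alone, and then its own degree bound decides. *)
Lemma absorb_all (S G : {set V}) p q c : hp S p q -> [disjoint S & G] -> G \subset X ->
  (forall x, x \in G -> deg x <= dd x (S :|: G) + c) ->
  (x0 \in G -> #|S :|: G| + c + 1 <= deg x0) ->
  #|S :|: G| + c + #|G| <= n + #|X| -> hp (S :|: G) p q.
Proof.
move=> hS dis GX Gc G0 Gn; have [U [UG hU bU]] := hp_absorb irr hS dis.
have leU := subset_leq_card UG.
have dU x : x \in U -> deg x + 1 <= #|S :|: G| + #|U| + c.
  move=> xU; have := bU x xU; have := Gc x (subsetP UG x xU).
  by case: (arc x p); case: (arc q x) => /=; card_lia.
have U0 x : x \in U -> x = x0.
  move=> xU; apply/eqP/negPn/negP => xx; have xX := subsetP GX x (subsetP UG x xU).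
  by have := good_deg xX xx; have := dU x xU; move: Gn leU; card_lia.
case: (set_0Vmem U) => [E|[x xU]]; first by rewrite E setD0 in hU.
have Ex := U0 x xU; subst x.
have U1 : U = [set x0].
  by apply/setP => z; rewrite inE; apply/idP/eqP => [/U0|->].
have := G0 (subsetP UG _ xU); have := dU x0 xU; rewrite U1 cards1.
card_lia.
Qed.

Lemma set_cat_disjoint (L g : seq V) : uniq (L ++ g) -> [disjoint [set z in L] & [set z in g]].
Proof.
rewrite cat_uniq => /and3P[_ /hasPn H _]; rewrite -setI_eq0; apply/eqP/setP => z; rewrite !inE.
by apply/negbTE/negP => /andP[zL /H]; rewrite /= zL.
Qed.

Lemma card_seq_X (g : seq V) : uniq g -> (forall z, z \in g -> z \in X) -> #|[set z in g]| <= #|X|.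
Proof. by move=> ug gX; apply: subset_leq_card; apply/subsetP => z; rewrite inE => /gX. Qed.

Lemma absorb_C l L g p q : cyc l -> walk arc L p q -> perm_eq (L ++ g) l ->
  (forall z, z \in g -> z \in X) -> (x0 \in g -> n <= deg x0) -> hp C p q.
Proof.
move=> cl wL pe gX g0; have [u E] := cyc_perm_set cl pe; have cC := card_C y.
move: (u); rewrite cat_uniq => /and3P[uL _ ug].
have := absorb_all (c := 0) (walk_hp wL uL) (set_cat_disjoint u).
rewrite -set_seq_cat E; apply.
- by apply/subsetP => z; rewrite inE => /gX.
- by move=> x; rewrite inE => /gX /X_deg ->; rewrite addn0.
- by rewrite inE => /g0; move: cC; card_lia.
- by have := card_seq_X ug gX; move: cC; card_lia.
Qed.

Lemma absorb_V l L g p q : cyc l -> walk arc L p q -> perm_eq (L ++ g) (y :: l) ->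
  (forall z, z \in g -> z \in X) -> (x0 \in g -> n + 1 <= deg x0) -> hp setT p q.
Proof.
move=> cl wL pe gX g0; have [u E] := cyc_perm_setT cl pe.
move: (u); rewrite cat_uniq => /and3P[uL _ ug].
have := absorb_all (c := 0) (walk_hp wL uL) (set_cat_disjoint u).
rewrite -set_seq_cat E cardsT; apply.
- by apply/subsetP => z; rewrite inE => /gX.
- by move=> x _; rewrite degE addn0.
- by rewrite inE => /g0; card_lia.
- by have := card_seq_X ug gX; card_lia.
Qed.

(** The choice [c := 2] pays for the two possible arcs with [x]; in return the host has one vertex
    less and [g] at most |X| - 1 vertices. *)
Lemma absorb_skip l L g p q x : cyc l -> walk arc L p q -> perm_eq (L ++ g ++ [:: x]) (y :: l) ->
  (forall z, z \in g -> z \in X) -> x \in X -> x0 \notin g -> hp [set~ x] p q.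
Proof.
move=> cl wL pe gX xX g0; have [u E] := cyc_perm_setT cl pe.
move: (u); rewrite catA cats1 rcons_uniq => /andP[xLg uLg].
move: (uLg); rewrite cat_uniq => /and3P[uL _ ug].
have E' : [set z in L ++ g] = [set~ x].
  apply/setP => z; move/setP/(_ z): E; rewrite !inE catA cats1 mem_rcons inE.
  by case: (eqVneq z x) => [->|_] //=; rewrite (negbTE xLg).
have := absorb_all (c := 2) (walk_hp wL uL) (set_cat_disjoint uLg).
have cC := card_C x.
rewrite -set_seq_cat E'; apply.
- by apply/subsetP => z; rewrite inE => /gX.
- move=> v _; rewrite (deg_split arc v [set~ x]) setCK dd1.
  by case: arc; case: arc => /=; card_lia.
- by rewrite inE (negbTE g0).
- have xg : x \notin g by move: xLg; rewrite mem_cat negb_or => /andP[].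
  have ux : uniq (x :: g) by rewrite /= xg.
  have := card_seq_X ux; rewrite !card_set_seq //= => H.
  have : (size g).+1 <= #|X| by apply: H => z; rewrite inE => /predU1P[->|/gX].
  by move: cC; card_lia.
Qed.

(** A complete insertion would give a Hamiltonian path of C with ends of the same type.
    Non-neighbours have too large a degree to be stuck, so [v] is the only vertex left out; to the
    bound for a single stuck vertex comes its one arc with [y]. *)
Lemma low_set l L g p q v : cyc l -> walk arc L p q -> perm_eq (L ++ v :: g) l ->
  (forall z, z \in g -> z \in X) -> (x0 \in g -> n + 1 <= deg x0) -> nX v -> same p q ->
  deg v + 2 <= n + arc v p + arc q v.
Proof.
move=> cl wL pe gX g0 vX pq; have [u E] := cyc_perm_set cl pe; have cC := card_C y.
move: (u); rewrite cat_uniq => /and3P[uL _ uvg]; have /andP[vg ug] := uvg.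
have [U [UG hU bU]] := hp_absorb irr (walk_hp wL uL) (set_cat_disjoint u).
rewrite -set_seq_cat E in bU.
have cG : #|[set z in v :: g]| <= #|X| + 1.
  by have := card_seq_X ug gX; rewrite !card_set_seq //=; card_lia.
have leU := subset_leq_card UG.
have gU x : x \in U -> x != v -> x \in g.
  by move=> /(subsetP UG); rewrite !inE => /predU1P[->|//]; rewrite eqxx.
have dU x : x \in U -> x != v -> deg x + 2 <= n + #|U|.
  move=> xU xv; have := bU x xU; rewrite -X_deg; last by apply/gX/gU.
  by move: cC; case: (arc x p); case: (arc q x) => /=; card_lia.
have U0 x : x \in U -> x != v -> x = x0.
  move=> xU xv; apply/eqP/negPn/negP => xx.
  by have := good_deg (gX x (gU x xU xv)) xx; have := dU x xU xv; move: cG leU; card_lia.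
have U1 x : x \in U -> x = v.
  move=> xU; apply/eqP/negPn/negP => xv; have Ex := U0 x xU xv; subst x.
  have : U \subset [set x0; v].
    by apply/subsetP => z zU; rewrite !inE; case: (eqVneq z v) => [->|zv]; rewrite ?eqxx ?orbT // (U0 z zU zv) eqxx.
  move/subset_leq_card; have := cards2 x0 v; rewrite xv.
  by have := g0 (gU x0 xU xv); have := dU x0 xU xv; card_lia.
case: (set_0Vmem U) => [E0|[x xU]].
  move: hU; rewrite E0 setD0 -set_seq_cat E => /(no_hp_same nb).
  by rewrite pq.
have Ex := U1 x xU; subst x.
have UE : U = [set v] by apply/setP => z; rewrite inE; apply/idP/eqP => [/U1|->].
have := bU v xU; rewrite UE cards1 (deg_split arc v [set y]) dd1 (nX_type vX).
by move: cC; case: (arc y v) => /=; card_lia.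
Qed.

End Good.
End Nonneighbours.

(** * Alternating types and small degrees of neighbours *)

Section Alternation.
Variables (V : finType) (arc : rel V).
Hypothesis irr : irreflexive arc.
Hypothesis A0 : condA0 arc.
Hypothesis nb : ~ has_ham_bypass arc.
Hypothesis n4 : 4 <= #|V|.
Hypothesis str : strongly_connected arc.
Local Notation n := #|V|.
Local Notation outs := (outs arc).
Local Notation ins := (ins arc).
Local Notation deg := (deg arc).
Local Notation hcyc := (hcyc arc).
Variable y : V.
Local Notation C := [set~ y].
Local Notation X := (X arc y).
Local Notation nX := (nX arc y).
Local Notation same := (same arc y).
Local Notation cyc := (cyc arc y).
Hypothesis hC : hcyc C.
Hypothesis X1 : 0 < #|X|.

Lemma count_nX l x : cyc (x :: l) -> x \in X -> size (filter nX l) = #|outs y| + #|ins y|.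
Proof.
move=> cl xX; have [ul _ E] := cl; have ul' : uniq l by case/andP: ul.
have nXx : ~~ nX x by rewrite -X_nX // -[x != y](cyc_mem x cl) inE eqxx.
have := X_count irr A0 nb n4 hC; have := card_C y.
have : #|[set z in filter nX l]| + #|X| = #|C|.
  rewrite -E -(cardsID X [set z in x :: l]) addnC; congr (_ + _).
    apply: eq_card => z; rewrite !inE -!in_cons (cyc_mem z cl).
    by rewrite andbC; case: (z != y); rewrite ?andbF.
  apply: eq_card => z; rewrite in_setD [LHS]in_set [X in _ = _ && X]in_set mem_filter.
  case: (eqVneq z x) => [->|zx]; first by rewrite (negbTE nXx) xX.
  rewrite in_cons (negbTE zx) /=; case: (boolP (z \in l)) => zl; rewrite ?andbF // !andbT.
  rewrite X_nX ?negbK //; by rewrite -(cyc_mem z cl) inE zl orbT.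
rewrite card_set_seq ?filter_uniq //.
by card_lia.
Qed.

Lemma cyc_X (l g : seq V) : cyc l -> {subset g <= l} -> (forall z, z \in g -> ~~ nX z) ->
  forall z, z \in g -> z \in X.
Proof.
by move=> cl gl gn; apply: nX_notX gn => z /gl; rewrite (cyc_mem z cl).
Qed.

(** A_0 with third vertex [y] bounds the in-degree of [o] plus the out-degree of [j], so that more
    than |X| vertices z have no arc to [o] and none from [j]. One of these is [y] or a neighbour of
    [y], hence d(z) <= n; the two instances with third vertex z make the sum of all four
    contradictory. *)
Lemma big_degree_false o j : nX o -> nX j -> arc y o -> arc j y -> ~~ adjacent arc o j ->
  deg o + deg j + 2 <= 2 * n -> (forall v, nX v -> deg v <= n) -> False.
Proof.
move=> oX jX yo jy nadj d2 low.
have oy : ~~ arc o y by rewrite (one_way irr A0 nb n4 hC yo).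
have yj : ~~ arc y j by apply/negP => /(one_way irr A0 nb n4 hC); rewrite jy.
have [oy' jy'] : o != y /\ j != y by rewrite !(nX_C irr).
have [yo' yj'] : y != o /\ y != j by rewrite ![y == _]eq_sym.
have oj : o != j by apply: contraTneq yo => ->.
have jo : j != o by rewrite eq_sym.
have nadj' : ~~ adjacent arc j o by rewrite adjacentC.
have e1 := A0_out A0 oj jy' oy' nadj oy.
have e2 := A0_in A0 jo oy' jy' nadj' yj.
have cX := X_count irr A0 nb n4 hC.
pose Z := ~: ([set o; j] :|: ins o :|: outs j).
have cZ : #|X| < #|Z|.
  have := cardsC ([set o; j] :|: ins o :|: outs j); rewrite -/Z.
  have := (leq_card_setU ([set o; j] :|: ins o) (outs j)).1.
  have := (leq_card_setU [set o; j] (ins o)).1.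
  rewrite cards2 oj; move: e1 e2 d2 cX; rewrite !degD; card_lia.
have [z] : exists z, z \in Z :\: X.
  by apply: card_ex; have := cardsID X Z; have := subset_leq_card (subsetIr Z X); move: cZ; card_lia.
rewrite in_setD => /andP[zX].
rewrite /Z in_setC !in_setU in_set1 in_set1 !negb_or !in_set => /andP[/andP[/andP[zo zj] zo'] jz].
have oz : o != z by rewrite eq_sym.
have jz' : j != z by rewrite eq_sym.
have e3 := A0_in A0 oj jz' oz nadj zo'.
have e4 := A0_out A0 jo oz jz' nadj' jz.
have dy : deg y + 1 <= n := missed_deg irr nb hC.
have dz : deg z <= n.
  case: (eqVneq z y) => [->|zy]; first by move: dy; card_lia.
  by apply: low; move: zX; rewrite X_nX // negbK.
by move: e1 e2 e3 e4 d2 cX dz dy; rewrite !degD; card_lia.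
Qed.

Section Structure.
(** These two properties are assumed for now: their proofs differ according to whether a
    non-neighbour of degree at most n exists. *)
Hypothesis AltAll : forall p g q t, cyc (p :: g ++ q :: t) -> (forall z, z \in g -> z \in X) ->
  nX p -> nX q -> arc y p != arc y q.
Hypothesis LowAll : forall v1 g1 v g2 v2 t, cyc (v1 :: g1 ++ v :: g2 ++ v2 :: t) ->
  (forall z, z \in g1 ++ g2 -> z \in X) -> nX v1 -> nX v -> nX v2 ->
  deg v + 2 <= n + arc v v2 + arc v1 v.

Lemma size_filter_ge3 l : cyc l -> 3 <= size (filter nX l).
Proof.
move=> cl; have [x xX] := card_gt0P X1.
have : x \in l by rewrite (cyc_mem x cl); have := X_C xX; rewrite !inE.
move=> xl; have [i t Et] := rot_to xl.
have ct : cyc (x :: t).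
  by rewrite -Et /rot; apply: cyc_rot; rewrite cat_take_drop.
have nXx : ~~ nX x by rewrite -X_nX // -(cyc_mem x ct) inE eqxx.
have -> : size (filter nX l) = size (filter nX (x :: t)).
  by apply/perm_size/perm_filter; rewrite -Et perm_sym perm_rot.
rewrite /= (negbTE nXx) (count_nX ct xX).
exact: (type_count irr A0 nb n4 str hC X1).
Qed.

(** There are at least three neighbours, so the neighbour preceding [v] differs from [q]; its arc to
    [v] is estimated by 1. *)
Lemma low_next v g q t : cyc (v :: g ++ q :: t) -> (forall z, z \in g -> z \in X) ->
  nX v -> nX q -> deg v + 1 <= n + arc v q.
Proof.
move=> cl gX vX qX; have := size_filter_ge3 cl.
have gf : filter nX g = [::].
  apply/eqP; rewrite -size_eq0 size_filter -leqn0 leqNgt -has_count; apply/hasPn => z /gX.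
  by rewrite X_def nXE negb_or => /and3P[_ -> ->].
rewrite /= vX filter_cat gf /= qX /=; case/lastP Ef : (filter nX t) => [|f u] //= _.
rewrite -cats1 in Ef; have [t1 [h1 [Et _ Eh uX]]] := filter_split Ef.
have hX : forall z, z \in h1 -> z \in X.
  apply: (cyc_X cl); last exact: filter_nil.
  by move=> z zh; rewrite Et !(inE, mem_cat) zh !orbT.
have := LowAll (v1 := u) (g1 := h1) (v := v) (g2 := g) (v2 := q) (t := t1).
case: (arc u v) => H; last first.
  have : deg v + 2 <= n + arc v q + false; last by card_lia.
  apply: H => //; last by move=> z; rewrite mem_cat => /orP[/hX|/gX].
  have := @cyc_rot _ arc y (v :: g ++ q :: t1) (u :: h1); rewrite /= -!catA /=; apply.
  by rewrite Et in cl.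
have : deg v + 2 <= n + arc v q + true; last by card_lia.
apply: H => //; last by move=> z; rewrite mem_cat => /orP[/hX|/gX].
have := @cyc_rot _ arc y (v :: g ++ q :: t1) (u :: h1); rewrite /= -!catA /=; apply.
by rewrite Et in cl.
Qed.

Lemma low_prev p g v t : cyc (p :: g ++ v :: t) -> (forall z, z \in g -> z \in X) ->
  nX p -> nX v -> deg v + 1 <= n + arc p v.
Proof.
move=> cl gX pX vX; have := size_filter_ge3 cl.
have gf : filter nX g = [::].
  apply/eqP; rewrite -size_eq0 size_filter -leqn0 leqNgt -has_count; apply/hasPn => z /gX.
  by rewrite X_def nXE negb_or => /and3P[_ -> ->].
rewrite /= pX filter_cat gf /= vX /=; case Ef : (filter nX t) => [|u f] //= _.
have [h0 [t1 [Et Eh _ uX]]] := filter_split (s1 := [::]) Ef.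
have hX : forall z, z \in h0 -> z \in X.
  apply: (cyc_X cl); last exact: filter_nil.
  by move=> z zh; rewrite Et !(inE, mem_cat) zh !orbT.
have : deg v + 2 <= n + arc v u + arc p v.
  apply: (@LowAll p g v h0 u t1) => //; first by rewrite Et in cl.
  by move=> z; rewrite mem_cat => /orP[/gX|/hX].
by case: (arc v u) => /=; card_lia.
Qed.

Lemma low_all v : nX v -> deg v <= n.
Proof.
move=> vX; have vy := nX_C irr vX; have [l cl] := hcyc_cyc hC vy.
have := size_filter_ge3 cl; rewrite /= vX /=; case Ef : (filter nX l) => [|u f] //= _.
have [h0 [t1 [Et Eh _ uX]]] := filter_split (s1 := [::]) Ef.
have hX : forall z, z \in h0 -> z \in X.
  apply: (cyc_X cl); last exact: filter_nil.
  by move=> z zh; rewrite Et !(inE, mem_cat) zh !orbT.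
rewrite Et in cl; have := low_next cl hX vX uX; by case: (arc v u) => /=; card_lia.
Qed.

Lemma run_ends_adjacent p g q t : cyc (p :: g ++ q :: t) -> (forall z, z \in g -> z \in X) ->
  nX p -> nX q -> adjacent arc p q.
Proof.
move=> cl gX pX qX; apply/negPn/negP => nadj.
have d1 := low_next cl gX pX qX; have d2 := low_prev cl gX pX qX.
have opp := AltAll cl gX pX qX.
move: (nadj); rewrite /adjacent negb_or => /andP[npq nqp].
rewrite (negbTE npq) in d1 d2.
case: (boolP (arc y p)) opp => yp; case: (boolP (arc y q)) => yq // _.
  have qy : arc q y by rewrite (nX_type irr A0 nb n4 hC qX) yq.
  by apply: (big_degree_false pX qX yp qy nadj) low_all; move: d1 d2; card_lia.
have py : arc p y by rewrite (nX_type irr A0 nb n4 hC pX) yp.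
rewrite adjacentC in nadj.
by apply: (big_degree_false qX pX yq py nadj) low_all; move: d1 d2; card_lia.
Qed.

(** The cycle is cut at the run of [x], and [L] hosts [y]. Absorbing everything gives a Hamiltonian
    path, so no arc goes from its first to its last vertex; absorbing all but [x] gives a path that
    an arc back would close to a cycle missing only [x], against d(x) > n. So the ends of the run
    are non-adjacent. *)
Lemma hosted_false x0 x w g0 v1 M g1 L g :
  (forall x, x \in X -> x != x0 -> 2 * n <= deg x + deg y + 1) ->
  cyc (x :: w) -> x \in X -> n + 1 <= deg x -> w = g0 ++ (v1 :: M) ++ g1 -> 0 < size M ->
  nX v1 -> nX (last v1 M) ->
  (forall z, z \in g0 -> z \in X) -> (forall z, z \in g1 -> z \in X) ->
  walk arc L v1 (last v1 M) -> perm_eq (L ++ g ++ [:: x]) (y :: x :: w) ->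
  (forall z, z \in g -> z \in X) -> x0 \notin g -> False.
Proof.
move=> good cl xX dx Ew sM v1X vkX X0 X1' wl pe gX xg; set vk := last v1 M in vkX wl.
have nv : ~~ arc v1 vk.
  apply: (no_bypass_hp nb); apply: (absorb_V irr A0 nb n4 hC good cl wl (g := g ++ [:: x])) => //.
    by move=> z; rewrite mem_cat mem_seq1 => /orP[/gX|/eqP ->].
  by rewrite mem_cat (negbTE xg) inE => /eqP ->.
have nv' : ~~ arc vk v1.
  apply/negP => a; have h := absorb_skip irr A0 nb n4 hC good cl wl pe gX xX xg.
  have hcx : hcyc [set~ x] by exists v1, vk.
  by have := missed_deg irr nb hcx; move: dx; card_lia.
have [M' EM'] : exists M', v1 :: M = rcons (v1 :: M') vk.
  by rewrite /vk; case/lastP: (M) sM => // M' v _; exists M'; rewrite last_rcons.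
have clr : cyc (vk :: (g1 ++ x :: g0) ++ v1 :: M').
  have := @cyc_rot _ arc y (x :: g0 ++ v1 :: M') (vk :: g1); rewrite /= -!catA /=; apply.
  by move: cl; rewrite Ew EM' /= cat_rcons.
have := run_ends_adjacent clr; rewrite /adjacent (negbTE nv) (negbTE nv') => H.
suff: false by []; apply: H => // z; by rewrite mem_cat inE => /or3P[/X1'|/eqP ->|/X0].
Qed.

End Structure.

Definition alternating (f : seq V) := sorted (fun u w => arc y u != arc y w) f.

Lemma alternating_filter w : (forall l1 u g v l2, w = l1 ++ u :: g ++ v :: l2 ->
    (forall z, z \in g -> ~~ nX z) -> nX u -> nX v -> arc y u != arc y v) ->
  alternating (filter nX w).
Proof.
move=> H; rewrite /alternating; case Ef : (filter nX w) => [|v f] //=.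
apply/negPn/negP => /not_path_split[s1 [u [s2 [Es nu]]]].
have E2 : filter nX w = belast v s1 ++ last v s1 :: u :: s2.
  by rewrite Ef Es -[RHS]cat_rcons -lastI.
have [l1 [g [l2 [Ew _ _ gn]]]] := filter_split2 E2.
have inf z : z \in belast v s1 ++ last v s1 :: u :: s2 -> nX z.
  by rewrite -E2 mem_filter => /andP[].
case/negP: nu; apply: H Ew gn _ _; apply: inf; by rewrite mem_cat !inE eqxx !orbT.
Qed.

Lemma cyc_parts x w l1 u g v l2 : cyc (x :: w) -> w = l1 ++ u :: g ++ v :: l2 ->
  cyc (u :: g ++ v :: l2 ++ x :: l1).
Proof.
move=> cl E; have := @cyc_rot _ arc y (x :: l1) (u :: g ++ v :: l2).
by rewrite /= -!catA /= -?catA; apply; rewrite -E.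
Qed.

Section Good.
Variable x0 : V.
Hypothesis good : forall x, x \in X -> x != x0 -> 2 * n <= deg x + deg y + 1.

Hypothesis alt : forall p g q t, cyc (p :: g ++ q :: t) -> (forall z, z \in g -> z \in X) ->
  (x0 \in g -> n + 1 <= deg x0) -> nX p -> nX q -> arc y p != arc y q.

(** By alternation [v1] and [v2] have the same type, so the part of the cycle from [v2] round to
    [v1] is a host for [low_set]. *)
Lemma low_cyc v1 g1 v g2 v2 t : cyc (v1 :: g1 ++ v :: g2 ++ v2 :: t) ->
  (forall z, z \in g1 ++ g2 -> z \in X) -> (x0 \in g1 ++ g2 -> n + 1 <= deg x0) ->
  nX v1 -> nX v -> nX v2 -> deg v + 2 <= n + arc v v2 + arc v1 v.
Proof.
move=> cl gX g0 v1X vX v2X; have clr : cyc (v :: g2 ++ v2 :: t ++ v1 :: g1).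
  have := @cyc_rot _ arc y (v1 :: g1) (v :: g2 ++ v2 :: t); rewrite /= -!catA /=; apply.
  exact: cl.
have h1 : arc y v1 != arc y v.
  by apply: (alt cl) => // [z zg|zg]; [apply: gX | apply: g0]; rewrite mem_cat zg.
have h2 : arc y v != arc y v2.
  by apply: (alt clr) => // [z zg|zg]; [apply: gX | apply: g0]; rewrite mem_cat zg orbT.
have cl' : cyc ([::] ++ (v2 :: rcons t v1) ++ (g1 ++ v :: g2)).
  rewrite /= cat_rcons.
  have := @cyc_rot _ arc y (v1 :: g1 ++ v :: g2) (v2 :: t); rewrite /= -!catA /=; apply.
  exact: cl.
have w := cyc_walk cl'; rewrite last_rcons in w.
apply: (low_set irr A0 nb n4 hC good cl w (g := g1 ++ g2)) => //; first by perm_count.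
rewrite (same_type irr A0 nb n4 hC) //.
by move: h1 h2; case: (arc y v1); case: (arc y v); case: (arc y v2).
Qed.

End Good.

Lemma ordinary_false : (forall x, x \in X -> n + 1 <= deg x) -> False.
Proof.
move=> big; have [x0 good] := nonnbr_split A0 n4 y.
have AltAll p g q t : cyc (p :: g ++ q :: t) -> (forall z, z \in g -> z \in X) ->
    nX p -> nX q -> arc y p != arc y q.
  move=> cl gX pX qX; apply/negP => /eqP Epq.
  have s : same p q by rewrite (same_type irr A0 nb n4 hC) // Epq.
  have [x [xg dx _]] := run_bad irr nb A0 cl gX s.
  by have := big x (gX x xg); move: dx; card_lia.
have LowAll v1 g1 v g2 v2 t : cyc (v1 :: g1 ++ v :: g2 ++ v2 :: t) ->
    (forall z, z \in g1 ++ g2 -> z \in X) -> nX v1 -> nX v -> nX v2 ->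
    deg v + 2 <= n + arc v v2 + arc v1 v.
  move=> cl gX; apply: (low_cyc good _ cl gX) => [p g q s c gX' _|/gX/big //].
  exact: AltAll c gX'.
(* If the exceptional vertex is a non-neighbour, the cycle is cut exactly there, so that it never
   has to be absorbed when the cut vertex is left out. *)
have [xs [xsX x0s]] : exists xs, xs \in X /\ (x0 \in X -> xs = x0).
  case: (boolP (x0 \in X)) => x0X; first by exists x0.
  by have [x xX] := card_gt0P X1; exists x.
have xsy : xs != y by have := X_C xsX; rewrite !inE.
have [w cl] := hcyc_cyc hC xsy; have [ul _ _] := cl.
have sf := count_nX cl xsX; have ty := type_count irr A0 nb n4 str hC X1.
case Ef : (filter nX w) sf => [|v1 [|v2 [|v3 f]]] sf; try by move: sf ty => /= <-.
have alt : alternating (filter nX w).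
  apply: alternating_filter => l1 u g v l2 Ew gn uX vX.
  apply: (AltAll u g v (l2 ++ xs :: l1)) => //; first exact: cyc_parts Ew.
  apply: (cyc_X cl) gn; move=> z zg; by rewrite Ew !(inE, mem_cat) zg !orbT.
have inf z : z \in filter nX w -> nX z by rewrite mem_filter => /andP[].
have [g0 [M [g1 [Ew EM lM n0 n1]]]] := filter_trim Ef.
(* Among three neighbours of alternating type some in-neighbour is followed by an out-neighbour;
   this is where [y] goes. *)
have [s1 [j [o [s2 [Es jy yo]]]]] : exists s1 j o s2,
    [/\ [:: v1, v2, v3 & f] = s1 ++ j :: o :: s2, arc j y & arc y o].
  move: alt; rewrite Ef /alternating /= => /and3P[a12 a23 _].
  have t1 : arc v1 y = ~~ arc y v1 by apply/(nX_type irr A0 nb n4 hC)/inf; rewrite Ef inE eqxx.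
  have t2 : arc v2 y = ~~ arc y v2 by apply/(nX_type irr A0 nb n4 hC)/inf; rewrite Ef !inE eqxx orbT.
  case: (boolP (arc y v1)) => y1.
    exists [:: v1], v2, v3, f; split=> //; move: t2 a12 a23; rewrite y1.
      by case: (arc y v2).
    by case: (arc y v2); case: (arc y v3).
  exists [::], v1, v2, (v3 :: f); split=> //; first by rewrite t1.
  by move: a12; rewrite (negbTE y1); case: (arc y v2).
have EM2 : filter nX (v1 :: M) = s1 ++ j :: o :: s2 by rewrite EM Es.
have [l1 [g3 [l2 [EMl _ _ g3n]]]] := filter_split2 EM2.
have wM : walk arc (v1 :: M) v1 (last v1 M).
  by apply: (@cyc_walk _ arc y (xs :: g0) v1 M g1); rewrite /= -Ew.
have X0 : forall z, z \in g0 -> z \in X.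
  by apply: (cyc_X cl) n0 => z zg; rewrite Ew !(inE, mem_cat) zg !orbT.
have X1' : forall z, z \in g1 -> z \in X.
  by apply: (cyc_X cl) n1 => z zg; rewrite Ew !(inE, mem_cat) zg !orbT.
have X3 : forall z, z \in g3 -> z \in X.
  by apply: (cyc_X cl) g3n => z zg; rewrite Ew EMl !(inE, mem_cat) zg !orbT.
have sM : 0 < size M.
  have := size_filter nX (v1 :: M); have := count_size nX (v1 :: M).
  by rewrite EM /=; card_lia.
apply: (hosted_false AltAll LowAll (g := g3 ++ g1 ++ g0) good cl xsX (big xs xsX) Ew sM
  _ _ X0 X1' (walk_host wM EMl jy yo)).
- by apply: inf; rewrite Ef inE eqxx.
- by apply: inf; rewrite Ef lM; exact: mem_last.
- by rewrite Ew EMl; perm_count.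
- by move=> z; rewrite !mem_cat => /or3P[/X3|/X1'|/X0].
apply/negP => x0g; have x0X : x0 \in X by move: x0g; rewrite !mem_cat => /or3P[/X3|/X1'|/X0].
move: ul; rewrite (x0s x0X) /= Ew EMl => /andP[].
by move: x0g; rewrite !(mem_cat, inE) => /or3P[->|->|->]; rewrite ?orbT.
Qed.

End Alternation.

(** * A non-neighbour of degree at most n *)

Lemma alternating_count (T : eqType) (t : pred T) v s :
  path (fun u w => t u != t w) v s ->
  count t (v :: s) + ~~ t (last v s) = count (predC t) (v :: s) + t v.
Proof.
elim: s v => [|z s IH] v /=; first by case: (t v).
by move=> /andP[tv /IH /=]; case: (t v) (t z) tv => [] [] //= _; lia.
Qed.

Section Special.
Variables (V : finType) (arc : rel V).
Hypothesis irr : irreflexive arc.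
Hypothesis A0 : condA0 arc.
Hypothesis nb : ~ has_ham_bypass arc.
Hypothesis n4 : 4 <= #|V|.
Hypothesis str : strongly_connected arc.
Local Notation n := #|V|.
Local Notation dd := (dd arc).
Local Notation outs := (outs arc).
Local Notation ins := (ins arc).
Local Notation deg := (deg arc).
Local Notation hp := (hp arc).
Local Notation hcyc := (hcyc arc).
Variable y : V.
Local Notation C := [set~ y].
Local Notation X := (X arc y).
Local Notation nX := (nX arc y).
Local Notation same := (same arc y).
Local Notation cyc := (cyc arc y).
Hypothesis hC : hcyc C.
Variable x0 : V.
Hypothesis x0X : x0 \in X.
Hypothesis x0n : deg x0 <= n.

Let type := nX_type irr A0 nb n4 hC.

Lemma X_gt0 : 0 < #|X|. Proof. by apply/card_gt0P; exists x0. Qed.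

Lemma deg_y : deg y + #|X| + 1 = n.
Proof. by have := X_count irr A0 nb n4 hC; rewrite degD; card_lia. Qed.

Lemma x0_y : x0 != y. Proof. by have := X_C x0X; rewrite !inE. Qed.

Lemma x0_nX : nX x0 = false.
Proof. by apply/negbTE; rewrite -X_nX ?x0_y. Qed.

Lemma x0_bad : bad arc x0 y.
Proof.
by rewrite /bad x0_y X_nadj //=; move: deg_y X_gt0 x0n; card_lia.
Qed.

Lemma x0_good x : x \in X -> x != x0 -> 2 * n <= deg x + deg y + 1.
Proof.
move=> xX xx; rewrite leqNgt; apply/negP => lt; case/eqP: xx.
apply: (bad_uniq A0 (x := y)); last by rewrite badC x0_bad.
have := X_C xX; rewrite badC /bad X_nadj // !inE => -> /=; move: lt; card_lia.
Qed.

Lemma star_out v : v != x0 -> v != y -> ~~ arc x0 v -> ~~ arc v y ->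
  6 * n <= deg v + 2 * (deg x0 + deg y) + #|outs x0| + #|ins y| + 4.
Proof.
move=> vx vy xv vy'; have yx : y != x0 by rewrite eq_sym x0_y.
have [xv' yv] : x0 != v /\ y != v by rewrite ![_ == v]eq_sym.
have nadj := X_nadj x0X.
have := A0_out A0 x0_y yv xv' nadj xv; rewrite adjacentC in nadj.
by have := A0_in A0 yx xv' yv nadj vy'; rewrite [deg v]degD; card_lia.
Qed.

Lemma star_in v : v != x0 -> v != y -> ~~ arc v x0 -> ~~ arc y v ->
  6 * n <= deg v + 2 * (deg x0 + deg y) + #|ins x0| + #|outs y| + 4.
Proof.
move=> vx vy xv vy'; have yx : y != x0 by rewrite eq_sym x0_y.
have [xv' yv] : x0 != v /\ y != v by rewrite ![_ == v]eq_sym.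
have nadj := X_nadj x0X.
have := A0_in A0 x0_y yv xv' nadj xv; rewrite adjacentC in nadj.
by have := A0_out A0 yx xv' yv nadj vy'; rewrite [deg v]degD; card_lia.
Qed.

(** In the sum of both inequalities the half-degrees recombine, so that d(x0) + d(y), which is at
    most 2n - 2, occurs five times. *)
Lemma star2 u v : u != x0 -> u != y -> v != x0 -> v != y -> ~~ arc x0 u -> ~~ arc u y ->
  ~~ arc v x0 -> ~~ arc y v -> 2 * n + 2 <= deg u + deg v.
Proof.
move=> ux uy vx vy a1 a2 a3 a4.
have := star_out ux uy a1 a2; have := star_in vx vy a3 a4.
by move: deg_y X_gt0 x0n; rewrite [deg x0]degD [deg y]degD; card_lia.
Qed.

Lemma out_facts v : arc y v -> [/\ v != x0, v != y & ~~ arc v y].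
Proof.
move=> yv; split.
- by apply: contraTneq yv => ->; have := x0_nX; rewrite nXE; case: arc.
- by apply: contraTneq yv => ->; rewrite irr.
- by rewrite (one_way irr A0 nb n4 hC yv).
Qed.

Lemma in_facts v : arc v y -> [/\ v != x0, v != y & ~~ arc y v].
Proof.
move=> vy; split.
- by apply: contraTneq vy => ->; have := x0_nX; rewrite nXE; case: (arc x0 y); rewrite ?orbT.
- by apply: contraTneq vy => ->; rewrite irr.
- by apply/negP => /(one_way irr A0 nb n4 hC); rewrite vy.
Qed.

(** By [star2], [O] and [J] cannot both contain a vertex not joined to [x0] as claimed, so one
    inclusion holds. It gives [x0] many arcs on one side, hence few on the other, and [star_out] or
    [star_in] yields the second inclusion. *)
Lemma hits (O J : {set V}) : O \subset outs y -> J \subset ins y ->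
  (forall v, v \in O :|: J -> deg v <= n) -> deg x0 + deg y + 3 <= 2 * n ->
  deg x0 + #|outs y| <= n + 1 + #|O| -> deg x0 + #|ins y| <= n + 1 + #|J| ->
  O \subset outs x0 /\ J \subset ins x0.
Proof.
move=> Oy Jy low D3 cO cJ.
have lO v : v \in O -> deg v <= n by move=> vO; apply: low; rewrite inE vO.
have lJ v : v \in J -> deg v <= n by move=> vJ; apply: low; rewrite inE vJ orbT.
have fO v : v \in O -> [/\ v != x0, v != y & ~~ arc v y].
  by move=> /(subsetP Oy); rewrite inE => /out_facts.
have fJ v : v \in J -> [/\ v != x0, v != y & ~~ arc y v].
  by move=> /(subsetP Jy); rewrite inE => /in_facts.
have h1 : O \subset outs x0 \/ J \subset ins x0.
  case: (boolP (O \subset outs x0)) => [|/subsetPn[u uO nu]]; first by left.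
  right; apply/subsetP => v vJ; apply/negPn/negP => nv.
  have [u1 u2 u3] := fO u uO; have [v1 v2 v3] := fJ v vJ.
  rewrite inE in nu; rewrite inE in nv.
  by have := star2 u1 u2 v1 v2 nu u3 nv v3; have := lO u uO; have := lJ v vJ; card_lia.
have h2 : J \subset ins x0 -> O \subset outs x0.
  move=> Js; apply/subsetP => u uO; rewrite inE; apply/negPn/negP => nu.
  have [u1 u2 u3] := fO u uO; have := star_out u1 u2 nu u3.
  by have := lO u uO; have := subset_leq_card Js; move: D3 cJ; rewrite [deg x0]degD; card_lia.
have h3 : O \subset outs x0 -> J \subset ins x0.
  move=> Os; apply/subsetP => u uJ; rewrite inE; apply/negPn/negP => nu.
  have [u1 u2 u3] := fJ u uJ; have := star_in u1 u2 nu u3.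
  by have := lJ u uJ; have := subset_leq_card Os; move: D3 cO; rewrite [deg x0]degD; card_lia.
by case: h1 => h; split=> //; [exact: h3|exact: h2].
Qed.

(** A_0 for [y], [x0] with an in-neighbour of [y], whose in-degree is at most n - 2, and dually with
    an out-neighbour. *)
Lemma big_sides : 2 * n <= deg x0 + deg y + #|outs y| /\ 2 * n <= deg x0 + deg y + #|ins y|.
Proof.
have yx : y != x0 by rewrite eq_sym x0_y.
have nadj : ~~ adjacent arc y x0 by rewrite adjacentC X_nadj.
have card2 (A : {set V}) u v : u != v -> u \notin A -> v \notin A -> #|A| + 2 <= n.
  move=> uv uA vA; have : A \subset ~: [set u; v].
    by apply/subsetP => z zA; rewrite !inE negb_or; apply/andP; split; apply: contraTneq zA => ->.
  by move/subset_leq_card; have := cardsC [set u; v]; rewrite cards2 uv; card_lia.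
have [j jy] := ins_ex n4 str y; have [o yo] := outs_ex n4 str y.
have [j1 j2 j3] := in_facts jy; have [o1 o2 o3] := out_facts yo.
have [xj yj] : x0 != j /\ y != j by rewrite ![_ == j]eq_sym.
have [xo yo'] : x0 != o /\ y != o by rewrite ![_ == o]eq_sym.
have := A0_out A0 yx xj yj nadj j3; have := A0_in A0 yx xo yo' nadj o3.
have := card2 (ins j) y j; rewrite yj !inE irr j3 => /(_ isT isT isT).
have := card2 (outs o) y o; rewrite yo' !inE irr o3 => /(_ isT isT isT).
by split; card_lia.
Qed.

Lemma alt_run p g q t : cyc (p :: g ++ q :: t) -> (forall z, z \in g -> z \in X) -> x0 \notin g ->
  nX p -> nX q -> arc y p != arc y q.
Proof.
move=> cl gX x0g pX qX; apply/negP => /eqP Epq.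
have s : same p q by rewrite (same_type irr A0 nb n4 hC) // Epq.
have [x [xg dx bx]] := run_bad irr nb A0 cl gX s.
case/negP: x0g; have -> // : x0 = x.
by apply: (bad_uniq A0 (x := y)); rewrite badC ?x0_bad.
Qed.

Lemma low_run v1 g1 v g2 v2 t : cyc (v1 :: g1 ++ v :: g2 ++ v2 :: t) ->
  (forall z, z \in g1 ++ g2 -> z \in X) -> x0 \notin g1 ++ g2 -> nX v1 -> nX v -> nX v2 ->
  deg v + 2 <= n + arc v v2 + arc v1 v.
Proof.
move=> cl gX xg; apply: (low_cyc irr A0 nb n4 hC x0_good _ cl gX) => [p g q s c gX' xg'|xg'].
  by apply: alt_run c gX' _; apply/negP => /xg'; move: x0n; card_lia.
by rewrite xg' in xg.
Qed.

(** * The run through the exceptional vertex *)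

Section Config.
Variables (g0 T g1 : seq V) (v1 vk : V).
Hypothesis cl : cyc (x0 :: g0 ++ v1 :: T ++ vk :: g1).
Hypothesis g0X : forall z, z \in g0 -> z \in X.
Hypothesis g1X : forall z, z \in g1 -> z \in X.
Hypothesis v1X : nX v1.
Hypothesis vkX : nX vk.

Local Notation mid := (filter nX T).

Lemma filter_X g : (forall z, z \in g -> z \in X) -> filter nX g = [::].
Proof.
move=> gX; apply/eqP; rewrite -size_eq0 size_filter -leqn0 leqNgt -has_count; apply/hasPn => z /gX.
by rewrite X_def nXE negb_or => /and3P[_ -> ->].
Qed.

Lemma mid_size : size mid + 2 = #|outs y| + #|ins y|.
Proof.
rewrite -(count_nX irr A0 nb n4 hC X_gt0 cl x0X) filter_cat (filter_X g0X) /=.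
by rewrite v1X filter_cat /= vkX (filter_X g1X) /= size_cat /=; lia.
Qed.

Lemma cfg_filter : filter nX (v1 :: T ++ [:: vk]) = v1 :: mid ++ [:: vk].
Proof. by rewrite /= v1X filter_cat /= vkX. Qed.

Lemma cfg_rot l1 u l2 : v1 :: T ++ [:: vk] = l1 ++ u :: l2 ->
  cyc (u :: l2 ++ (g1 ++ x0 :: g0) ++ l1).
Proof.
move=> E; have := @cyc_rot _ arc y (x0 :: g0 ++ l1) (u :: l2 ++ g1); rewrite /= -!catA /=; apply.
have E' : (v1 :: T) ++ vk :: g1 = l1 ++ u :: l2 ++ g1.
  by rewrite -cat_rcons -cats1 /= -[u :: _ ++ _]/((u :: l2) ++ g1) catA -E /= -catA.
by rewrite -E'.
Qed.

Lemma cfg_run l1 g l2 : v1 :: T ++ [:: vk] = l1 ++ g ++ l2 -> (forall z, z \in g -> ~~ nX z) ->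
  (forall z, z \in g -> z \in X) /\ x0 \notin g.
Proof.
move=> E gn; have sub z : z \in g -> z \in v1 :: T ++ [:: vk] by rewrite E !mem_cat => ->; rewrite orbT.
have [ul _ _] := cl.
have sub2 z : z \in g -> z \in g0 ++ v1 :: T ++ vk :: g1.
  move=> /sub; rewrite !(inE, mem_cat) => /or3P[->|->|->]; by rewrite ?orbT.
split; last first.
  by apply/negP => /sub2 h; move: ul => /andP[]; rewrite h.
by apply: (cyc_X cl) gn => z /sub2; rewrite inE => ->; rewrite orbT.
Qed.

Lemma cfg_alt : alternating arc y (v1 :: mid ++ [:: vk]).
Proof.
rewrite -cfg_filter; apply: alternating_filter => l1 u g v l2 E gn uX vX.
have [gX xg] := cfg_run (etrans E (esym (cat_rcons _ _ _))) gn.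
have := cfg_rot E; rewrite -!catA /= => c; exact: (alt_run c gX xg uX vX).
Qed.

(** Both runs next to such a neighbour avoid [x0], so [low_run] applies. *)
Lemma inner_low z : z \in mid -> deg z <= n.
Proof.
move=> zm; have [s1 [s2 Es]] : exists s1 s2, mid = s1 ++ z :: s2.
  by case/splitPr: zm => s1 s2; exists s1, s2.
have E1 : filter nX (v1 :: T ++ [:: vk]) = belast v1 s1 ++ last v1 s1 :: z :: s2 ++ [:: vk].
  by rewrite cfg_filter Es -[RHS]cat_rcons -lastI /= -catA.
have [l1 [h1 [l2 [E _ E2 h1n]]]] := filter_split2 E1.
have [u [s3 Eu]] : exists u s3, s2 ++ [:: vk] = u :: s3 by case: (s2) => [|u s3]; [exists vk, [::]|exists u, (s3 ++ [:: vk])].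
rewrite Eu in E2; have [h2 [l3 [El2 h2n _ uX]]] := filter_split (s1 := [::]) E2.
have /filter_nil h2n' := h2n; subst l2.
have inf v : v \in filter nX (v1 :: T ++ [:: vk]) -> nX v by rewrite mem_filter => /andP[].
have [h1X xh1] := cfg_run (l1 := rcons l1 (last v1 s1)) (g := h1) (l2 := z :: h2 ++ u :: l3) (etrans E (esym (cat_rcons _ _ _))) h1n.
have E3 : v1 :: T ++ [:: vk] = (l1 ++ last v1 s1 :: h1 ++ [:: z]) ++ h2 ++ u :: l3.
  by rewrite E -!catA /= -!catA.
have [h2X xh2] := cfg_run E3 h2n'.
have c := cfg_rot E; rewrite -!catA /= -!catA in c.
have := low_run c; rewrite !mem_cat negb_or xh1 xh2.
have -> // : nX (last v1 s1) by apply: inf; rewrite E1 mem_cat inE eqxx orbT.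
have -> // : nX z by apply: inf; rewrite E1 mem_cat !inE eqxx !orbT.
rewrite uX => H; have : deg z + 2 <= n + arc z u + arc (last v1 s1) z.
  by apply: H => // v; rewrite mem_cat => /orP[/h1X|/h2X].
by case: (arc z u); case: (arc _ z) => /=; card_lia.
Qed.

Lemma cfg_memT v : nX v -> v != v1 -> v != vk -> v \in mid.
Proof.
move=> vX n1 nk; have vy := nX_C irr vX; rewrite mem_filter vX /=.
have := cyc_mem v cl; rewrite vy !(inE, mem_cat) (negbTE n1) (negbTE nk) /=.
case: (eqVneq v x0) => [E|_]; first by rewrite E x0_nX in vX.
have -> : v \in g0 = false by apply/negP => /g0X; rewrite X_nX ?vX.
have -> : v \in g1 = false by apply/negP => /g1X; rewrite X_nX ?vX.
by rewrite /= orbF.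
Qed.

Lemma ends_same_deg : arc y v1 = arc y vk -> deg x0 + 1 <= n.
Proof.
move=> E; have s : same vk v1 by rewrite (same_type irr A0 nb n4 hC) // E.
have c : cyc (vk :: (g1 ++ x0 :: g0) ++ v1 :: T).
  have := @cyc_rot _ arc y (x0 :: g0 ++ v1 :: T) (vk :: g1); rewrite /= -!catA /=; apply.
  exact: cl.
have gX z : z \in g1 ++ x0 :: g0 -> z \in X.
  by rewrite mem_cat inE => /or3P[/g1X|/eqP ->|/g0X].
have [x [_ dx bx]] := run_bad irr nb A0 c gX s.
have -> // : x0 = x by apply: (bad_uniq A0 (x := y)); rewrite badC ?x0_bad.
Qed.

(** The ends [v1], [vk] may have large degree, so [hits] is applied without them; [ends_same_deg]
    makes up for the loss when both ends are of the same type. *)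
Lemma inner_hits : deg x0 + deg y + 3 <= 2 * n ->
  forall z, z \in mid -> (arc y z -> arc x0 z) /\ (arc z y -> arc z x0).
Proof.
move=> D3; set O := outs y :&: [set z in mid]; set J := ins y :&: [set z in mid].
have count (A : {set V}) : (forall v, v \in A -> nX v) ->
    #|A| <= #|A :&: [set z in mid]| + (v1 \in A) + (vk \in A).
  move=> AX; rewrite (cardsD1 v1) (cardsD1 vk (A :\ v1)).
  have : A :\ v1 :\ vk \subset A :&: [set z in mid].
    apply/subsetP => v; rewrite !in_setD1 in_setI in_set => /and3P[nk n1 vA].
    by rewrite vA cfg_memT // AX.
  move/subset_leq_card; rewrite [vk \in A :\ v1]in_setD1.
  by case: (v1 \in A); case: (vk \in A); rewrite ?andbF; case: (vk != v1) => /=; card_lia.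
have cO : #|outs y| <= #|O| + arc y v1 + arc y vk.
  by have := count (outs y); rewrite !inE; apply=> v; rewrite inE nXE => ->.
have cJ : #|ins y| <= #|J| + arc v1 y + arc vk y.
  by have := count (ins y); rewrite !inE; apply=> v; rewrite inE nXE => ->; rewrite orbT.
have ends : deg x0 + (arc y v1 + arc y vk) <= n + 1 /\ deg x0 + (arc v1 y + arc vk y) <= n + 1.
  have := ends_same_deg; rewrite (type v1X) (type vkX).
  move: x0n; case: (arc y v1); case: (arc y vk) => /= ? H; split; try by card_lia.
    by have := H erefl; card_lia.
  by have := H erefl; card_lia.
have [] := @hits O J (subsetIl _ _) (subsetIl _ _) _ D3.
- by move=> v; rewrite !inE -andb_orl => /andP[_]; apply: inner_low.
- by move: ends cO => [+ _]; card_lia.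
- by move: ends cJ => [_ +]; card_lia.
move=> h1 h2 z zm; split=> a.
  by have := subsetP h1 z; rewrite !in_setI !in_set a zm => /(_ isT).
by have := subsetP h2 z; rewrite !in_setI !in_set a zm => /(_ isT).
Qed.

(** By [big_sides] at least four neighbours lie inside, so alternation yields an in-neighbour
    followed by an out-neighbour; by [inner_hits], [x0] fits between them. *)
Lemma mid_slot : deg x0 + deg y + 3 <= 2 * n ->
  exists s1 j o s2, [/\ mid = s1 ++ j :: o :: s2, arc j x0, arc x0 o, arc j y & arc y o].
Proof.
move=> D3; have H := inner_hits D3; have [b1 b2] := big_sides.
have ms := mid_size; have alt := cfg_alt.
have m4 : 4 <= size mid by move: ms b1 b2 D3; card_lia.
have mX z : z \in mid -> arc z y = ~~ arc y z.
  by rewrite mem_filter => /andP[/(type)].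
case Em : mid m4 alt mX => [|u1 [|u2 [|u3 [|u4 r]]]] //= _.
rewrite /alternating /= => /and4P[_ a12 a23 _] mX.
have inm z : z \in [:: u1, u2, u3, u4 & r] -> z \in mid by rewrite Em.
have t1 := mX u1; have t2 := mX u2; rewrite !inE !eqxx ?orbT /= in t1 t2.
have i1 := H u1 (inm u1 _); have i2 := H u2 (inm u2 _); have i3 := H u3 (inm u3 _).
rewrite !inE !eqxx ?orbT in i1 i2 i3.
have [_ h1] := i1 isT; have [h2 h2'] := i2 isT; have [h3 _] := i3 isT.
case: (boolP (arc y u1)) a12 a23 => y1.
  case: (boolP (arc y u2)) => y2 // _; case: (boolP (arc y u3)) => y3 // _.
  have u2y : arc u2 y by rewrite t2.
  by exists [:: u1], u2, u3, (u4 :: r); split=> //; [exact: h2'|exact: h3].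
case: (boolP (arc y u2)) => y2 // _ _.
have u1y : arc u1 y by rewrite t1.
by exists [::], u1, u2, (u3 :: u4 :: r); split=> //; [exact: h1|exact: h2].
Qed.

Lemma cfg_walk : walk arc (v1 :: T ++ [:: vk]) v1 vk.
Proof.
have := @cyc_walk _ arc y (x0 :: g0) v1 (T ++ [:: vk]) g1; rewrite last_cat /= -!catA /=; exact.
Qed.

Lemma cfg_perm : perm_eq (x0 :: g0 ++ v1 :: T ++ vk :: g1) (x0 :: (v1 :: T ++ [:: vk]) ++ g0 ++ g1).
Proof. by perm_count. Qed.

Hypothesis D3 : deg x0 + deg y + 3 <= 2 * n.

(** With [x0] hosted in a slot, only ordinary non-neighbours remain to be absorbed; ends of the same
    type would contradict [no_hp_same]. *)
Lemma ends_differ : arc y v1 != arc y vk.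
Proof.
have [s1 [j [o [s2 [Em jx xo _ _]]]]] := mid_slot D3.
have E1 : filter nX (v1 :: T ++ [:: vk]) = (v1 :: s1) ++ j :: o :: s2 ++ [:: vk].
  by rewrite cfg_filter Em /= -catA.
have [l1 [g3 [l2 [E _ _ g3n]]]] := filter_split2 E1.
have [g3X xg3] := cfg_run (etrans E (esym (cat_rcons _ _ _))) g3n.
have wL := walk_host cfg_walk E jx xo.
apply/negP => /eqP Et.
have h : hp C v1 vk.
  apply: (absorb_C irr A0 nb n4 hC x0_good cl wL (g := g3 ++ g0 ++ g1)).
  - by rewrite perm_sym; apply: (perm_trans cfg_perm); rewrite E; perm_count.
  - by move=> z; rewrite !mem_cat => /or3P[/g3X|/g0X|/g1X].
  have [ul _ _] := cl; move: ul => /= /andP[+ _]; rewrite !mem_cat (negbTE xg3) /=.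
  rewrite !(inE, mem_cat) => /negP H /orP[] h; case: H; by rewrite h ?orbT.
by have := no_hp_same nb h; rewrite (same_type irr A0 nb n4 hC v1X vkX) Et eqxx.
Qed.

Lemma cfg_x0 : x0 \notin g0 ++ g1.
Proof.
have [ul _ _] := cl; move: ul => /= /andP[+ _]; rewrite !(inE, mem_cat) !negb_or.
by case/and3P=> -> _ /and3P[_ _ ->].
Qed.

(** The run before [v1] contains [x0], so [x0] is hosted in the path from [v2] to [vk] and [v1] is
    left out. The ends [v2], [vk] have the same type by alternation and [ends_differ]. *)
Lemma low_first h v2 T' : T = h ++ v2 :: T' -> (forall z, z \in h -> z \in X) -> nX v2 ->
  deg v1 + 2 <= n + arc v1 v2 + arc vk v1.
Proof.
move=> ET hX v2X; have [s1 [j [o [s2 [Em jx xo _ _]]]]] := mid_slot D3.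
have Em' : mid = v2 :: filter nX T' by rewrite ET filter_cat (filter_X hX) /= v2X.
have E1 : filter nX (v2 :: T' ++ [:: vk]) = s1 ++ j :: o :: s2 ++ [:: vk].
  by rewrite /= v2X filter_cat /= vkX -cat_cons -Em' Em -catA.
have [l1 [g3 [l2 [E _ _ g3n]]]] := filter_split2 E1.
have E2 : v1 :: T ++ [:: vk] = (v1 :: h ++ rcons l1 j) ++ g3 ++ o :: l2.
  by rewrite ET -?catA /= -?catA cat_rcons E.
have [g3X xg3] := cfg_run E2 g3n.
have E3 : v1 :: T ++ [:: vk] = (v1 :: h) ++ v2 :: T' ++ [:: vk] by rewrite ET -catA.
have xh : x0 \notin h.
  have hn z : z \in h -> ~~ nX z by move=> /hX; rewrite X_def nXE negb_or => /and3P[_ -> ->].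
  have [] // := @cfg_run [:: v1] h (v2 :: T' ++ [:: vk]) _ hn.
have w2 : walk arc (v2 :: T' ++ [:: vk]) v2 vk.
  by have := cfg_walk; rewrite E3 => /walk_split[].
have wL := walk_host w2 E jx xo.
apply: (low_set irr A0 nb n4 hC x0_good cl wL (g := g3 ++ h ++ g0 ++ g1)) => //.
- rewrite perm_sym; apply: (perm_trans cfg_perm); rewrite ET -catA /= E; perm_count.
- by move=> z; rewrite !mem_cat => /or4P[/g3X|/hX|/g0X|/g1X].
- by rewrite mem_cat (negbTE xg3) mem_cat (negbTE xh) /= (negbTE cfg_x0).
have := cfg_alt; rewrite /alternating Em' /= => /andP[a _]; move: ends_differ a.
rewrite (same_type irr A0 nb n4 hC v2X vkX).
by case: (arc y v1); case: (arc y v2); case: (arc y vk).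
Qed.

Lemma low_last h vp T' : T = T' ++ vp :: h -> (forall z, z \in h -> z \in X) -> nX vp ->
  deg vk + 2 <= n + arc vk v1 + arc vp vk.
Proof.
move=> ET hX vpX; have [s1 [j [o [s2 [Em jx xo _ _]]]]] := mid_slot D3.
have Em' : mid = filter nX T' ++ [:: vp] by rewrite ET filter_cat /= vpX (filter_X hX).
have E1 : filter nX (v1 :: T' ++ [:: vp]) = (v1 :: s1) ++ j :: o :: s2.
  by rewrite /= v1X filter_cat /= vpX -Em' Em.
have [l1 [g3 [l2 [E _ _ g3n]]]] := filter_split2 E1.
have E3 : v1 :: T ++ [:: vk] = (v1 :: T') ++ vp :: h ++ [:: vk] by rewrite ET -!catA.
have E4 : v1 :: T ++ [:: vk] = (v1 :: T' ++ [:: vp]) ++ h ++ [:: vk] by rewrite ET -!catA /= -!catA.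
have E2 : v1 :: T ++ [:: vk] = rcons l1 j ++ g3 ++ o :: l2 ++ h ++ [:: vk].
  by rewrite E4 E cat_rcons -!catA /= -!catA.
have [g3X xg3] := cfg_run E2 g3n.
have xh : x0 \notin h.
  have hn z : z \in h -> ~~ nX z by move=> /hX; rewrite X_def nXE negb_or => /and3P[_ -> ->].
  by have [] := cfg_run E4 hn.
have w2 : walk arc (v1 :: T' ++ [:: vp]) v1 vp.
  by have := cfg_walk; rewrite E3 => /walk_split[]; rewrite -cats1.
have wL := walk_host w2 E jx xo.
apply: (low_set irr A0 nb n4 hC x0_good cl wL (g := g3 ++ h ++ g0 ++ g1)) => //.
- rewrite perm_sym; apply: (perm_trans cfg_perm); rewrite E4 E; perm_count.
- by move=> z; rewrite !mem_cat => /or4P[/g3X|/hX|/g0X|/g1X].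
- by rewrite mem_cat (negbTE xg3) mem_cat (negbTE xh) /= (negbTE cfg_x0).
have := cfg_alt; rewrite /alternating Em' /= cat_path last_cat /= andbT => /andP[_ a]; move: ends_differ a.
rewrite (same_type irr A0 nb n4 hC v1X vpX).
by case: (arc y v1); case: (arc y vp); case: (arc y vk).
Qed.

End Config.

Section Strict.
Hypothesis D3 : deg x0 + deg y + 3 <= 2 * n.

Lemma alt_all p g q t : cyc (p :: g ++ q :: t) -> (forall z, z \in g -> z \in X) ->
  nX p -> nX q -> arc y p != arc y q.
Proof.
move=> cl gX pX qX; case: (boolP (x0 \in g)) => xg; last exact: alt_run cl gX xg pX qX.
case/splitPr: xg cl gX => g1 g0 cl gX.
rewrite eq_sym; apply: (@ends_differ g0 t g1 q p) => //.
- have := @cyc_rot _ arc y (p :: g1) (x0 :: g0 ++ q :: t); rewrite /= -?catA /= -?catA /=; apply.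
  by move: cl; rewrite -catA.
- by move=> z zg; apply: gX; rewrite mem_cat inE zg !orbT.
- by move=> z zg; apply: gX; rewrite mem_cat zg.
Qed.

Lemma low_all_runs v1 g1 v g2 v2 t : cyc (v1 :: g1 ++ v :: g2 ++ v2 :: t) ->
  (forall z, z \in g1 ++ g2 -> z \in X) -> nX v1 -> nX v -> nX v2 ->
  deg v + 2 <= n + arc v v2 + arc v1 v.
Proof.
move=> cl gX v1X vX v2X; case: (boolP (x0 \in g1 ++ g2)) => xg; last exact: low_run cl gX xg v1X vX v2X.
have gX1 z : z \in g1 -> z \in X by move=> zg; apply: gX; rewrite mem_cat zg.
have gX2 z : z \in g2 -> z \in X by move=> zg; apply: gX; rewrite mem_cat zg orbT.
move: xg; rewrite mem_cat => /orP[] xg.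
  case/splitPr: xg cl {gX} gX1 => h1 h0 cl gX1.
  apply: (@low_first h0 (g2 ++ v2 :: t) h1 v v1) => //.
  - have := @cyc_rot _ arc y (v1 :: h1) (x0 :: h0 ++ v :: g2 ++ v2 :: t); rewrite /= -?catA /= -?catA /=; apply.
    by move: cl; rewrite -catA.
  - by move=> z zg; apply: gX1; rewrite mem_cat inE zg !orbT.
  - by move=> z zg; apply: gX1; rewrite mem_cat zg.
case/splitPr: xg cl {gX} gX2 => h1 h0 cl gX2.
apply: (@low_last h0 (t ++ v1 :: g1) h1 v2 v) => //.
- have := @cyc_rot _ arc y (v1 :: g1 ++ v :: h1) (x0 :: h0 ++ v2 :: t); rewrite /= -?catA /= -?catA /=; apply.
  by move: cl; rewrite -?catA /= -?catA.
- by move=> z zg; apply: gX2; rewrite mem_cat inE zg !orbT.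
- by move=> z zg; apply: gX2; rewrite mem_cat zg.
Qed.

Lemma all_hit : (forall o, arc y o -> arc x0 o) /\ (forall j, arc j y -> arc j x0).
Proof.
have low := low_all irr A0 nb n4 str hC X_gt0 low_all_runs.
have [] := @hits (outs y) (ins y) (subxx _) (subxx _) _ D3.
- by move=> v; rewrite !inE => h; apply: low; rewrite nXE.
- by move: x0n; card_lia.
- by move: x0n; card_lia.
move=> h1 h2; split=> z yz.
  by have := subsetP h1 z; rewrite !inE yz => /(_ isT).
by have := subsetP h2 z; rewrite !inE yz => /(_ isT).
Qed.

Lemma alt_nX x w : cyc (x :: w) -> alternating arc y (filter nX w).
Proof.
move=> cl; apply: alternating_filter => l1 u g v l2 Ew gn uX vX.
apply: (alt_all (cyc_parts cl Ew)) => //.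
by apply: (cyc_X cl) gn => z zg; rewrite Ew !(inE, mem_cat) zg !orbT.
Qed.

Lemma two_slots f : alternating arc y f -> (forall z, z \in f -> nX z) -> 6 <= size f ->
  exists s1 j o j' o' s3, [/\ f = s1 ++ [:: j, o, j', o' & s3], arc j y, arc y o, arc j' y & arc y o'].
Proof.
case: f => [|v1 [|v2 [|v3 [|v4 [|v5 [|v6 f]]]]]] //.
rewrite /alternating /= => /and5P[a12 a23 a34 a45 _] inf _.
have t v : v \in [:: v1, v2, v3, v4, v5, v6 & f] -> arc v y = ~~ arc y v by move=> /inf /type.
have := t v1; have := t v2; have := t v3; have := t v4; rewrite !inE !eqxx !orbT.
move=> /(_ isT) t4 /(_ isT) t3 /(_ isT) t2 /(_ isT) t1.
case y1 : (arc y v1) a12; case y2 : (arc y v2) a23; case y3 : (arc y v3) a34;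
  case y4 : (arc y v4) a45; case y5 : (arc y v5) => // _ _ _ _.
  by exists [:: v1], v2, v3, v4, v5, (v6 :: f); rewrite t2 t4 y2 y4.
by exists [::], v1, v2, v3, v4, (v5 :: v6 :: f); rewrite t1 t3 y1 y3.
Qed.

(** The cycle is cut at a non-neighbour other than [x0], and [y] takes the first slot. If [x0] lies
    in one of the discarded runs, it takes the second slot, where it fits by [all_hit]. *)
Lemma special_many : 2 <= #|X| -> False.
Proof.
move=> X2; have [x xX xx] := card_ex2 x0 X2.
have xy : x != y by have := X_C xX; rewrite !inE.
have [w cl] := hcyc_cyc hC xy; have [ul _ _] := cl.
have sf := count_nX irr A0 nb n4 hC X_gt0 cl xX; have alt := alt_nX cl.
have f6 : 6 <= size (filter nX w) by rewrite sf; move: big_sides D3 => [? ?]; card_lia.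
have inf z : z \in filter nX w -> nX z by rewrite mem_filter => /andP[].
have [s1 [j [o [j' [o' [s3 [Es jy yo j'y yo']]]]]]] := two_slots alt inf f6.
case Ef : (filter nX w) f6 => [|v1 f] // f6.
have [g0 [M [g1 [Ew EM lM n0 n1]]]] := filter_trim Ef.
rewrite Ef in Es; rewrite Es in EM.
have [l1 [g3 [l2 [EM1 _ El2 g3n]]]] := filter_split2 EM.
have [l3 [g4 [l4 [EM2 _ _ g4n]]]] := filter_split2 (s1 := [::]) El2.
set vk := last v1 M.
have wM : walk arc (v1 :: M) v1 vk by apply: (@cyc_walk _ arc y (x :: g0) v1 M g1); rewrite /= -Ew.
have wL := walk_host wM EM1 jy yo.
have inw (g : seq V) : (forall z, z \in g -> z \in w) -> (forall z, z \in g -> ~~ nX z) -> forall z, z \in g -> z \in X.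
  by move=> gw gn; apply: (cyc_X cl) gn => z /gw; rewrite inE => ->; rewrite orbT.
have X0 : forall z, z \in g0 -> z \in X.
  by apply: inw n0 => z zg; rewrite Ew !(inE, mem_cat) zg ?orbT.
have X1 : forall z, z \in g1 -> z \in X.
  by apply: inw n1 => z zg; rewrite Ew !(inE, mem_cat) zg ?orbT.
have X3 : forall z, z \in g3 -> z \in X.
  by apply: inw g3n => z zg; rewrite Ew EM1 !(inE, mem_cat) zg ?orbT.
have X4 : forall z, z \in g4 -> z \in X.
  by apply: inw g4n => z zg; rewrite Ew EM1 EM2 !(inE, mem_cat) zg ?orbT.
have [L [g [wl pe gX xg]]] : exists L g, [/\ walk arc L v1 vk, perm_eq (L ++ g ++ [:: x]) (y :: x :: w),
    forall z, z \in g -> z \in X & x0 \notin g].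
  case: (boolP (x0 \in g3 ++ g0 ++ g1)) => xG; last first.
    exists (rcons l1 j ++ [:: y] ++ o :: l2), (g3 ++ g0 ++ g1); split=> //.
      by rewrite Ew EM1; perm_count.
    by move=> z; rewrite !mem_cat => /or3P[/X3|/X0|/X1].
  have EL : rcons l1 j ++ [:: y] ++ o :: l2 = (rcons l1 j ++ [:: y, o & l3]) ++ j' :: g4 ++ o' :: l4.
    by rewrite EM2 -catA.
  have [_ hitJ] := all_hit; have [hitO _] := all_hit.
  have wL2 := walk_host wL EL (hitJ _ j'y) (hitO _ yo').
  have ug : uniq ((g3 ++ g0 ++ g1) ++ g4).
    have : uniq (((g3 ++ g0 ++ g1) ++ g4) ++ (l1 ++ [:: j, o & l3]) ++ j' :: o' :: l4).
      rewrite (perm_uniq (s2 := w)); first by case/andP: ul.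
      by rewrite Ew EM1 EM2; perm_count.
    by rewrite cat_uniq => /and3P[].
  have /and3P[uG /hasPn dis _] : [&& uniq (g3 ++ g0 ++ g1), ~~ has (mem (g3 ++ g0 ++ g1)) g4 & uniq g4].
    by rewrite -cat_uniq.
  exists (rcons (rcons l1 j ++ [:: y, o & l3]) j' ++ [:: x0] ++ o' :: l4), (rem x0 (g3 ++ g0 ++ g1) ++ g4).
  split=> //.
  - apply: (@perm_trans _ ((rcons (rcons l1 j ++ [:: y, o & l3]) j' ++ o' :: l4) ++
      (x0 :: rem x0 (g3 ++ g0 ++ g1)) ++ g4 ++ [:: x])).
      by move: (rem _ _) => r; perm_count.
    apply: (@perm_trans _ ((rcons (rcons l1 j ++ [:: y, o & l3]) j' ++ o' :: l4) ++
      (g3 ++ g0 ++ g1) ++ g4 ++ [:: x])).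
      by rewrite perm_cat2l perm_cat2r perm_sym perm_to_rem.
    by rewrite Ew EM1 EM2; perm_count.
  - by move=> z; rewrite mem_cat => /orP[/mem_rem|/X4 //]; rewrite !mem_cat => /or3P[/X3|/X0|/X1].
  - rewrite mem_cat negb_or mem_rem_uniq // inE eqxx /=.
    by apply/negP => /dis; rewrite /= xG.
have sM : 0 < size M.
  have := size_filter nX (v1 :: M); have := count_size nX (v1 :: M).
  by rewrite EM size_cat /=; card_lia.
have dx : n + 1 <= deg x by have := good_deg irr A0 nb n4 hC x0_good xX xx; move: X_gt0; card_lia.
apply: (hosted_false irr A0 nb n4 str hC X_gt0 alt_all low_all_runs x0_good cl xX dx Ew sM _ _ X0 X1 wl pe gX xg).
- by apply: inf; rewrite Ef inE eqxx.
- by apply: inf; rewrite Ef lM; exact: mem_last.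
Qed.

End Strict.

(** * A single non-neighbour *)

Section Single.
Hypothesis X1 : #|X| = 1.

Let deg_y' : deg y + 2 = n.
Proof. by have := deg_y; rewrite X1; card_lia. Qed.
Let n5 : 5 <= n.
Proof.
have := type_count irr A0 nb n4 str hC; rewrite X1 => /(_ isT).
by have := deg_y'; rewrite degD; card_lia.
Qed.

Lemma single_nX v : v != y -> v != x0 -> nX v.
Proof.
move=> vy vx; apply/negPn; rewrite -X_nX //; apply/negP => vX.
by have := cards1P (introT eqP X1); case=> z EX; move: x0X vX vx; rewrite EX !inE => /eqP -> ->.
Qed.

Lemma walk_setT l L p q : cyc l -> walk arc L p q -> perm_eq L (y :: l) -> hp setT p q.
Proof. by move=> cl w pe; have [u <-] := cyc_perm_setT cl pe; exact: walk_hp. Qed.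

Lemma walk_missing l L p q v : cyc l -> walk arc L p q -> perm_eq (v :: L) (y :: l) -> hp [set~ v] p q.
Proof.
move=> cl w pe; have [/= /andP[vL uL] E] := cyc_perm_setT cl pe.
have <- : [set z in L] = [set~ v]; last exact: walk_hp.
apply/setP => z; move/setP/(_ z): E; rewrite !inE.
by case: (eqVneq z v) => [->|_] /=; rewrite ?(negbTE vL).
Qed.

Section Ends.
Variables (T : seq V) (v1 vk : V).
Hypothesis cl : cyc (x0 :: v1 :: T ++ [:: vk]).

Lemma w_nX z : z \in v1 :: T ++ [:: vk] -> nX z.
Proof.
move=> zw; have [ul _ _] := cl; apply: single_nX.
  by rewrite -(cyc_mem z cl) inE zw orbT.
by apply: contraTneq zw => ->; move: ul => /= /andP[].
Qed.

Let v1X : nX v1. Proof. by apply: w_nX; rewrite inE eqxx. Qed.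
Let vkX : nX vk. Proof. by apply: w_nX; rewrite !(inE, mem_cat) eqxx !orbT. Qed.

Lemma w_alt : path (fun u w => arc y u != arc y w) v1 (T ++ [:: vk]).
Proof.
have := cfg_alt (g0 := [::]) (g1 := [::]) cl v1X vkX.
rewrite /alternating /=; have -> // : filter nX T = T.
by apply/all_filterP/allP => z zT; apply: w_nX; rewrite !(inE, mem_cat) zT orbT.
Qed.

Lemma w_walk : walk arc (v1 :: T ++ [:: vk]) v1 vk.
Proof. exact: (@cfg_walk [::] T [::]). Qed.

Lemma w_arcs : arc x0 v1 /\ arc vk x0.
Proof. by have [_ + _] := cl; rewrite /= rcons_path last_cat /= => /and3P[-> _ ->]. Qed.

Lemma w_size : size T + 4 = n.
Proof. by have := cyc_size cl; rewrite /= size_cat /=; card_lia. Qed.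

Lemma twin_cycle : arc y v1 -> arc vk y -> hcyc [set~ x0].
Proof.
move=> yv1 vky; exists v1, y; split=> //.
apply: (walk_missing (L := (v1 :: T ++ [:: vk]) ++ [:: y]) cl); last by perm_count.
exact: walk_cat w_walk (walk1 arc y) vky.
Qed.

(** The successor v2 of [v1] is an out-neighbour of [y], so [y] fits between [v1] and v2; with [x0]
    in front or behind this gives two Hamiltonian paths. *)
Lemma crossed_ends : arc v1 y -> arc y vk -> ~~ arc x0 vk /\ ~~ arc v1 x0.
Proof.
move=> v1y yvk; have [a1 a2] := w_arcs; have alt := w_alt.
have y1 : arc y v1 = false by apply/negbTE/negP => /(one_way irr A0 nb n4 hC); rewrite v1y.
have := w_size; have := w_walk; case: (T) alt cl => [|v2 T'] alt cl' w sz; first by move: sz n5 => /= <-.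
have yv2 : arc y v2 by move: alt => /= /andP[+ _]; rewrite y1; case: (arc y v2).
have w1 : walk arc [:: v1] v1 v1 by exact: walk1.
have w2 : walk arc (v2 :: T' ++ [:: vk]) v2 vk.
  by have := @walk_split _ arc [:: v1] v2 (T' ++ [:: vk]) v1 vk w => -[].
have wy := walk_cat w1 (walk_cat (walk1 arc y) w2 yv2) v1y.
split; apply: (no_bypass_hp nb).
  apply: (walk_setT cl' (walk_cat (walk1 arc x0) wy a1)); perm_count.
apply: (walk_setT cl' (walk_cat wy (walk1 arc x0) a2)); perm_count.
Qed.

(** The path cannot take both [x0] and [v]. If [v] fits first, [x0] does not fit afterwards, against
    d(x0) = n; otherwise [v] fails, at once or after [x0]. *)
Lemma end_low L p q v : deg x0 = n -> walk arc L p q -> perm_eq (L ++ [:: v; x0]) (x0 :: v1 :: T ++ [:: vk]) ->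
  same p q -> nX v -> ~~ (arc v x0 && arc x0 v) -> deg v <= n.
Proof.
move=> dx0 w pe pq vX nvx; have [u E] := cyc_perm_set cl pe.
have hS : hp [set z in L] p q by apply: walk_hp w _; move: u; rewrite cat_uniq => /and3P[].
have sz : size L + 3 = n by have := cyc_size cl; rewrite -(perm_size pe) size_cat /=; card_lia.
have cS : #|[set z in L]| = size L by rewrite card_set_seq //; move: u; rewrite cat_uniq => /and3P[].
have [vL xL vx] : [/\ v \notin [set z in L], x0 \notin [set z in L] & v != x0].
  move: u; rewrite (perm_uniq (s2 := v :: x0 :: L)); last by perm_count.
  by rewrite /= !in_set inE negb_or => /and3P[/andP[-> ->] -> _].
have vxL : v \notin x0 |: [set z in L] by rewrite in_setU1 negb_or vx.
have xvL : x0 \notin v |: [set z in L] by rewrite in_setU1 negb_or eq_sym vx.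
have EC : v |: (x0 |: [set z in L]) = C.
  by rewrite -E; apply/setP => z; rewrite !(inE, mem_cat); do !case: (_ == _); rewrite ?orbT ?orbF.
have EC' : x0 |: (v |: [set z in L]) = C by rewrite -EC setUCA.
have no : ~ hp C p q by move=> /(no_hp_same nb); rewrite pq.
have dv : deg v = dd v [set z in L] + (arc v x0 + arc x0 v) + 1.
  rewrite (deg_split arc v [set y]) dd1 -EC setUC ddU ?disjoints1; last first.
    by rewrite disjoint_sym disjoints1.
  rewrite dd1 irr addn0 setUC ddU; last by rewrite disjoint_sym disjoints1.
  by rewrite dd1 (type vX); case: (arc y v) => /=; card_lia.
have dx : deg x0 = dd x0 (v |: [set z in L]).
  rewrite (X_deg x0X) -EC' setUC ddU; last by rewrite disjoint_sym disjoints1.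
  by rewrite dd1 irr !addn0.
have c1 : #|x0 |: [set z in L]| = size L + 1 by rewrite cardsU1 xL cS addnC.
have c2 : #|v |: [set z in L]| = size L + 1 by rewrite cardsU1 vL cS addnC.
have dxv : dd v (x0 |: [set z in L]) = dd v [set z in L] + (arc v x0 + arc x0 v).
  by rewrite setUC ddU ?dd1 // disjoint_sym disjoints1.
case: (hp_insert hS xL) => [h1|_].
  case: (hp_insert h1 vxL) => [|]; first by rewrite EC.
  rewrite c1 dxv; move: dv sz; case: (arc v p); case: (arc q v) => /=; card_lia.
case: (hp_insert hS vL) => [h1|].
  case: (hp_insert h1 xvL) => [|]; first by rewrite EC'.
  rewrite c2 -dx dx0; move: sz; case: (arc x0 p); case: (arc q x0) => /=; card_lia.
rewrite cS; move: dv sz nvx.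
by case: (arc v p); case: (arc q v); case: (arc v x0); case: (arc x0 v) => //=; card_lia.
Qed.

End Ends.

Lemma single_cyc : exists T v1 vk, cyc (x0 :: v1 :: T ++ [:: vk]).
Proof.
have [w cl] := hcyc_cyc hC x0_y; have sz := cyc_size cl.
case: w cl sz => [|v1 w] cl sz; first by move: sz n4 => /=; card_lia.
case/lastP: w cl sz => [|T vk] cl sz; first by move: sz n4 => /=; card_lia.
by exists T, v1, vk; rewrite cats1.
Qed.

(** The assumption forces d(x0) = n. If the two ends have the same type, or if [y] can replace [x0]
    on the cycle, then d(x0) < n; for crossed ends, [star2] and [end_low] disagree about their
    degrees. *)
Lemma single_tight : 2 * n < deg x0 + deg y + 3 -> False.
Proof.
move=> D; have dx0 : deg x0 = n by move: D deg_y' x0n; card_lia.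
have [T [v1 [vk cl]]] := single_cyc.
have v1X : nX v1 by apply: (w_nX cl); rewrite inE eqxx.
have vkX : nX vk by apply: (w_nX cl); rewrite !(inE, mem_cat) eqxx !orbT.
have nil_X z : z \in ([::] : seq V) -> z \in X by [].
have same_end := @ends_same_deg [::] T [::] v1 vk cl nil_X nil_X v1X vkX.
have sz := w_size cl; have ww := w_walk cl; have alt := w_alt cl.
case: (boolP (arc y v1)) same_end => y1; case: (boolP (arc y vk)) => yk same_end.
- by have := same_end erefl; rewrite dx0; card_lia.
- have vky : arc vk y by rewrite (type vkX).
  by have := missed_deg irr nb (twin_cycle cl y1 vky); rewrite dx0; card_lia.
- have v1y : arc v1 y by rewrite (type v1X).
  have [c1 c2] := crossed_ends cl v1y yk.
  have [kx ky kn] := out_facts yk.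
  have [lx ly ln] := in_facts v1y.
  have := star2 kx ky lx ly c1 kn c2 ln.
  case: T cl alt sz ww {same_end} => [|v2 T'] cl alt sz ww; first by move: sz n5 => /= <-.
  have yv2 : arc y v2 by move: alt => /= /andP[+ _]; rewrite (negbTE y1); case: (arc y v2).
  have lk : deg v1 <= n.
    have w2 : walk arc (v2 :: T' ++ [:: vk]) v2 vk.
      by have := @walk_split _ arc [:: v1] v2 (T' ++ [:: vk]) v1 vk ww => -[].
    apply: (end_low cl dx0 w2) => //; [by perm_count | by rewrite sameE yv2 yk | by rewrite (negbTE c2)].
  have l1 : deg vk <= n.
    case/lastP ET : (v2 :: T') => [|T2 vp] //; rewrite -cats1 in ET.
    rewrite ET in cl ww alt.
    have w2 : walk arc (v1 :: T2 ++ [:: vp]) v1 vp.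
      have := @walk_split _ arc (v1 :: T2) vp [:: vk] v1 vk; rewrite -cats1 /= => H.
      by have [] // := H; rewrite -[vp :: _]/([:: vp] ++ [:: vk]) catA.
    have vpX : nX vp by apply: (w_nX cl); rewrite !(inE, mem_cat) eqxx !orbT.
    have nvp : ~~ arc y vp by move: alt; rewrite cat_path last_cat /= yk => /andP[_]; case: (arc y vp).
    apply: (end_low cl dx0 w2) => //; [by perm_count | | by rewrite (negbTE c1) andbF].
    by rewrite (same_type irr A0 nb n4 hC v1X vpX) (negbTE y1) (negbTE nvp).
  by move: lk l1; card_lia.
- by have := same_end erefl; rewrite dx0; card_lia.
Qed.

Section Twin.
Hypothesis D3 : deg x0 + deg y + 3 <= 2 * n.

(** Crossed ends contradict [all_hit]. So the cycle runs from an out-neighbour to an in-neighbour of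
    [y], the types balance, and [big_sides] gives at least three of each. *)
Lemma twin_shape : exists o1 j1 o2 j2 o3 t vk,
  [/\ cyc [:: x0, o1, j1, o2, j2, o3 & t ++ [:: vk]],
      [/\ arc y o1, arc j1 y, arc y o2, arc j2 y & arc y o3], arc vk y &
      #|outs y| = #|ins y|].
Proof.
have [T [v1 [vk cl]]] := single_cyc.
have v1X : nX v1 by apply: (w_nX cl); rewrite inE eqxx.
have vkX : nX vk by apply: (w_nX cl); rewrite !(inE, mem_cat) eqxx !orbT.
have nil_X z : z \in ([::] : seq V) -> z \in X by [].
have := @ends_differ [::] T [::] v1 vk cl nil_X nil_X v1X vkX D3.
have sz := w_size cl; have ww := w_walk cl; have alt := w_alt cl; have wX := w_nX cl.
case: (boolP (arc y v1)); case: (boolP (arc y vk)) => yk y1 // _; last first.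
  have v1y : arc v1 y by rewrite (type v1X).
  by have [/negP[]] := crossed_ends cl v1y yk; apply: ((all_hit D3).1).
have vky : arc vk y by rewrite (type vkX).
have cnt : #|outs y| = #|ins y|.
  have := alternating_count alt; rewrite last_cat /= y1 yk /=.
  have [ul _ E] := cl; have uw : uniq (v1 :: T ++ [:: vk]) by case/andP: ul.
  have Eo : #|outs y| = count (arc y) (v1 :: T ++ [:: vk]).
    rewrite -size_filter -card_set_seq ?filter_uniq //; apply: eq_card => z; rewrite !inE mem_filter.
    case: (boolP (arc y z)) => //= yz; have [zx zy _] := out_facts yz.
    by have := cyc_mem z cl; rewrite zy inE (negbTE zx).
  have Ei : #|ins y| = count (predC (arc y)) (v1 :: T ++ [:: vk]).
    rewrite -size_filter -card_set_seq ?filter_uniq //; apply: eq_card => z; rewrite !inE mem_filter.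
    case: (boolP (arc z y)) => /= zy.
      have [zx zy' ->] := in_facts zy.
      by have := cyc_mem z cl; rewrite zy' inE (negbTE zx).
    by apply/esym/negbTE/negP => /andP[yz /wX/type]; rewrite yz (negbTE zy).
  by rewrite /= y1 in Eo Ei *; rewrite Eo Ei; card_lia.
have sd : 3 <= #|outs y| by move: big_sides D3 => [+ _]; card_lia.
have tX z : z \in T -> arc z y = ~~ arc y z.
  by move=> zT; apply/type/wX; rewrite !(inE, mem_cat) zT orbT.
have sz' : #|outs y| + #|ins y| + 2 = n by rewrite -degD deg_y'.
case: T cl sz alt tX {ww wX} => [|j1 [|o2 [|j2 [|o3 t]]]] cl sz alt tX;
  try by move: sz sz' sd; rewrite cnt /=; card_lia.
exists v1, j1, o2, j2, o3, t, vk.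
have := tX j1; have := tX o2; have := tX j2; rewrite !inE !eqxx !orbT => /(_ isT) t3 /(_ isT) t2 /(_ isT) t1.
move: alt => /= /and5P[]; rewrite y1 t1 t3.
by case: (arc y j1); case: (arc y o2); case: (arc y j2); case: (arc y o3).
Qed.

(* Here x0 and y are twins, and the first in-neighbour j1 of y gets so small a degree that it
   lies in a bad pair. *)
Lemma twin_false : False.
Proof.
have [o1 [j1 [o2 [j2 [o3 [t [vk [cl [yo1 j1y yo2 j2y yo3] vky cnt]]]]]]]] := twin_shape.
set w := [:: o1, j1, o2, j2, o3 & t ++ [:: vk]] in cl.
have [hO hJ] := (all_hit D3); set a := #|outs y| in cnt.
have [ul cc E] := cl; have sz := cyc_size cl.
have an : 2 * a + 2 = n by have := deg_y'; rewrite degD -/a -cnt; card_lia.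
have hx : hcyc [set~ x0] by exact: (@twin_cycle [:: j1, o2, j2, o3 & t] o1 vk cl).
(* A cycle misses only [x0] too, so its half-degrees are at most (n - 1) / 2, that is at most [a];
   they include those of [y], which equal [a]. *)
have [eo ei] : outs x0 = outs y /\ ins x0 = ins y.
  have [h1 h2] := half_degrees irr nb hx.
  split; apply/esym/eqP; rewrite eqEcard.
    apply/andP; split; first by apply/subsetP => z; rewrite !inE => /hO.
    by rewrite -/a; move: h1 an; card_lia.
  apply/andP; split; first by apply/subsetP => z; rewrite !inE => /hJ.
  by rewrite -cnt; move: h2 an; card_lia.
have dx0 : deg x0 = 2 * a by rewrite degD eo ei -/a -cnt; card_lia.
have dy : deg y = 2 * a by rewrite degD -/a -cnt; card_lia.
have inJ j : arc j y -> a + 4 <= #|ins j|.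
  move=> jy; have [jx jy' yj] := in_facts jy.
  have yx : y != x0 by rewrite eq_sym x0_y.
  have nadj : ~~ adjacent arc y x0 by rewrite adjacentC X_nadj.
  have [yj' xj] : y != j /\ x0 != j by rewrite ![_ == j]eq_sym.
  have := A0_out A0 yx xj yj' nadj yj.
  by rewrite dx0 dy -/a; move: an; card_lia.
have outO o : arc y o -> a + 4 <= #|outs o|.
  move=> yO; have [ox oy oy'] := out_facts yO.
  have yx : y != x0 by rewrite eq_sym x0_y.
  have nadj : ~~ adjacent arc y x0 by rewrite adjacentC X_nadj.
  have [yo xo] : y != o /\ x0 != o by rewrite ![_ == o]eq_sym.
  have := A0_in A0 yx xo yo nadj oy'.
  by rewrite dx0 dy -cnt; move: an; card_lia.
have ww : walk arc w o1 vk by exact: (@w_walk [:: j1, o2, j2, o3 & t] o1 vk cl).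
have [oj jo oj2 jo2] : [/\ arc o1 j1, arc j1 o2, arc o2 j2 & arc j2 o3].
  by case: ww => s [/= [<-] /and5P[-> -> -> -> _]].
have w3 : walk arc (o3 :: t ++ [:: vk]) o3 vk.
  by have := @walk_split _ arc [:: o1; j1; o2; j2] o3 (t ++ [:: vk]) o1 vk ww => -[].
have W z := walk1 arc z.
(* The Hamiltonian path o2, j2, x0, o3, ..., vk, y, o1, j1 admits no arc from its first to its last
   vertex. *)
have n1 : ~~ arc o2 j1.
  apply: (no_bypass_hp nb); apply: (walk_setT cl).
    apply: (walk_cat (W o2) _ oj2); apply: (walk_cat (W j2) _ (hJ _ j2y)).
      apply: (walk_cat (W x0) _ (hO _ yo3)); apply: (walk_cat w3 _ vky).
      by apply: (walk_cat (W y) _ yo1); apply: (walk_cat (W o1) (W j1) oj).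
  by rewrite /w; perm_count.
have n2 : ~~ arc j1 o1.
  apply: (no_bypass_hp nb); apply: (walk_setT cl).
    apply: (walk_cat (W j1) _ jo); apply: (walk_cat (W o2) _ oj2).
      apply: (walk_cat (W j2) _ (hJ _ j2y)); apply: (walk_cat (W x0) _ (hO _ yo3)).
      by apply: (walk_cat w3 _ vky); apply: (walk_cat (W y) (W o1) yo1).
  by rewrite /w; perm_count.
(* This arc would give a cycle missing only [o2], whose out-degree is too large for that. *)
have n3 : ~~ arc j1 j2.
  apply/negP => a12; have h : hp [set~ o2] j1 o1.
    apply: (walk_missing cl).
      apply: (walk_cat (W j1) _ a12); apply: (walk_cat (W j2) _ j2y).
        apply: (walk_cat (W y) _ yo3); apply: (walk_cat w3 _ (hJ _ vky)).
        exact: (walk_cat (W x0) (W o1) (hO _ yo1)).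
    by rewrite /w; perm_count.
  have ho2 : hcyc [set~ o2] by exists j1, o1.
  by have [h1 _] := half_degrees irr nb ho2; have := outO o2 yo2; move: h1 an; card_lia.
have [j1x j1y' yj1] := in_facts j1y.
have n4' : ~~ arc x0 j1 by have /setP/(_ j1) := eo; rewrite !inE => ->.
have up : uniq ([:: o1, j1, o2, j2 & (o3 :: t ++ [:: vk])] ++ [:: x0]).
  rewrite (perm_uniq (s2 := x0 :: w)) //; rewrite /w; perm_count.
pose P := [set z in [:: j2, o3 & t ++ [:: vk]] ++ [:: x0]].
have hP : hp P j2 x0.
  apply: walk_hp; last by move: up => /= /and4P[_ _ _ ->].
  have := walk_cat (W j2) (walk_cat w3 (W x0) (hJ _ vky)) jo2; by rewrite /= -?catA.
have [o1P j1P o2P] : [/\ o1 \notin P, j1 \notin P & o2 \notin P].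
  rewrite /P !in_set; move: up => /= /and4P[h1 h2 h3 _]; split.
  - by apply: contra h1; rewrite !in_cons => ->; rewrite !orbT.
  - by apply: contra h2; rewrite !in_cons => ->; rewrite !orbT.
  - by apply: contra h3; rewrite !in_cons => ->.
have [o1j1 o1o2 j1o2] : [/\ o1 != j1, o1 != o2 & j1 != o2].
  by move: up => /=; rewrite !in_cons !negb_or => /and4P[/and4P[-> -> _ _] /and3P[-> _ _] _ _].
have EC : o1 |: (o2 |: (j1 |: P)) = C.
  rewrite -E /w; apply/setP => z; rewrite !(inE, mem_cat).
  by do !case: (_ == _); rewrite ?orbT ?orbF.
(* If [j1] fitted, putting [o2] in front and [o1] behind would give a Hamiltonian path of C between
   two out-neighbours of [y]. *)
have dP : dd j1 P < #|P|.
  case: (hp_insert hP j1P) => [h1|].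
    have h2 : hp C o2 o1.
      rewrite -EC; apply: hp_consr; last by rewrite !in_setU1 !negb_or o1o2 o1j1.
        apply: hp_consl h1 oj2 _; by rewrite in_setU1 negb_or eq_sym j1o2.
      exact: hO.
    by have := no_hp_same nb h2; rewrite sameE yo1 yo2.
  by rewrite (negbTE n3) (negbTE n4') !addn0.
have cP : #|P| + 4 = n.
  have := card_C y; rewrite -EC !cardsU1 !in_setU1 !negb_or o1o2 o1j1 o1P eq_sym j1o2 o2P j1P /=.
  by card_lia.
have dj1 : deg j1 + 2 <= n.
  rewrite (deg_split arc j1 [set y]) dd1 j1y (negbTE yj1) -EC.
  rewrite setUC ddU; last by rewrite disjoint_sym disjoints1 !in_setU1 !negb_or o1o2 o1j1.
  rewrite setUC ddU; last by rewrite disjoint_sym disjoints1 in_setU1 negb_or eq_sym j1o2.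
  rewrite setUC ddU; last by rewrite disjoint_sym disjoints1.
  by rewrite !dd1 irr oj jo (negbTE n1) (negbTE n2) /=; move: dP cP; card_lia.
have [v vj nv] : exists2 v, v != j1 & ~~ adjacent arc j1 v.
  have : ~~ ([set~ j1] \subset outs j1 :|: ins j1).
    apply/negP => /subset_leq_card; have := (leq_card_setU (outs j1) (ins j1)).1.
    by have := card_C j1; move: dj1; rewrite degD; card_lia.
  by case/subsetPn => v; rewrite !inE => vj nv; exists v.
have vX : nX v.
  apply: single_nX; apply: contraNneq nv => ->; rewrite /adjacent ?j1y //.
  by rewrite hJ.
have dv : deg v <= n := low_all irr A0 nb n4 str hC (X_gt0) (low_all_runs D3) vX.
(* The out-degree of [j1] is at most (n - 2) - (a + 4) = a - 4, so some out-neighbour of [y] other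
   than [v] is not reached from [j1]. *)
have [o oO on] : exists2 o, o \in outs y & o \notin v |: outs j1.
  have : ~~ (outs y \subset v |: outs j1).
    apply/negP => /subset_leq_card; rewrite cardsU1 -/a.
    have := inJ j1 j1y; move: dj1 an; rewrite degD; case: (v \notin _) => /=; card_lia.
  by case/subsetPn => o; exists o.
move: oO on; rewrite !inE negb_or => yo /andP[ov nj1o].
have [ox oy oy'] := out_facts yo.
have j1o : j1 != o by apply: contraTneq yo => <-.
have jv : j1 != v by rewrite eq_sym.
have vo : v != o by rewrite eq_sym.
have dgo : deg o <= n.
  by apply: (low_all irr A0 nb n4 str hC (X_gt0) (low_all_runs D3)); rewrite nXE yo.
have := A0_out A0 jv vo j1o nv nj1o; have := inJ j1 j1y; have := outO o yo.
by move: dj1 an dv dgo; rewrite [deg j1]degD [deg o]degD; card_lia.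
Qed.

End Twin.

End Single.
End Special.

(** * No non-neighbours *)

Section NoNonneighbour.
Variables (V : finType) (arc : rel V).
Hypothesis irr : irreflexive arc.
Hypothesis A0 : condA0 arc.
Hypothesis nb : ~ has_ham_bypass arc.
Hypothesis n4 : 4 <= #|V|.
Hypothesis str : strongly_connected arc.
Local Notation n := #|V|.
Local Notation outs := (outs arc).
Local Notation ins := (ins arc).
Local Notation deg := (deg arc).
Local Notation hp := (hp arc).
Local Notation hcyc := (hcyc arc).
Local Notation dd := (dd arc).
Local Notation cyc := (cyc arc).

Lemma all_neighbours y v : hcyc [set~ y] -> v != y -> nX arc y v.
Proof.
move=> hC vy; apply/negPn; rewrite -X_nX //; apply/negP => vX.
case: (classic (exists2 x0, x0 \in X arc y & deg x0 <= n)) => [[x0 x0X x0n]|no]; last first.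
  apply: (ordinary_false irr A0 nb n4 str hC).
    by apply/card_gt0P; exists v.
  move=> x xX; rewrite addn1 ltnNge; apply/negP => le; apply: no; by exists x.
have dy := deg_y irr A0 nb n4 hC x0n; have X1 := X_gt0 x0X.
(* As d(y) = n - 1 - |X| and d(x0) <= n, a failure of this inequality forces |X| = 1. *)
case: (leqP (deg x0 + deg y + 3) (2 * n)) => D3; last first.
  apply: (single_tight irr A0 nb n4 str hC x0X x0n _ D3).
  by move: D3 dy X1 x0n; card_lia.
case: (leqP 2 #|X arc y|) => X2; first exact: (special_many irr A0 nb n4 str hC x0X x0n D3 X2).
apply: (twin_false irr A0 nb n4 str hC x0X x0n _ D3).
by move: X1 X2; card_lia.
Qed.

Lemma type_out y v : hcyc [set~ y] -> v != y -> arc v y = ~~ arc y v.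
Proof. by move=> hC vy; apply: (nX_type irr A0 nb n4 hC); apply: all_neighbours. Qed.

Lemma consecutive_types y l1 u w l2 : cyc y (l1 ++ u :: w :: l2) -> arc y u != arc y w.
Proof.
move=> cl; have hC : hcyc [set~ y] by apply: (cyc_hcyc cl); case: l1 {cl}.
have ns := cyc_no_same nb cl; apply/negP => /eqP E; case/negP: ns.
have inC z : z \in l1 ++ u :: w :: l2 -> nX arc y z.
  by move=> zl; apply: all_neighbours => //; rewrite -(cyc_mem z cl).
by rewrite (same_type irr A0 nb n4 hC) ?E // inC // mem_cat !inE eqxx ?orbT.
Qed.

Lemma missing_cyc y x l L p q : cyc y l -> walk arc L p q -> arc q p -> perm_eq (x :: L) (y :: l) ->
  cyc x L.
Proof.
move=> cl w qp pe; have [/= /andP[xL uL] E] := cyc_perm_setT cl pe.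
split=> //; first by case: w => s [-> ps ls]; rewrite /= rcons_path ps ls.
apply/setP => z; move/setP/(_ z): E; rewrite !inE.
by case: (eqVneq z x) => [->|_] /=; rewrite ?(negbTE xL).
Qed.

Variable y : V.
Hypothesis hC : hcyc [set~ y].

Lemma cyc_types4 u w l : cyc y (u :: w :: l) -> exists a b l', [/\ l = [:: a, b & l'],
  arc y u != arc y w, arc y w != arc y a & arc y a != arc y b].
Proof.
move=> cl; have sz := cyc_size cl; have e1 := @consecutive_types y [::] u w l cl.
case: l cl sz => [|a l] cl sz; first by move: sz n4 => /= <-.
have e2 := @consecutive_types y [:: u] w a l cl.
case: l cl sz => [|b l] cl sz; last first.
  have e3 := @consecutive_types y [:: u; w] a b l cl; by exists a, b, l.
have e3 := @consecutive_types y [::] a u [:: w] (cyc_rot (l1 := [:: u; w]) cl).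
by move: e1 e2 e3; case: (arc y u); case: (arc y w); case: (arc y a).
Qed.

Lemma cyc_y l z : cyc y l -> z \in l -> arc z y = ~~ arc y z.
Proof. by move=> cl zl; apply: type_out => //; rewrite -(cyc_mem z cl). Qed.

(** Between an in-neighbour and the following out-neighbour [y] can be placed, which gives a
    Hamiltonian path from [w] to [u]. *)
Lemma no_back u w l : cyc y (u :: w :: l) -> ~~ arc w u.
Proof.
move=> cl; have [a [b [l' [El e1 e2 e3]]]] := cyc_types4 cl; subst l.
have ww : walk arc [:: w, a, b & l' ++ [:: u]] w u.
  have := @cyc_walk _ arc y [::] w [:: a, b & l' ++ [:: u]] [::].
  rewrite /= last_cat cats0; apply.
  by have := cyc_rot (l1 := [:: u]) cl.
have tw := cyc_y cl (z := w); have ta := cyc_y cl (z := a).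
rewrite !inE !eqxx !orbT in tw ta; have {}tw := tw isT; have {}ta := ta isT.
apply: (no_bypass_hp nb); case: (boolP (arc y w)) e2 tw => yw e2 tw.
  have ya : ~~ arc y a by move: e2; case: (arc y a).
  have yb : arc y b by move: e3; rewrite (negbTE ya); case: (arc y b).
  have ay : arc a y by rewrite ta.
  have w2 := @walk_host _ arc _ w u [:: w] a [::] b (l' ++ [:: u]) y ww erefl ay yb.
  by apply: (walk_setT cl w2); perm_count.
have ya : arc y a by move: e2; case: (arc y a).
have w2 := @walk_host _ arc _ w u [::] w [::] a [:: b & l' ++ [:: u]] y ww erefl tw ya.
by apply: (walk_setT cl w2); perm_count.
Qed.

Section Long.
Hypothesis n7 : 7 <= n.

(* A chord u -> w that skips x gives cycles missing x, in which y may be hosted at two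
   different places; the neighbours of x must alternate along both. *)
Lemma no_skip u x w l : cyc y [:: u, x, w & l] -> ~~ arc u w.
Proof.
move=> cl; have sz := cyc_size cl; have e1 := @consecutive_types y [::] u x (w :: l) cl.
have e2 := @consecutive_types y [:: u] x w l cl.
case: l cl sz => [|a [|b [|c l]]] cl sz; try by move: sz n7 => /= <-.
have e3 := @consecutive_types y [:: u; x] w a [:: b, c & l] cl.
have e4 := @consecutive_types y [:: u; x; w] a b (c :: l) cl.
have e5 := @consecutive_types y [:: u; x; w; a] b c l cl.
apply/negP => uw.
have ww : walk arc [:: w, a, b, c & l ++ [:: u]] w u.
  have := @cyc_walk _ arc y [:: x] w [:: a, b, c & l ++ [:: u]] [::].
  rewrite /= last_cat cats0; apply.
  by have := cyc_rot (l1 := [:: u]) cl.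
have T z : z \in [:: u, x, w, a, b, c & l] -> arc z y = ~~ arc y z by exact: cyc_y cl.
have twy := T w; have tay := T a; have tby := T b; have tcy := T c.
rewrite !inE !eqxx !orbT in twy tay tby tcy.
have {}twy := twy isT; have {}tay := tay isT; have {}tby := tby isT; have {}tcy := tcy isT.
case: (boolP (arc y x)) => yx.
  have [yw ya yb yc] : [/\ arc y w = false, arc y a, arc y b = false & arc y c].
    by move: e2 e3 e4 e5; rewrite yx; case: (arc y w); case: (arc y a); case: (arc y b); case: (arc y c).
  rewrite yw in twy; rewrite yb in tby.
  have w1 := @walk_host _ arc _ w u [::] w [::] a [:: b, c & l ++ [:: u]] y ww erefl twy ya.
  have w2 := @walk_host _ arc _ w u [:: w; a] b [::] c (l ++ [:: u]) y ww erefl tby yc.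
  have c1 : cyc x ([:: w; y; a; b; c] ++ l ++ [:: u]) by apply: (missing_cyc cl w1 uw); perm_count.
  have c2 : cyc x ([:: w; a; b; y; c] ++ l ++ [:: u]) by apply: (missing_cyc cl w2 uw); perm_count.
  (* With respect to [x] the first cycle makes y, a and a, b opposite, and the second b, y: three
     vertices of two types. The other branch uses b, c and y in the same way. *)
  have := @consecutive_types x [:: w] y a _ c1; have := @consecutive_types x [:: w; y] a b _ c1.
  have := @consecutive_types x [:: w; a] b y _ c2.
  by case: (arc x y); case: (arc x a); case: (arc x b).
have [d [s Es]] : exists d s, l ++ [:: u] = d :: s by case: (l) => [|d s]; [exists u, [::]|exists d, (s ++ [:: u])].
have yd : arc y d != arc y c.
  case: l Es cl {sz ww T} => [|d' l'] /= [<- _] cl; last first.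
    by have := @consecutive_types y [:: u; x; w; a; b] c d' l' cl; rewrite eq_sym.
  have := @consecutive_types y [::] c u [:: x; w; a; b] (cyc_rot (l1 := [:: u; x; w; a; b]) cl).
  by rewrite eq_sym.
have [yw ya yb yc yd'] : [/\ arc y w, arc y a = false, arc y b, arc y c = false & arc y d].
  move: e2 e3 e4 e5 yd; rewrite (negbTE yx).
  by case: (arc y w); case: (arc y a); case: (arc y b); case: (arc y c); case: (arc y d).
rewrite ya in tay; rewrite yc in tcy; rewrite Es in ww.
have w1 := @walk_host _ arc _ w u [:: w] a [::] b [:: c, d & s] y ww erefl tay yb.
have w2 := @walk_host _ arc _ w u [:: w; a; b] c [::] d s y ww erefl tcy yd'.
have pe : perm_eq [:: x, y, w, a, b, c, d & s] (y :: [:: u, x, w, a, b, c & l]).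
  by rewrite -Es; perm_count.
have c1 : cyc x ([:: w; a; y; b; c; d] ++ s).
  by apply: (missing_cyc cl w1 uw); apply: perm_trans pe; perm_count.
have c2 : cyc x ([:: w; a; b; c; y; d] ++ s).
  by apply: (missing_cyc cl w2 uw); apply: perm_trans pe; perm_count.
have := @consecutive_types x [:: w; a] y b _ c1; have := @consecutive_types x [:: w; a; y] b c _ c1.
have := @consecutive_types x [:: w; a; b] c y _ c2.
by case: (arc x y); case: (arc x b); case: (arc x c).
Qed.

(** The cycle neighbours u, w of [x] have the same type, so [x] does not fit into the path on the
    other n - 4 vertices, to whose ends it has no useful arcs by [no_skip]. This leaves at most n -
    5 arcs there and one each with [y], u and w. *)
Lemma deg_small x : x != y -> deg x + 2 <= n.
Proof.
move=> xy; have [l0 cl] := hcyc_cyc hC xy; have sz := cyc_size cl.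
case: l0 cl sz => [|w [|a s]] cl sz; try by move: sz n7 => /= <-.
case/lastP: s cl sz => [|s u] cl sz; first by move: sz n7 => /= <-.
rewrite -cats1 in cl; set z := last a s.
have bw := no_back cl.
have cu : cyc y [:: u, x, w, a & s] by have := cyc_rot (l1 := [:: x, w, a & s]) cl.
have bu := no_back cu; have sa := no_skip cl.
have sk : ~~ arc z x.
  have [s' Es] : exists s', a :: s = s' ++ [:: z].
    by exists (belast a s); rewrite cats1 -lastI.
  have c3 : cyc y ([:: x, w & s'] ++ [:: z; u]).
    by have := cl; rewrite -[a :: s ++ _]/((a :: s) ++ _) Es -catA.
  exact: (no_skip (l := w :: s') (cyc_rot c3)).
have [ul _ E] := cl; pose P := [set v in a :: s].
have ua : [&& x \notin P, w \notin P, u \notin P, x != w, x != u, w != u & uniq (a :: s)].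
  have : uniq [:: x, w, u, a & s].
    by rewrite (perm_uniq (s2 := [:: x, w, a & s ++ [:: u]])) //; perm_count.
  rewrite /P !in_set /= !(in_cons a) => /and4P[]; rewrite !in_cons !negb_or.
  by move=> /and4P[-> -> -> ->] /and3P[-> -> ->] /andP[-> ->] /andP[-> ->].
case/and5P: ua => xP wP uP xw /and3P[xu wu us].
have w1 : walk arc (a :: s) a z by apply: (@cyc_walk _ arc y [:: x; w] a s [:: u]).
have hP : hp P a z := walk_hp w1 us.
have [wa zu] : arc w a /\ arc z u.
  have [_ + _] := cl; by rewrite /= rcons_cat cat_path /= => /and5P[_ -> _ ->].
have EC : u |: (w |: (x |: P)) = [set~ y].
  rewrite -E; apply/setP => v; rewrite !(inE, mem_cat).
  by do !case: (_ == _); rewrite ?orbT ?orbF.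
have dP : dd x P < #|P|.
  case: (hp_insert hP xP) => [h1|].
    have h2 : hp [set~ y] w u.
      rewrite -EC; apply: hp_consr; last by rewrite !in_setU1 !negb_or eq_sym wu eq_sym xu.
        by apply: hp_consl h1 wa _; rewrite in_setU1 negb_or eq_sym xw.
      exact: zu.
    have := no_hp_same nb h2; rewrite (same_type irr A0 nb n4 hC); last first.
    - by apply: all_neighbours => //; rewrite -(cyc_mem u cu) inE eqxx.
    - by apply: all_neighbours => //; rewrite -(cyc_mem w cu) !inE eqxx !orbT.
    have := @consecutive_types y [::] u x _ cu; have := @consecutive_types y [:: u] x w _ cu.
    by case: (arc y u); case: (arc y x); case: (arc y w).
  by rewrite (negbTE sa) (negbTE sk) !addn0.
have cP : #|P| + 4 = n.
  have := card_C y; rewrite -EC !cardsU1 !in_setU1 !negb_or eq_sym wu eq_sym xu uP eq_sym xw wP xP /=.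
  by card_lia.
rewrite (deg_split arc x [set y]) dd1 (type_out hC xy) -EC.
rewrite setUC ddU; last by rewrite disjoint_sym disjoints1 !in_setU1 !negb_or eq_sym wu eq_sym xu.
rewrite setUC ddU; last by rewrite disjoint_sym disjoints1 in_setU1 negb_or eq_sym xw.
rewrite setUC ddU; last by rewrite disjoint_sym disjoints1.
rewrite !dd1 irr (negbTE bw) (negbTE bu); move: dP cP.
by case: (arc y x); case: (arc x w); case: (arc u x) => /=; card_lia.
Qed.

Lemma pred_oneway x : x != y -> exists u, [/\ u != y, arc u x & ~~ arc x u].
Proof.
move=> xy; have [l cl] := hcyc_cyc hC xy; have sz := cyc_size cl.
case/lastP: l cl sz => [|l u] cl sz; first by move: sz n7 => /= <-.
rewrite -cats1 in cl; have cu : cyc y [:: u, x & l] by have := cyc_rot (l1 := x :: l) cl.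
exists u; split; last exact: no_back cu.
  by rewrite -(cyc_mem u cu) inE eqxx.
by case: cu => _ /= /andP[].
Qed.

Lemma long_false : False.
Proof.
(* Descent to the predecessor u: [deg_small] leaves a vertex v non-adjacent to [x], and A_0 for [x],
   v, u gives u in-degree at least n + 2 minus the out-degree of [x], while d(u) <= n - 2. *)
have H k x : x != y -> #|outs x| < k -> False.
  elim: k x => // k IH x xy xk; have [u [uy ux xu]] := pred_oneway xy.
  have dx := deg_small xy.
  have [v vx nv] : exists2 v, v != x & ~~ adjacent arc x v.
    have : ~~ ([set~ x] \subset outs x :|: ins x).
      apply/negP => /subset_leq_card; have := (leq_card_setU (outs x) (ins x)).1.
      by have := card_C x; move: dx; rewrite degD; card_lia.
    by case/subsetPn => v; rewrite !inE => vx nv; exists v.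
  have vy : v != y.
    apply: contraNneq nv => ->; rewrite /adjacent (type_out hC xy); by case: (arc y x).
  have dv := deg_small vy; have du := deg_small uy.
  apply: (IH u uy); have xv : x != v by rewrite eq_sym.
  have vu : v != u by apply: contraNneq nv => ->; rewrite /adjacent ux orbT.
  have xu' : x != u by apply: contraTneq ux => ->; rewrite irr.
  have := A0_out A0 xv vu xu' nv xu; move: xk dx dv du; rewrite [deg u]degD; card_lia.
have [v _ vy] : exists2 v, v \in [set: V] & v != y by apply: card_ex2; rewrite cardsT; apply: leq_trans n4.
exact: H vy (ltnSn _).
Qed.

End Long.
End NoNonneighbour.

(** * Five vertices: the tournament *)

Section Short.
Variables (V : finType) (arc : rel V).
Hypothesis irr : irreflexive arc.
Hypothesis A0 : condA0 arc.
Hypothesis nb : ~ has_ham_bypass arc.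
Hypothesis n4 : 4 <= #|V|.
Hypothesis str : strongly_connected arc.
Local Notation n := #|V|.
Local Notation hcyc := (hcyc arc).
Local Notation cyc := (cyc arc).

Lemma isomorphic_T5 (l : seq V) (v : V) : uniq l -> size l = 5 -> n = 5 ->
  (forall i j : 'I_5, arc (nth v l i) (nth v l j) = T5 i j) -> isomorphic arc T5.
Proof.
move=> ul sl n5 H; pose g (i : 'I_5) := nth v l i.
have gi : injective g.
  by move=> i j /eqP; rewrite nth_uniq ?sl ?ltn_ord // => /eqP; exact: val_inj.
have [f fg gf] : bijective g by apply: inj_card_bij gi _; rewrite card_ord n5.
exists f; split; first by exists g.
by move=> x z; rewrite -H -/(g _) -/(g _) !gf.
Qed.

Section Quad.
Variables y o1 j1 o2 j2 : V.
Hypothesis cl : cyc y [:: o1; j1; o2; j2].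
Hypothesis yo1 : arc y o1.

Let hC : hcyc [set~ y]. Proof. exact: (cyc_hcyc cl). Qed.
Let n5 : n = 5. Proof. by rewrite -(cyc_size cl). Qed.

Lemma quad_types : [/\ arc y j1 = false, arc y o2 = true & arc y j2 = false] /\
  [/\ arc o1 y = false, arc j1 y = true, arc o2 y = false & arc j2 y = true].
Proof.
have ty z : z \in [:: o1; j1; o2; j2] -> arc z y = ~~ arc y z.
  by move=> zl; apply: (type_out irr A0 nb n4 str hC); rewrite -(cyc_mem z cl).
rewrite !ty ?inE ?eqxx ?orbT // yo1.
have := @consecutive_types _ arc irr A0 nb n4 str y [::] o1 j1 _ cl.
have := @consecutive_types _ arc irr A0 nb n4 str y [:: o1] j1 o2 _ cl.
have := @consecutive_types _ arc irr A0 nb n4 str y [:: o1; j1] o2 j2 _ cl.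
by rewrite yo1; case: (arc y j1); case: (arc y o2); case: (arc y j2).
Qed.

Lemma quad_arcs : [/\ arc o1 j1 = true, arc j1 o2 = true, arc o2 j2 = true & arc j2 o1 = true] /\
  [/\ arc j1 o1 = false, arc o2 j1 = false, arc j2 o2 = false & arc o1 j2 = false].
Proof.
split; first by have [_ + _] := cl; rewrite /= andbT => /and4P[].
have nbk := no_back irr A0 nb n4 str hC.
split; apply/negbTE.
- exact: nbk cl.
- exact: nbk (cyc_rot (l1 := [:: o1]) cl).
- exact: nbk (cyc_rot (l1 := [:: o1; j1]) cl).
- exact: nbk (cyc_rot (l1 := [:: o1; j1; o2]) cl).
Qed.

Lemma quad_count (A : {set V}) :
  #|A| = (y \in A) + (o1 \in A) + (j1 \in A) + (o2 \in A) + (j2 \in A).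
Proof.
have [u E] := cyc_perm_setT cl (perm_refl _).
by rewrite -[A]setIT -E card_setI_seq //= E !setIT !addn0 !addnA.
Qed.

Lemma quad_adjacent : adjacent arc o1 o2 /\ adjacent arc j1 j2.
Proof.
have [[y1 y2 y3] [x1 x2 x3 x4]] := quad_types; have [[a1 a2 a3 a4] [b1 b2 b3 b4]] := quad_arcs.
have [ul _ _] := cl; move: ul; rewrite /= !inE !negb_or => /and4P[/and3P[n12 n13 n14] /andP[n23 n24] n34 _].
split; apply/negPn/negP => nadj; have := nadj; rewrite /adjacent negb_or => /andP[c1 c2].
  have n32 : o2 != j1 by rewrite eq_sym.
  have := A0_in A0 n13 n32 n12 nadj; rewrite b1 => /(_ isT).
  rewrite !degD !quad_count !inE !(irr, yo1, y1, y2, y3, x1, x2, x3, x4, a1, a2, a3, a4, b1, b2, b3, b4).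
  by rewrite (negbTE c1) (negbTE c2) n5; case: (arc j1 j2).
have n43 : j2 != o2 by rewrite eq_sym.
have := A0_in A0 n24 n43 n23 nadj; rewrite b2 => /(_ isT).
rewrite !degD !quad_count !inE !(irr, yo1, y1, y2, y3, x1, x2, x3, x4, a1, a2, a3, a4, b1, b2, b3, b4).
by rewrite (negbTE c1) (negbTE c2) n5; case: (arc o2 o1).
Qed.

(** Both chords together give the cycle [j2], [y], [o1], [j1], which misses [o2]; but [o2] has the
    three in-neighbours [y], [o1], [j1], more than [half_degrees] allows. *)
Lemma quad_chords : arc o1 o2 -> ~~ arc j1 j2.
Proof.
move=> o12; apply/negP => j12.
have [[y1 y2 y3] [x1 x2 x3 x4]] := quad_types; have [[a1 a2 a3 a4] [b1 b2 b3 b4]] := quad_arcs.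
have w : walk arc [:: j2; y; o1; j1] j2 j1 by exists [:: y; o1; j1]; rewrite /= x4 yo1 a1.
have c : cyc o2 [:: j2; y; o1; j1] by apply: (missing_cyc cl w j12); perm_count.
have [_] := half_degrees irr nb (cyc_hcyc c isT).
rewrite quad_count !inE irr y2 o12 a2 n5.
by case: (arc j2 o2).
Qed.

End Quad.

Lemma quad_T5 y o1 j1 o2 j2 : cyc y [:: o1; j1; o2; j2] -> arc y o1 -> arc o1 o2 -> isomorphic arc T5.
Proof.
move=> cl yo1 o12; have cl' := cyc_rot (l1 := [:: o1; j1]) cl.
have [[y1 y2 y3] [x1 x2 x3 x4]] := quad_types cl yo1.
have [[a1 a2 a3 a4] [b1 b2 b3 b4]] := quad_arcs cl.
have j12 : arc j1 j2 = false by apply/negbTE/(quad_chords cl yo1).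
have j21 : arc j2 j1 by have [_] := quad_adjacent cl yo1; rewrite /adjacent j12.
have o21 : arc o2 o1 = false.
  by apply/negbTE/negP => /(quad_chords cl' y2); rewrite j21.
(* This order corresponds to x1, x2, x3, x4, y in T(5). *)
have pe : perm_eq [:: j2; o1; j1; o2; y] [:: y; o1; j1; o2; j2] by perm_count.
have [u _] := cyc_perm_setT cl pe.
apply: (@isomorphic_T5 [:: j2; o1; j1; o2; y] y) => //.
  by rewrite -(cyc_size cl).
by case=> [[|[|[|[|[|i]]]]] iP] // [[|[|[|[|[|k]]]]] kP] //=;
  rewrite ?(irr, yo1, o12, j21, j12, o21, y1, y2, y3, x1, x2, x3, x4, a1, a2, a3, a4, b1, b2, b3, b4).
Qed.

End Short.

Theorem theorem12 (V : finType) (arc : rel V) :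
  irreflexive arc ->
  4 <= #|V| ->
  strongly_connected arc ->
  condA0 arc ->
  has_ham_bypass arc \/ isomorphic arc T5.
Proof.
move=> irr n4 str A0; case: (classic (has_ham_bypass arc)) => [|nb]; [by left | right].
have [y hC] := pre_hamiltonian irr A0 n4 str nb.
have [o1 yo1] := outs_ex n4 str y.
have oy : o1 != y by apply: contraTneq yo1 => ->; rewrite irr.
have [l cl] := hcyc_cyc hC oy; have sz := cyc_size cl.
have ct := @consecutive_types _ arc irr A0 nb n4 str y.
(* Types alternate round a cycle on n - 1 vertices, so n is odd; this excludes n = 4 and n = 6. *)
case: l cl sz => [|j1 [|o2 [|j2 [|v [|u l]]]]] cl sz; try by move: n4; rewrite -sz.
- have := ct [::] _ _ _ cl; have := ct [:: o1] _ _ _ cl.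
  have := ct [::] _ _ _ (cyc_rot (l1 := [:: o1; j1]) cl).
  by case: (arc y o1); case: (arc y j1); case: (arc y o2).
- have [[_ yo2 _] _] := quad_types irr A0 nb n4 str cl yo1.
  have [/orP[o12|o21] _] := quad_adjacent irr A0 nb n4 str cl yo1.
    exact: (quad_T5 irr A0 nb n4 str cl).
  exact: (quad_T5 irr A0 nb n4 str (cyc_rot (l1 := [:: o1; j1]) cl)).
- have := ct [::] _ _ _ cl; have := ct [:: o1] _ _ _ cl; have := ct [:: o1; j1] _ _ _ cl.
  have := ct [:: o1; j1; o2] _ _ _ cl.
  have := ct [::] _ _ _ (cyc_rot (l1 := [:: o1; j1; o2; j2]) cl).
  by case: (arc y o1); case: (arc y j1); case: (arc y o2); case: (arc y j2); case: (arc y v).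
- by case: (long_false irr A0 nb n4 str hC); rewrite -sz addn1.
Qed.
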